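(* Let $d\neq 0,1$ be a square-free integer with $d\not\equiv 1 \pmod 8$, and let $p,q$ be two prime integers with $q\geq 3$ and $p\neq q$. Let $K=\mathbb{Q}(\sqrt{d})$, let $\mathcal{O}_K$ be its ring of integers and let $\Delta_K$ be the discriminant of $K$ (so $\Delta_K=d$ if $d\equiv 1\pmod 4$ and $\Delta_K=4d$ if $d\equiv 2,3 \pmod 4$). Then: (i) if $p\geq 3$ and the Legendre symbols satisfy $\left(\frac{\Delta_K}{p}\right)\neq 1$ and $\left(\frac{\Delta_K}{q}\right)\neq 1$, then the quaternion algebra $H_{\mathbb{Q}(\sqrt{d})}(p,q)$ splits; (ii) if $p=2$ and the Legendre symbol satisfies $\left(\frac{\Delta_K}{q}\right)\neq 1$, then the quaternion algebra $H_{\mathbb{Q}(\sqrt{d})}(2,q)$ splits.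
   Context: For a field $F$ of characteristic $\neq 2$ and $a,b\in F^{*}$, the quaternion algebra $H_F(a,b)$ is the $F$-algebra with basis $1,e_1,e_2,e_3$ subject to $e_1^2=a$, $e_2^2=b$, $e_3=e_1e_2=-e_2e_1$. It is said to split (over $F$) if it is isomorphic to the matrix algebra $M_2(F)$. *)

(* Defs.v *)
From HB Require Import structures.
From mathcomp Require Export all_boot all_order all_algebra all_field.
From mathcomp Require Import ring.

Set Implicit Arguments.
Unset Strict Implicit.
Unset Printing Implicit Defensive.

Import GRing.Theory.

Local Open Scope ring_scope.

(* Quat x0 x1 x2 x3 stands for x0 + x1 e1 + x2 e2 + x3 e3. The F-algebra       *)
(* structure below makes sense for all a, b and all F; it is a quaternion      *)
(* algebra in the usual sense when F has characteristic different from 2 and   *)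
(* a, b are nonzero.                                                           *)
Record quaternion (F : fieldType) (a b : F) :=
  Quat { qc0 : F; qc1 : F; qc2 : F; qc3 : F }.

Arguments Quat {F a b}.

Section QuaternionAlgebra.

Variables (F : fieldType) (a b : F).
Implicit Types x y z : quaternion a b.

Definition tuple_of_quat x := (qc0 x, qc1 x, qc2 x, qc3 x).
Definition quat_of_tuple (t : F * F * F * F) : quaternion a b :=
  let: (x0, x1, x2, x3) := t in Quat x0 x1 x2 x3.

Lemma tuple_of_quatK : cancel tuple_of_quat quat_of_tuple.
Proof. by case. Qed.

HB.instance Definition _ := Choice.copy (quaternion a b)
  (can_type tuple_of_quatK).

Definition qzero : quaternion a b := Quat 0 0 0 0.
Definition qone : quaternion a b := Quat 1 0 0 0.
Definition qopp x : quaternion a b :=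
  Quat (- qc0 x) (- qc1 x) (- qc2 x) (- qc3 x).
Definition qadd x y : quaternion a b :=
  Quat (qc0 x + qc0 y) (qc1 x + qc1 y) (qc2 x + qc2 y) (qc3 x + qc3 y).
Definition qscale (c : F) x : quaternion a b :=
  Quat (c * qc0 x) (c * qc1 x) (c * qc2 x) (c * qc3 x).

(* The bilinear product determined by e1^2 = a, e2^2 = b and                   *)
(* e3 = e1 e2 = - e2 e1; the last two relations give e3^2 = - a b,             *)
(* e1 e3 = - e3 e1 = a e2 and e3 e2 = - e2 e3 = b e1.                          *)
Definition qmul x y : quaternion a b :=
  let: Quat x0 x1 x2 x3 := x in
  let: Quat y0 y1 y2 y3 := y in
  Quat (x0 * y0 + a * x1 * y1 + b * x2 * y2 - a * b * x3 * y3)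
       (x0 * y1 + x1 * y0 - b * x2 * y3 + b * x3 * y2)
       (x0 * y2 + x2 * y0 + a * x1 * y3 - a * x3 * y1)
       (x0 * y3 + x3 * y0 + x1 * y2 - x2 * y1).

Fact qaddA : associative qadd.
Proof. by move=> [x0 x1 x2 x3] [y0 y1 y2 y3] [z0 z1 z2 z3]; congr Quat; apply: addrA. Qed.
Fact qaddC : commutative qadd.
Proof. by move=> [x0 x1 x2 x3] [y0 y1 y2 y3]; congr Quat; apply: addrC. Qed.
Fact qadd0 : left_id qzero qadd.
Proof. by move=> [x0 x1 x2 x3]; congr Quat; apply: add0r. Qed.
Fact qaddN : left_inverse qzero qopp qadd.
Proof. by move=> [x0 x1 x2 x3]; congr Quat; apply: addNr. Qed.

HB.instance Definition _ :=
  GRing.isZmodule.Build (quaternion a b) qaddA qaddC qadd0 qaddN.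

Fact qmulA : associative qmul.
Proof. by move=> [x0 x1 x2 x3] [y0 y1 y2 y3] [z0 z1 z2 z3]; congr Quat; ring. Qed.
Fact qmul1 : left_id qone qmul.
Proof. by move=> [x0 x1 x2 x3]; congr Quat; ring. Qed.
Fact qmulr1 : right_id qone qmul.
Proof. by move=> [x0 x1 x2 x3]; congr Quat; ring. Qed.
Fact qmulDl : left_distributive qmul +%R.
Proof. by move=> [x0 x1 x2 x3] [y0 y1 y2 y3] [z0 z1 z2 z3]; congr Quat => /=; ring. Qed.
Fact qmulDr : right_distributive qmul +%R.
Proof. by move=> [x0 x1 x2 x3] [y0 y1 y2 y3] [z0 z1 z2 z3]; congr Quat => /=; ring. Qed.
Fact qone_neq0 : qone != 0.
Proof. by apply/eqP => -[] /eqP; rewrite oner_eq0. Qed.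

HB.instance Definition _ := GRing.Zmodule_isNzRing.Build (quaternion a b)
  qmulA qmul1 qmulr1 qmulDl qmulDr qone_neq0.

Fact qscaleA c d x : qscale c (qscale d x) = qscale (c * d) x.
Proof. by case: x => *; congr Quat; apply: mulrA. Qed.
Fact qscale1 : left_id 1 qscale.
Proof. by case=> *; congr Quat; apply: mul1r. Qed.
Fact qscaleDr : right_distributive qscale +%R.
Proof. by move=> c [? ? ? ?] [? ? ? ?]; congr Quat; apply: mulrDr. Qed.
Fact qscaleDl x : {morph qscale^~ x : c d / c + d}.
Proof. by case: x => ? ? ? ? c d; congr Quat; apply: mulrDl. Qed.

HB.instance Definition _ := GRing.Zmodule_isLmodule.Build F (quaternion a b)
  qscaleA qscale1 qscaleDr qscaleDl.

Fact qscaleAl c x y : c *: (x * y) = c *: x * y.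
Proof. by case: x y => [? ? ? ?] [? ? ? ?]; congr Quat => /=; ring. Qed.
Fact qscaleAr c x y : c *: (x * y) = x * (c *: y).
Proof. by case: x y => [? ? ? ?] [? ? ? ?]; congr Quat => /=; ring. Qed.

HB.instance Definition _ := GRing.Lmodule_isLalgebra.Build F (quaternion a b)
  qscaleAl.
HB.instance Definition _ := GRing.Lalgebra_isAlgebra.Build F (quaternion a b)
  qscaleAr.

Definition qe1 : quaternion a b := Quat 0 1 0 0.
Definition qe2 : quaternion a b := Quat 0 0 1 0.
Definition qe3 : quaternion a b := Quat 0 0 0 1.

Lemma quat_relations :
  [/\ qe1 ^+ 2 = a%:A, qe2 ^+ 2 = b%:A, qe3 = qe1 * qe2 & qe3 = - (qe2 * qe1)].
Proof. by split; congr Quat => /=; ring. Qed.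

Lemma quat_decomp (c0 c1 c2 c3 : F) :
  Quat c0 c1 c2 c3 = c0 *: 1 + c1 *: qe1 + c2 *: qe2 + c3 *: qe3.
Proof. by congr Quat => /=; ring. Qed.

End QuaternionAlgebra.

Definition quaternion_splits (F : fieldType) (a b : F) : Prop :=
  exists f : {lrmorphism quaternion a b -> 'M[F]_2}, bijective f.

Definition square_free (d : int) : Prop :=
  forall m : int, (m ^+ 2 %| d)%Z -> m \is a GRing.unit.

Definition legendre (n : int) (p : nat) : int :=
  if (p %| n)%Z then 0
  else if [exists x : 'I_p, (x%:Z ^+ 2 == n %[mod p])%Z] then 1 else -1.

(* K = Q(sqrt d), up to isomorphism of fields. *)
Definition is_Qsqrt (d : int) (K : fieldExtType rat) : Prop :=
  exists2 s : K, s ^+ 2 = d%:~R & <<1; s>>%VS = {:K}%VS.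

Section Discriminant.

Variable K : fieldExtType rat.

Definition ring_of_integers (x : K) : Prop :=
  integralOver (intr : int -> K) x.

(* The trace of the Q-linear map y |-> y * x. *)
Definition field_trace (x : K) : rat :=
  \tr (passmx.mxof (vbasis {:K}) (vbasis {:K}) (amulr x)).

Definition integral_basis (w : seq K) : Prop :=
  basis_of {:K} w /\
  forall x, ring_of_integers x <->
    exists c : 'I_(size w) -> int, x = \sum_(i < size w) w`_i *~ c i.

Definition is_discriminant (D : int) : Prop :=
  exists2 w : seq K, integral_basis w &
    D%:~R = \det (\matrix_(i < size w, j < size w) field_trace (w`_i * w`_j)).

End Discriminant.

(* Main.v *)
(* Write K = Q(s) with s^2 = d. If p x^2 + q y^2 = p q z^2 + d w^2 <> 0 with
   rational x, y, z, w, then N(s w + x sqrt p) = q N(y + z sqrt p) for the norm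
   of K(sqrt p)/K, so q is a norm from K(sqrt p) and the quaternion algebra
   splits. The hypotheses on d modulo 8 and on the Legendre symbols say that
   this quadric has good points at 2 and at the primes dividing p q d; at the
   other primes there is no condition.

   To pass to a global point, one looks for a common value t of the two binary
   forms p x^2 + q y^2 and p q z^2 + d w^2. Prescribing t locally at the primes
   dividing 2 p q d, one is reduced by Legendre's theorem on ternary forms to
   finding an integer n in a given class a modulo M such that every prime
   dividing n to an odd power splits in Q(sqrt(-p q)) and in Q(sqrt(-p q d)).
   Dirichlet's theorem is not needed for this: if X1, X2 are the two quadratic
   characters, X1(a) = X2(a) = 1, and no such n existed, the coefficients of
   zeta(s) L(s, X1) L(s, X2) L(s, X1 X2) would vanish on the class a, whereas
   their smoothed sum over that class grows like zeta(s) times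
   L(1, X1) L(1, X2) L(1, X1 X2), and L(1, X) > 0 for real X. *)

Require Import Defs.
From HB Require Import structures.
From mathcomp Require Import all_fingroup all_solvable.
From mathcomp Require Import boolp reals Rstruct.
From mathcomp.analysis Require Import sequences exp.
From mathcomp Require Import zify ring lra.

Set Implicit Arguments.
Unset Strict Implicit.
Unset Printing Implicit Defensive.

Import Order.TTheory GRing.Theory Num.Theory.

Local Open Scope ring_scope.

(** * Quadratic reciprocity and the Jacobi symbol *)

(** The condition X1(a) = X2(a) = 1 comes from the local data with no product formula. If t m1 is a
    value of p x^2 + q y^2, then p t m1 is a norm from Q(sqrt(-p q)), so the primes off 2 p q d that
    divide m1 to an odd power split there and the Jacobi symbol of m1 is 1; the other form gives the
    same for its value t m2. Periodicity of the symbol, hence quadratic reciprocity, moves both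
    values to the single class of m1. The analysis uses only finite sums. Weights eta(k)^2 / k, with
    eta multiplicative and decreasing, stand for k^(-s), and all four factors are cut at the same N.
    One eta makes the terms with product above N negligible, the other keeps the four sums bounded.
    If -p q d is a square, the second character is trivial and the method breaks down; in that case
    q = -p Y^2 in K, and q is visibly a norm. *)

Lemma finField_prim_root (F : finFieldType) n :
  (n %| #|F|.-1)%N -> exists z : F, n.-primitive_root z.
Proof.
move=> n_dv.
have /cyclicP[u Du] := field_unit_group_cyclic [set: {unit F}]%G.
have ou : #[u]%g = #|F|.-1 by rewrite orderE -Du card_finField_unit.
have F0 : (0 < #|F|.-1)%N by rewrite -ou order_gt0.
have n0 : (0 < n)%N by apply: dvdn_gt0 n_dv.
pose v : {unit F} := (u ^+ (#|F|.-1 %/ n))%g.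
have ov : #[v]%g = n.
  rewrite orderXdiv ou; move: #|F|.-1 F0 n_dv => m F0 /dvdnP[k Dm].
    by move: F0; rewrite Dm mulnK // muln_gt0 => /andP[k0 _]; rewrite mulKn.
  by rewrite Dm mulnK // dvdn_mulr.
exists (FinRing.uval v); apply/andP; split=> //.
apply/forallP=> i; rewrite unity_rootE -FinRing.val_unitX -[1]/(FinRing.uval 1%g).
rewrite (inj_eq val_inj) -order_dvdn ov.
apply/eqP; apply/idP/idP=> [|/eqP->//].
by move=> /dvdn_leq -/(_ isT) h; rewrite eqn_leq h ltn_ord.
Qed.

Lemma finField_euler (F : finFieldType) (h : nat) (x : F) :
  #|F| = h.*2.+1 -> x != 0 ->
  x ^+ h = if [exists y, y ^+ 2 == x] then 1 else -1.
Proof.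
move=> cF x0.
have xcard (y : F) : y != 0 -> y ^+ h.*2 = 1.
  move=> y0; apply: (mulfI y0); rewrite mulr1 -exprS -[RHS](expf_card y).
  by rewrite cF.
case: ifP => [/existsP[y /eqP Dy]|nsq]; [rewrite -Dy in x0 *|].
  rewrite -exprM mul2n xcard //.
  by apply: contraNneq x0 => ->; rewrite expr0n.
have [z oz] := finField_prim_root (dvdnn #|F|.-1).
have h0 : (0 < h)%N.
  by rewrite lt0n; apply/eqP => h0; have := finNzRing_gt1 F; rewrite cF h0.
rewrite cF /= in oz.
have [i Dx] : exists i, x = z ^+ i.
  have /(prim_rootP oz)[i ->] : x ^+ h.*2 = 1 by exact: xcard.
  by exists i.
have oddi : odd i.
  apply: contraT => ei; rewrite -nsq; apply/existsP; exists (z ^+ i./2).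
  by rewrite -exprM muln2 halfK (negbTE ei) subn0 Dx.
have zh : z ^+ h = -1.
  have /eqP := prim_expr_order oz; rewrite -muln2 exprM -subr_eq0 subr_sqr_1.
  rewrite mulf_eq0 => /orP[|]; last by rewrite addr_eq0 => /eqP.
  rewrite subr_eq0 -(prim_order_dvd oz) => /dvdn_leq -/(_ h0).
  by rewrite -addnn -{3}[h]addn0 leq_add2l leqNgt h0.
by rewrite Dx -exprM mulnC exprM zh -signr_odd oddi expr1.
Qed.

(* At r = 2 this is a mod 2, not the Kronecker symbol; accordingly [jac D n]
   below is meaningful only for odd n. *)
Definition leg (a : int) (r : nat) : int :=
  if a%:~R == 0 :> 'F_r then 0
  else if [exists y : 'F_r, y ^+ 2 == a%:~R] then 1 else -1.

Lemma odd_prime_half r : prime r -> (2 < r)%N -> #|'F_r| = (r./2).*2.+1.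
Proof.
move=> pr r2; rewrite card_Fp //.
by have := odd_prime_gt2; case: (even_prime pr) r2 => [->//|]; lia.
Qed.

Lemma leg_euler a r : prime r -> (2 < r)%N ->
  (leg a r)%:~R = a%:~R ^+ r./2 :> 'F_r.
Proof.
move=> pr r2; rewrite /leg; case: eqP => [->|/eqP a0].
  by rewrite expr0n; case: r r2 {pr} => [|[|[|r]]].
rewrite (finField_euler (odd_prime_half pr r2)) //.
by case: ifP => _ /=.
Qed.

Lemma legE a r : leg a r \in [:: 0; 1; -1].
Proof. by rewrite /leg; case: ifP => // _; case: ifP. Qed.

(** Lets identities between symbols be proved as congruences modulo r, where Euler's criterion
    applies. *)
Lemma leg_inj r (x y : int) : prime r -> (2 < r)%N ->
  x \in [:: 0; 1; -1] -> y \in [:: 0; 1; -1] ->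
  x%:~R = y%:~R :> 'F_r -> x = y.
Proof.
move=> pr r2 hx hy.
have n1 : (1 : 'F_r) != 0 by exact: oner_neq0.
have n2 : (1 : 'F_r) != -1.
  rewrite -addr_eq0 -(natrD _ 1 1) addn1 -(dvdn_pcharf (pchar_Fp pr)).
  by rewrite gtnNdvd.
have n3 : (-1 : 'F_r) != 0 by rewrite oppr_eq0.
move: hx hy; rewrite !inE => /or3P[] /eqP-> /or3P[] /eqP-> //=;
  rewrite ?mulr0z ?mulrN1z ?mulr1z => /eqP;
  by rewrite ?(negbTE n1) ?(negbTE n2) ?(negbTE n3) // eq_sym
    ?(negbTE n1) ?(negbTE n2) ?(negbTE n3).
Qed.

Lemma legM a b r : prime r -> (2 < r)%N -> leg (a * b) r = leg a r * leg b r.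
Proof.
move=> pr r2; apply: (@leg_inj r) => //; first exact: legE.
  by move: (legE a r) (legE b r); rewrite !inE => /or3P[] /eqP-> /or3P[] /eqP->.
by rewrite intrM !leg_euler // intrM exprMn.
Qed.

Lemma leg_eq0 a r : prime r -> (leg a r == 0) = (r %| a)%Z.
Proof.
move=> pr; rewrite /leg -(dvdz_pcharf (pchar_Fp pr)).
by case: (r %| a)%Z => //; case: ifP.
Qed.

Lemma leg_mod a b r : prime r -> (a = b %[mod r])%Z -> leg a r = leg b r.
Proof.
move=> pr /eqP; rewrite eqz_mod_dvd (dvdz_pcharf (pchar_Fp pr)).
by rewrite mulrzBr subr_eq0 /leg => /eqP->.
Qed.

Lemma leg1 r : prime r -> leg 1 r = 1.
Proof.
move=> pr; rewrite /leg oner_eq0; case: ifP => // /idP[].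
by apply/existsP; exists 1; rewrite expr1n.
Qed.

Lemma leg_eq1P a r : prime r ->
  reflect (~~ (r %| a)%Z /\ exists x : int, (r %| x ^+ 2 - a)%Z) (leg a r == 1).
Proof.
move=> pr; have dE := dvdz_pcharf (pchar_Fp pr).
rewrite dE /leg; case: (boolP (a%:~R == 0 :> 'F_r)) => [a0|_].
  by apply: (iffP idP) => // -[].
apply: (iffP idP).
  case: ifP => // /existsP[y /eqP Dy] _; split=> //.
  exists (val y)%:Z; rewrite dE mulrzBr rmorphXn /= -Dy.
  by rewrite -pmulrn natr_Zp subrr.
case=> _ [x]; rewrite dE mulrzBr rmorphXn /= subr_eq0 => Dx.
by case: ifP => // /idP[]; apply/existsP; exists (x%:~R).
Qed.

Lemma leg_unitE a r : prime r -> ~~ (r %| a)%Z -> leg a r = 1 \/ leg a r = -1.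
Proof.
by move=> pr; rewrite -leg_eq0 //; move: (legE a r); rewrite !inE;
  case/or3P=> /eqP->; auto.
Qed.

Lemma leg_Fp_inj (F : fieldType) r (x y : int) : r \in [pchar F] -> (2 < r)%N ->
  x \in [:: 0; 1; -1] -> y \in [:: 0; 1; -1] ->
  x%:~R = y%:~R :> F -> x = y.
Proof.
move=> rF r2 hx hy exy; have pr := pcharf_prime rF.
apply: (@leg_inj r) => //; apply/eqP.
rewrite -subr_eq0 -mulrzBr -(dvdz_pcharf (pchar_Fp pr)) (dvdz_pcharf rF).
by rewrite mulrzBr exy subrr.
Qed.

Lemma leg_eulerF (F : fieldType) r a : r \in [pchar F] -> (2 < r)%N ->
  (leg a r)%:~R = a%:~R ^+ r./2 :> F.
Proof.
move=> rF r2; have pr := pcharf_prime rF.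
apply/eqP; rewrite -subr_eq0 -rmorphXn -mulrzBr.
rewrite -(dvdz_pcharf rF) (dvdz_pcharf (pchar_Fp pr)).
by rewrite mulrzBr rmorphXn /= leg_euler // subrr.
Qed.

Lemma legN1 r : prime r -> (2 < r)%N -> leg (-1) r = (-1) ^+ r./2.
Proof.
move=> pr r2; apply: (@leg_inj r) => //; first exact: legE.
  by rewrite -signr_odd; case: odd.
by rewrite leg_euler // rmorphXn.
Qed.

(** * Gauss sums and quadratic reciprocity *)

Section GaussSum.

Variables (l r : nat) (F : finFieldType) (z : F).
Hypotheses (pl : prime l) (l2 : (2 < l)%N) (r2 : (2 < r)%N) (lr : l != r).
Hypotheses (rF : r \in [pchar F]) (zl : l.-primitive_root z).

Let f (a : 'F_l) : int := leg (val a)%:Z l.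
Let e (a : 'F_l) : F := z ^+ (val a).

Let vE (x : 'F_l) : (val x)%:Z%:~R = x.
Proof. exact: natr_Zp. Qed.

Let legf a : leg a l = f a%:~R.
Proof. by rewrite /f /leg vE. Qed.

Let fM a b : f (a * b) = f a * f b.
Proof.
rewrite /f -legM //; rewrite /leg intrM.
by rewrite !vE.
Qed.

Let eD a b : e (a + b) = e a * e b.
Proof.
rewrite /e -exprD -[RHS](prim_expr_mod zl); congr (_ ^+ _).
by rewrite /=; congr (_ %% _)%N; apply: Fp_cast.
Qed.

Let e0 : e 0 = 1. Proof. by []. Qed.

Let eMn a k : e (a *+ k) = e a ^+ k.
Proof. by elim: k => [|k IH]; rewrite ?e0 // mulrS eD IH exprS. Qed.

Let f0 : f 0 = 0.
Proof. by rewrite /f /leg eqxx. Qed.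

Let f_sqr a : a != 0 -> f a * f a = 1.
Proof.
move=> a0; have : f a != 0.
  by rewrite /f leg_eq0 // (dvdz_pcharf (pchar_Fp pl)) vE.
by have := legE (val a)%:Z l; rewrite -/(f a) !inE => /or3P[] /eqP->.
Qed.

Let sum_f : \sum_a f a = 0.
Proof.
have [g og] := finField_prim_root (dvdnn #|'F_l|.-1).
have h0 : (0 < l./2)%N by case: (l) l2 => [|[|[]]].
have g0 : g != 0.
  apply/eqP => g0; have := prim_expr_order og; rewrite g0 expr0n.
  rewrite (odd_prime_half pl l2) /= double_eq0 eqn0Ngt h0 /= => /eqP.
  by rewrite eq_sym oner_eq0.
have fg : f g != 1.
  apply/eqP => fg; have := leg_euler (val g)%:Z pl l2.
  rewrite -/(f g) fg vE => /esym /eqP.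
  rewrite -(prim_order_dvd og) (odd_prime_half pl l2) /= => /dvdn_leq.
  by move=> /(_ h0); rewrite -addnn -{3}[l./2]addn0 leq_add2l leqNgt h0.
have : \sum_a f a = f g * \sum_a f a.
  rewrite mulr_sumr (reindex_inj (mulfI g0)) /=.
  by apply: eq_bigr => a _; rewrite fM.
move/eqP; rewrite -subr_eq0 -{1}[\sum_a f a]mul1r -mulrBl mulf_eq0 subr_eq0.
by rewrite eq_sym (negbTE fg) => /eqP.
Qed.

Let sum_e u : \sum_a e (a * u) = if u == 0 then l%:R else 0.
Proof.
case: eqP => [->|/eqP u0].
  under eq_bigr do rewrite mulr0 e0.
  by rewrite sumr_const card_Fp.
have -> : \sum_a e (a * u) = \sum_a e a by rewrite [RHS](reindex_inj (mulIf u0)).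
have e1 : e 1 != 1.
  rewrite /e /= Fp_cast // modn_small ?prime_gt1 // expr1.
  apply/eqP => z1; have := prim_order_dvd zl 1; rewrite expr1 z1 eqxx dvdn1.
  by move/eqP => l1; move: l2; rewrite l1.
have : \sum_a e a = e 1 * \sum_a e a.
  rewrite mulr_sumr (reindex_inj (addrI 1)) /=.
  by apply: eq_bigr => a _; rewrite eD.
move/eqP; rewrite -subr_eq0 -{1}[\sum_a e a]mul1r -mulrBl mulf_eq0 subr_eq0.
by rewrite eq_sym (negbTE e1) => /eqP.
Qed.

Let G : F := \sum_a (f a)%:~R * e a.

Let sqr_G : G ^+ 2 = (f (-1) * l%:Z)%:~R.
Proof.
rewrite expr2 {1}/G mulr_suml.
(* Replacing the variable c of the second sum by a c turns the product of the two symbols into f c,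
   so the sum over a runs over additive characters only and [sum_e] evaluates it. *)
have -> : \sum_a (f a)%:~R * e a * G =
    \sum_a \sum_c (f c)%:~R * (if a == 0 then 0 else e (a * (1 + c))).
  apply: eq_bigr => a _; case: eqP => [->|/eqP a0].
    by rewrite f0 !mul0r big1 // => c _; rewrite mulr0.
  rewrite /G (reindex_inj (mulfI a0)) mulr_sumr; apply: eq_bigr => c _.
  have ff : (f a)%:~R * (f a)%:~R = 1 :> F by rewrite -intrM f_sqr.
  rewrite fM intrM mulrDr mulr1 eD.
  move: (_%:~R : F) (_%:~R : F) (e a) (e (a * c)) ff => x y u v xx.
  by rewrite -[RHS]mul1r -xx; ring.
rewrite exchange_big /=.
transitivity (\sum_c (f c)%:~R * ((if 1 + c == 0 then l%:R else 0) - 1) : F).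
  apply: eq_bigr => c _; rewrite -mulr_sumr -sum_e; congr (_ * _).
  rewrite [in LHS](bigD1 0) //= add0r [in RHS](bigD1 0) //= mul0r e0.
  by rewrite addrAC subrr add0r; apply: eq_bigr => a /negbTE->.
under eq_bigr do rewrite mulrBr mulr1.
rewrite sumrB -rmorph_sum /= sum_f subr0 (bigD1 (-1)) //= addrN eqxx big1 ?addr0.
  by rewrite intrM -pmulrn.
by move=> c; rewrite -subr_eq0 opprK addrC => /negbTE->; rewrite mulr0.
Qed.

Let G_pow : G ^+ r = (f r%:R)%:~R * G.
Proof.
have pr := pcharf_prime rF.
have r0 : (r%:R : 'F_l) != 0.
  by rewrite -(dvdn_pcharf (pchar_Fp pl)) dvdn_prime2.
rewrite -(pFrobenius_autE rF) rmorph_sum mulr_sumr.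
rewrite [RHS](reindex_inj (mulfI r0)) /=; apply: eq_bigr => a _.
rewrite pFrobenius_autE exprMn -eMn -[a *+ r]mulr_natl (fM _ a).
rewrite mulrA -intrM mulrA f_sqr // mul1r.
congr (_ * _); rewrite /f; have /or3P[] := legE (val a) l.
- by move/eqP->; rewrite expr0n; case: (r) r2.
- by move/eqP->; rewrite expr1n.
rewrite orbF => /eqP->; rewrite -signr_odd.
by case: (even_prime pr) => [rE|->]; [move: r2; rewrite rE | rewrite expr1].
Qed.

(** Two computations of the r-th power of the Gauss sum G in characteristic r: Frobenius gives f(r)
    G, while G^2 = f(-1) l and Euler's criterion give the symbol of f(-1) l modulo r, times G. *)
Lemma quadratic_reciprocity_aux : leg r l = leg (leg (-1) l * l%:Z) r.
Proof.
have pr := pcharf_prime rF.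
have G0 : G != 0.
  apply/eqP => G0; have /eqP := sqr_G; rewrite G0 expr0n eq_sym intrM mulf_eq0.
  rewrite -pmulrn -(dvdn_pcharf rF) dvdn_prime2 // [r == l]eq_sym (negbTE lr) orbF.
  have /f_sqr : (-1 : 'F_l) != 0 by rewrite oppr_eq0 oner_eq0.
  move=> ff /eqP fF; have /eqP := congr1 (fun x : int => x%:~R : F) ff.
  by rewrite intrM fF mulr0 eq_sym oner_eq0.
apply: (leg_Fp_inj rF) => //; [exact: legE..|].
apply: (mulIf G0); rewrite legf -[r%:Z%:~R]pmulrn -G_pow leg_eulerF //.
rewrite legf rmorphN1 -sqr_G -exprM -exprSr mul2n -[in LHS](odd_double_half r).
by case: (even_prime pr) => [rE|->]; [move: r2; rewrite rE | ].
Qed.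

End GaussSum.

Lemma quadratic_reciprocity l r : prime l -> (2 < l)%N -> prime r -> (2 < r)%N ->
  l != r -> leg l r = leg r l * (-1) ^+ (l./2 * r./2).
Proof.
move=> pl l2 pr r2 lr.
have tl : (0 < totient l)%N by rewrite totient_gt0 prime_gt0.
(* By Euler's theorem l divides r^(totient l) - 1, so this field contains the l-th roots of
   unity. *)
have [F rF cF] := pPrimePowerField pr tl.
have [z zl] : exists z : F, l.-primitive_root z.
  apply: finField_prim_root; rewrite cF -subn1 -eqn_mod_dvd ?expn_gt0 ?prime_gt0 //.
  by apply/eqP; apply: Euler_exp_totient; rewrite prime_coprime // dvdn_prime2 // eq_sym.
rewrite (quadratic_reciprocity_aux pl l2 r2 lr rF zl) legM //.
have -> : leg (leg (-1) l) r = (-1) ^+ (l./2 * r./2).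
  rewrite legN1 // -[RHS]signr_odd oddM -[in LHS]signr_odd.
  case: (odd l./2); last by rewrite leg1.
  by rewrite expr1 legN1 //= signr_odd.
by rewrite mulrAC -expr2 -exprM muln2 -mul2n exprM sqrrN !expr1n mul1r.
Qed.

(** Here the Gauss sum is z + 1/z for a primitive 8th root of unity z, which lies in the field with
    r^2 elements. Its square is 2, and Frobenius fixes it or changes its sign according to r modulo
    8. *)
Lemma leg2 r : prime r -> (2 < r)%N ->
  leg 2 r = if (r %% 8 == 1)%N || (r %% 8 == 7)%N then 1 else -1.
Proof.
move=> pr r2.
have [F rF cF] := @pPrimePowerField r 2 pr isT.
have or : odd r by case: (even_prime pr) => // rE; move: r2; rewrite rE.
have [z oz] : exists z : F, 8.-primitive_root z.
  apply: finField_prim_root; rewrite cF -subn1.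
  rewrite -eqn_mod_dvd ?expn_gt0 ?prime_gt0 //.
  have /or4P : [|| r %% 8 == 1, r %% 8 == 3, r %% 8 == 5 | r %% 8 == 7]%N.
    by move: or; clear; lia.
  by rewrite -modnXm => -[] /eqP->.
have z8 : z ^+ 8 = 1 by exact: prim_expr_order.
have z4 : z ^+ 4 = -1.
  apply/eqP; rewrite -addr_eq0; have /eqP := z8.
  rewrite (exprM z 4 2) -subr_eq0 subr_sqr_1 mulf_eq0 subr_eq0.
  by rewrite -(prim_order_dvd oz).
pose G := z + z ^+ 7.
have G2 : G ^+ 2 = 2.
  rewrite /G sqrrD -exprS z8 -exprM (exprD z 8 6) z8 mul1r (exprD z 4 2) z4.
  by rewrite mulN1r addrAC subrr add0r.
have G0 : G != 0.
  apply/eqP => G0; move/eqP: G2; rewrite G0 expr0n eq_sym /=.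
  by rewrite -(dvdn_pcharf rF) gtnNdvd.
have Gr : G ^+ r = (if (r %% 8 == 1)%N || (r %% 8 == 7)%N then 1 else -1) * G.
  rewrite {1}/G -(pFrobenius_autE rF) rmorphD /= !(pFrobenius_autE rF) exprAC.
  rewrite -(expr_mod r z8); have /or4P : [|| r %% 8 == 1, r %% 8 == 3, r %% 8 == 5 | r %% 8 == 7]%N.
    by move: or; clear; lia.
  case=> /eqP-> /=; rewrite ?mul1r ?mulN1r /G -?exprM.
  - by [].
  - by rewrite -(expr_mod 21 z8) (exprD z 4 3) (exprD z 4 1) z4; ring.
  - by rewrite -(expr_mod 35 z8) (exprD z 4 3) (exprD z 4 1) z4; ring.
  - by rewrite -(expr_mod 49 z8) addrC.
apply: (leg_Fp_inj rF) => //; first exact: legE.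
  by case: ifP.
apply: (mulIf G0); rewrite leg_eulerF // -[2%:~R]/(2 : F) -G2 -exprM -exprSr mul2n.
rewrite -[X in G ^+ X](_ : r = _); last by rewrite -[LHS]odd_double_half or.
by rewrite Gr; case: ifP.
Qed.

Lemma prime_mul_ind (P : nat -> Prop) :
  P 1%N -> (forall r n, prime r -> (0 < n)%N -> P n -> P (r * n)%N) ->
  forall n, (0 < n)%N -> P n.
Proof.
move=> P1 PM n; elim/ltn_ind: n => n IH n0.
have [n1|n1] := leqP n 1; first by have -> : n = 1%N by lia.
have pr := pdiv_prime n1; rewrite -(divnK (pdiv_dvd n)) mulnC.
have d0 : (0 < n %/ pdiv n)%N by rewrite divn_gt0 ?pdiv_gt0 // dvdn_leq ?pdiv_dvd.
by apply: PM => //; apply: IH => //; rewrite ltn_Pdiv ?prime_gt1.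
Qed.

Definition squarefree (n : nat) := forall r, prime r -> (logn r n <= 1)%N.

Lemma squarefree_decomp n : (0 < n)%N ->
  exists f s, [/\ n = (f * s ^ 2)%N, (0 < s)%N & squarefree f].
Proof.
elim/prime_mul_ind=> [|r {}n pr n0 [f [s [Dn s0 sf]]]].
  by exists 1%N, 1%N; split=> // r _; rewrite logn1.
have f0 : (0 < f)%N by move: n0; rewrite Dn muln_gt0 => /andP[].
have [rf|rf] := boolP (r %| f)%N.
  exists (f %/ r)%N, (r * s)%N; split; last 1 first.
  - by move=> l pl; rewrite logn_div // leq_subLR (leq_trans (sf l pl)) ?leq_addl.
  - by rewrite Dn -{1}(divnK rf) expnMn; ring.
  - by rewrite muln_gt0 s0 prime_gt0.
exists (r * f)%N, s; split=> //; first by rewrite Dn mulnA.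
move=> l pl; rewrite lognM // ?prime_gt0 // (logn_prime l pr).
case: eqP => [->|_]; last exact: sf.
by rewrite (lognE r f) pr f0 (negbTE rf).
Qed.

Definition jac (D : int) (n : nat) : int :=
  \prod_(0 <= r < n.+1 | prime r) leg D r ^+ logn r n.

Lemma jac_widen D n N : (0 < n)%N -> (n <= N)%N ->
  jac D n = \prod_(0 <= r < N.+1 | prime r) leg D r ^+ logn r n.
Proof.
move=> n0 nN; rewrite /jac [RHS](@big_cat_nat _ _ _ n.+1) //=.
rewrite [X in _ = _ * X]big_nat_cond [X in _ = _ * X]big1 ?mulr1 //.
move=> r /andP[/andP[nr _] pr]; rewrite lognE pr n0 gtnNdvd ?expr0 //.
Qed.

Lemma jac1 D : jac D 1 = 1.
Proof. by rewrite /jac big1 // => r _; rewrite logn1. Qed.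

Lemma jacM D m n : (0 < m)%N -> (0 < n)%N -> jac D (m * n) = jac D m * jac D n.
Proof.
move=> m0 n0; rewrite (@jac_widen D m (m * n)) ?leq_pmulr //.
rewrite (@jac_widen D n (m * n)) ?leq_pmull // -big_split /=.
by apply: eq_bigr => r _; rewrite lognM // exprD.
Qed.

Lemma jac_prime D r : prime r -> jac D r = leg D r.
Proof.
move=> pr; rewrite /jac big_mkord (bigD1 (Ordinal (ltnSn r))) //=.
rewrite (logn_prime _ pr) eqxx big1 ?mulr1 // => i /andP[_ ir].
by rewrite (logn_prime _ pr) (negbTE (ir : i != r :> nat)) expr0.
Qed.

Lemma jac_mulD D E n : odd n -> jac (D * E) n = jac D n * jac E n.
Proof.
move=> on; rewrite /jac -big_split /=; apply: eq_bigr => r pr.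
have [r2|] := ltnP 2 r; first by rewrite legM // exprMn.
have := prime_gt1 pr => r1 r2; have -> : r = 2%N by lia.
by rewrite lognE /= dvdn2 on /= andbF.
Qed.

Lemma jac_one D n : odd n -> (forall r, prime r -> odd (logn r n) -> leg D r = 1) ->
  coprime n `|D| -> jac D n = 1.
Proof.
move=> on h cn; rewrite /jac big_seq_cond big1 // => r /andP[_ pr].
have [o|e] := boolP (odd (logn r n)); first by rewrite h // expr1n.
have [/eqP->//|l0] := boolP (logn r n == 0)%N.
have rn : (r %| n)%N by move: l0; rewrite -lt0n logn_gt0 mem_primes => /and3P[].
have rD : ~~ (r %| D)%Z.
  rewrite -[(r %| D)%Z]/(r %| `|D|)%N.
  apply/negP => rD; have := dvdn_gcd r n `|D|; rewrite (eqP cn) rn rD dvdn1.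
  by move/eqP => r1; move: pr; rewrite r1.
rewrite -(even_halfK e) -mul2n exprM.
by case: (leg_unitE pr rD) => ->; rewrite ?sqrrN !expr1n.
Qed.

Lemma jac_unit D n : (0 < n)%N -> coprime n `|D| -> jac D n = 1 \/ jac D n = -1.
Proof.
elim/prime_mul_ind=> [|r {}n pr n0 IH]; first by rewrite jac1; left.
rewrite coprimeMl => /andP[cr cn]; rewrite jacM // ?prime_gt0 // jac_prime //.
have rD : ~~ (r %| D)%Z by rewrite -prime_coprime.
by case: (leg_unitE pr rD) (IH cn) => -> [] ->; auto.
Qed.

(** Reduces the supplementary laws and reciprocity for [jac] to the case of prime n. *)
Lemma jac_fun D (psi : nat -> int) :
  psi 1%N = 1 -> (forall m n, odd m -> odd n -> psi (m * n)%N = psi m * psi n) ->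
  (forall r, prime r -> (2 < r)%N -> ~~ (r %| D)%Z -> leg D r = psi r) ->
  forall n, odd n -> coprime n `|D| -> jac D n = psi n.
Proof.
move=> p1 pM pp n on; have n0 : (0 < n)%N by case: n on.
move: on; elim/prime_mul_ind: n0 => [|r {}n pr n0 IH]; first by rewrite jac1.
rewrite oddM coprimeMl => /andP[or on] /andP[cr cn].
rewrite jacM // ?prime_gt0 // jac_prime // IH // pM // pp //.
  by case: (even_prime pr) => [r2|_]; [rewrite r2 in or | case: (r) pr or => [|[|[]]]].
by rewrite -prime_coprime.
Qed.

Lemma jacN1 n : odd n -> jac (-1) n = if (n %% 4 == 1)%N then 1 else -1.
Proof.
move=> on; apply: (@jac_fun (-1) (fun n => if (n %% 4 == 1)%N then 1 else -1)) => //.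
- move=> m k om ok; rewrite -modnMm.
  (have /orP[] : (m %% 4 == 1)%N || (m %% 4 == 3)%N by lia);
    (have /orP[] : (k %% 4 == 1)%N || (k %% 4 == 3)%N by lia);
    by move=> /eqP-> /eqP->.
- move=> r pr r2 _; rewrite legN1 // -signr_odd.
  have or : odd r by case: (even_prime pr) => // rE; rewrite rE in r2.
  have -> : odd r./2 = ~~ (r %% 4 == 1)%N by lia.
  by case: (_ == _).
- by rewrite abszN1 coprimen1.
Qed.

Lemma jac2 n : odd n ->
  jac 2 n = if (n %% 8 == 1)%N || (n %% 8 == 7)%N then 1 else -1.
Proof.
move=> on; apply: (@jac_fun 2
  (fun n => if (n %% 8 == 1)%N || (n %% 8 == 7)%N then 1 else -1)) => //.
- move=> m k om ok; rewrite -modnMm.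
  (have /or4P[] : [|| m %% 8 == 1, m %% 8 == 3, m %% 8 == 5 | m %% 8 == 7]%N by lia);
    (have /or4P[] : [|| k %% 8 == 1, k %% 8 == 3, k %% 8 == 5 | k %% 8 == 7]%N by lia);
    by move=> /eqP-> /eqP->.
- by move=> r pr r2 _; rewrite leg2.
- by rewrite coprimen2.
Qed.

Lemma jac_odd_prime l n : prime l -> (2 < l)%N -> odd n -> coprime n l ->
  jac l n = leg n l * if (l %% 4 == 3)%N && (n %% 4 == 3)%N then -1 else 1.
Proof.
move=> pl l2 on cn.
apply: (@jac_fun l (fun n => leg n l *
  if (l %% 4 == 3)%N && (n %% 4 == 3)%N then -1 else 1)) => //.
- by rewrite leg1 //= andbF mulr1.
- move=> m k om ok; rewrite PoszM legM // mulrACA; congr (_ * _).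
  case: (l %% 4 == 3)%N => //=; rewrite -modnMm.
  (have /orP[] : (m %% 4 == 1)%N || (m %% 4 == 3)%N by lia);
    (have /orP[] : (k %% 4 == 1)%N || (k %% 4 == 3)%N by lia);
    by move=> /eqP-> /eqP->.
- move=> r pr r2; rewrite dvdzE /= dvdn_prime2 // => rl.
  rewrite eq_sym in rl; rewrite quadratic_reciprocity //; congr (_ * _).
  have or : odd r by case: (even_prime pr) => // rE; rewrite rE in r2.
  have ol : odd l by case: (even_prime pl) => // lE; rewrite lE in l2.
  rewrite -signr_odd oddM.
  have -> : odd r./2 = (r %% 4 == 3)%N by lia.
  have -> : odd l./2 = (l %% 4 == 3)%N by lia.
  by do 2?case: (_ == _).
Qed.

(** D is taken apart into its sign, its factors 2 and its odd primes; these contribute symbols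
    depending on n modulo 4, modulo 8, and modulo 4 and l. Only the primes dividing D matter, not
    their exponents. *)
Lemma jac_period (D : int) m n : D != 0 -> odd m -> odd n ->
  coprime m `|D| -> coprime n `|D| -> m = n %[mod 8] ->
  (forall l, prime l -> (2 < l)%N -> (l %| D)%Z -> m = n %[mod l]) ->
  jac D m = jac D n.
Proof.
move=> D0 om on cm cn mn8 mnl.
rewrite [D]intEsign !jac_mulD //; congr (_ * _).
  case: (D < 0); rewrite ?expr1 ?expr0.
    by rewrite !jacN1 //; have -> : (m %% 4 = n %% 4)%N by lia.
  have j1 k : odd k -> jac 1 k = 1.
    by move=> ok; apply: jac_one => // [r pr _|]; [exact: leg1|exact: coprimen1].
  by rewrite !j1.
have : forall l, prime l -> (2 < l)%N -> (l %| `|D|)%N -> m = n %[mod l] by [].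
have : (0 < `|D|)%N by rewrite absz_gt0.
move: `|D|%N cm cn => {D D0 mnl} d + + d0.
elim/prime_mul_ind: d0 => [_ _ _|l {}d pl d0 IH].
  have j1 k : odd k -> jac 1 k = 1.
    by move=> ok; apply: jac_one => // [r pr _|]; [exact: leg1|exact: coprimen1].
  by rewrite !j1.
rewrite !coprimeMr => /andP[ml md] /andP[nl nd] mnl.
rewrite PoszM !jac_mulD // IH //; last first.
  by move=> r pr r2 rd; apply: mnl => //; apply: dvdn_mull.
congr (_ * _); case: (even_prime pl) => [->|ol].
  by rewrite !jac2 // mn8.
have l2 : (2 < l)%N by case: (l) pl ol => [|[|[]]].
rewrite !jac_odd_prime //; congr (_ * _).
  by apply: leg_mod => //; rewrite !modz_nat (mnl l) // dvdn_mulr.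
by have -> : (m %% 4 = n %% 4)%N by lia.
Qed.

Lemma nonresidue_exists l : prime l -> (2 < l)%N ->
  exists a : nat, leg a l = -1.
Proof.
move=> pl l2; have [g og] := finField_prim_root (dvdnn #|'F_l|.-1).
have h0 : (0 < l./2)%N by case: (l) l2 => [|[|[]]].
rewrite (odd_prime_half pl l2) /= in og.
have g0 : g != 0.
  apply/eqP => g0; have := prim_expr_order og; rewrite g0 expr0n.
  rewrite double_eq0 eqn0Ngt h0 /= => /eqP.
  by rewrite eq_sym oner_eq0.
have vg : (val g)%:Z%:~R = g by exact: natr_Zp.
exists (val g); have := leg_euler (val g)%:Z pl l2; rewrite vg.
have : ~~ (l %| (val g)%:Z)%Z by rewrite (dvdz_pcharf (pchar_Fp pl)) vg.
case/(leg_unitE pl) => -> // /esym/eqP.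
rewrite -(prim_order_dvd og) => /dvdn_leq -/(_ h0).
by rewrite -addnn -{3}[l./2]addn0 leq_add2l leqNgt h0.
Qed.

Lemma chinese_coprime m n c a : coprime m n -> (0 < m)%N -> (0 < n)%N ->
  coprime a n ->
  coprime c m -> exists k, [/\ (0 < k)%N, k = c %[mod m], k = a %[mod n] & coprime k (m * n)].
Proof.
move=> mn m0 n0 an cm; exists (chinese m n c a + m * n)%N.
have k1 : (chinese m n c a + m * n = c %[mod m])%N.
  by rewrite addnC mulnC modnMDl chinese_modl.
have k2 : (chinese m n c a + m * n = a %[mod n])%N.
  by rewrite addnC modnMDl chinese_modr.
split=> //; first by rewrite addn_gt0 muln_gt0 m0 n0 orbT.
by rewrite coprimeMr -coprime_modl k1 coprime_modl cm -coprime_modl k2 coprime_modl.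
Qed.

Lemma chinese_part l M a : prime l -> (0 < M)%N -> coprime a l ->
  exists k, [/\ (0 < k)%N, coprime k M,
    k = a %[mod M`_l] & k = 1 %[mod M`_l^']].
Proof.
move=> pl M0 al.
have cM : coprime M`_l M`_l^' by apply: pnat_coprime; apply: part_pnat.
have ca : coprime a M`_l by rewrite p_part coprimeXr.
have [] := @chinese_coprime _ _ a 1 cM; rewrite ?part_gt0 ?coprime1n //.
by move=> k []; rewrite partnC // => *; exists k.
Qed.

(** Write |D| = f s^2 with f squarefree. If an odd prime l divides f, take n a nonresidue modulo l
    and 1 modulo the prime-to-l part of M. Otherwise f is 1 or 2 and the sign or the factor 2 is
    detected by a class modulo 8. *)
Lemma jac_nontrivial (D : int) (M : nat) : D != 0 -> (forall x : int, x ^+ 2 != D) ->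
  (0 < M)%N -> (8 * `|D| %| M)%N ->
  exists n, [/\ (0 < n)%N, coprime n M & jac D n = -1].
Proof.
move=> D0 nsq M0 dM.
have M8 : (8 %| M)%N by apply: dvdn_trans dM; apply: dvdn_mulr.
have MD : (`|D| %| M)%N by apply: dvdn_trans dM; apply: dvdn_mull.
have oddM n : coprime n M -> odd n.
  move=> cn; rewrite -coprimen2; apply: coprime_dvdr cn.
  by apply: dvdn_trans M8.
have [|f [s [Df s0 sf]]] := @squarefree_decomp `|D|; first by rewrite absz_gt0.
have f0 : (0 < f)%N.
  by rewrite lt0n; apply/eqP => f0; move: D0; rewrite -absz_eq0 Df f0.
have jD n : coprime n M -> jac D n = jac ((-1) ^+ (D < 0)%R) n * jac f n.
  move=> cn; have on := oddM n cn; have n0 : (0 < n)%N by case: (n) on.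
  rewrite [D in LHS]intEsign Df PoszM expnS expn1 PoszM !jac_mulD //.
  have : coprime n `|s%:Z|.
    apply: coprime_dvdr cn; apply: dvdn_trans MD; rewrite Df expnS.
    by rewrite mulnCA dvdn_mulr.
  by case/(jac_unit n0) => ->; rewrite ?mulrNN ?mulr1.
have fM : (f %| M)%N by apply: dvdn_trans MD; rewrite Df dvdn_mulr.
have sgn n : odd n -> (n = 1 %[mod 4])%N -> jac ((-1) ^+ (D < 0)%R) n = 1.
  move=> on n1; case: (D < 0); rewrite ?expr1 ?expr0 ?jacN1 // ?n1 //.
  by apply: jac_one => // [r pr _|]; [exact: leg1|exact: coprimen1].
have [[l [pl l2 lf]]|nol] :
    (exists l, [/\ prime l, (2 < l)%N & (l %| f)%N]) \/
    (forall l, prime l -> (2 < l)%N -> ~~ (l %| f)%N).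
  have [/hasP[l]|/hasPn h] := boolP (has (fun l => (2 < l)%N) (primes f)).
    by rewrite mem_primes => /and3P[pl _ lf] l2; left; exists l.
  right=> l pl l2; apply/negP => lf; have := h l.
  by rewrite mem_primes pl f0 lf l2 => /(_ isT).
- have [a la] := nonresidue_exists pl l2.
  have cal : coprime a l.
    by rewrite coprime_sym prime_coprime // -[X in ~~ X](dvdzE l a) -leg_eq0 // la.
  have [n [n0 cn na n1]] := chinese_part pl M0 cal.
  have dvP d : coprime d l -> (d %| M)%N -> (d %| M`_l^')%N.
    move=> cd; rewrite -{1}(partnC l M0) Gauss_dvdr // p_part.
    exact: coprimeXr.
  have P8 : (8 %| M`_l^')%N.
    apply: dvP => //; rewrite (@coprimeXl 3 2) // prime_coprime // dvdn_prime2 //.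
    by rewrite neq_ltn l2.
  have n8 : n = 1 %[mod 8] by rewrite -(modn_dvdm n P8) n1 modn_dvdm.
  have on := oddM n cn.
  have n4 : n = 1 %[mod 4] by rewrite -(@modn_dvdm 8 n 4) // n8.
  exists n; split=> //; rewrite jD // sgn ?mul1r //.
  have [f' Df'] : exists f', f = (l * f')%N.
    by exists (f %/ l)%N; rewrite mulnC divnK.
  have f'0 : (0 < f')%N by move: f0; rewrite Df' muln_gt0 => /andP[].
  have lf' : ~~ (l %| f')%N.
    apply/negP => lf'; have := sf l pl; rewrite Df' lognM // ?prime_gt0 //.
    by rewrite (logn_prime l pl) eqxx (lognE l f') pl f'0 lf'.
  have cnf : coprime n f by apply: coprime_dvdr cn.
  have [cnl cnf'] : coprime n l /\ coprime n f'.
    by apply/andP; rewrite -coprimeMr -Df'.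
  rewrite Df' PoszM jac_mulD // jac_odd_prime //.
  have -> : leg n l = -1.
    rewrite -la; apply: leg_mod => //; rewrite !modz_nat.
    have lM : (l %| M`_l)%N.
      rewrite p_part -{1}(expn1 l) dvdn_exp2l // logn_gt0 mem_primes pl M0 /=.
      exact: dvdn_trans fM.
    by rewrite -(modn_dvdm n lM) na modn_dvdm.
  rewrite n4 andbF mulr1 (@jac_period f' n 1) ?jac1 ?mulr1 //.
  - by rewrite -lt0n.
  - by rewrite coprime1n.
  move=> r pr r2; rewrite dvdzE /= => rf'.
  have rP : (r %| M`_l^')%N.
    apply: dvP; last by apply: dvdn_trans fM; rewrite Df' dvdn_mull.
    rewrite prime_coprime // dvdn_prime2 //; apply/eqP => rl.
    by move: lf'; rewrite -rl rf'.
  by rewrite -(modn_dvdm n rP) n1 modn_dvdm.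
- have fE : f = 1%N \/ f = 2%N.
    have [f1|f1] := leqP f 1; first by left; move: f0 f1; clear; lia.
    have pd2 g : (1 < g)%N -> (g %| f)%N -> (2 %| g)%N.
      move=> g1 gf; have pg := pdiv_prime g1.
      have : pdiv g = 2%N.
        have [|g2] := leqP (pdiv g) 2; first by move: (prime_gt1 pg); clear; lia.
        by have := nol _ pg g2; rewrite (dvdn_trans (pdiv_dvd g) gf).
      by move=> <-; apply: pdiv_dvd.
    have f2 := pd2 _ f1 (dvdnn f); right.
    have [f21|f21] := leqP (f %/ 2) 1; first by move: f1 f21 f2; clear; lia.
    have f4 : (4 %| f)%N.
      have := pd2 _ f21 (dvdn_div f2); move: f2; clear; lia.
    by have := sf 2%N isT; rewrite leqNgt -(pfactor_dvdn 2) // f4.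
  case: fE => fE.
    have Dneg : (D < 0)%R.
      rewrite ltNge; apply/negP => Dp; have /eqP[] := nsq s%:Z.
      by rewrite -[D]gez0_abs // Df fE mul1n expnS expn1 PoszM.
    have [n [n0 cn na n1]] := @chinese_part 2 M 3 isT M0 isT.
    have M4 : (4 %| M`_2)%N by rewrite p_part (@dvdn_exp2l 2 2) // -pfactor_dvdn // (dvdn_trans _ M8).
    have n4 : n = 3 %[mod 4] by rewrite -(modn_dvdm n M4) na modn_dvdm.
    exists n; split=> //; rewrite jD // Dneg expr1 jacN1 ?oddM // n4 /= fE.
    by rewrite jac_one ?mulN1r // ?oddM ?coprimen1 // => r pr _; exact: leg1.
  (* Since 5 is 1 modulo 4 the sign of D does not contribute, whereas the symbol of 2 is -1. *)
  have [n [n0 cn na n1]] := @chinese_part 2 M 5 isT M0 isT.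
  have M82 : (8 %| M`_2)%N by rewrite p_part (@dvdn_exp2l 2 3) // -pfactor_dvdn.
  have n8 : n = 5 %[mod 8] by rewrite -(modn_dvdm n M82) na modn_dvdm.
  have n4 : n = 1 %[mod 4] by rewrite -(@modn_dvdm 8 n 4) // n8.
  exists n; split=> //; rewrite jD // sgn ?mul1r ?oddM //.
  by rewrite fE jac2 ?oddM // n8.
Qed.

(** * Real characters and L(1, chi) > 0 *)

(** Descent: if r divides b it divides a, and removing it from both lowers the exponent by 2,
    keeping it odd. Once r does not divide b, the quotient a / b is a square root of D modulo r. *)
Lemma norm_odd_logn (D a b : int) r : prime r -> ~~ (r %| D)%Z ->
  odd (logn r `|(a ^+ 2 - D * b ^+ 2)%R|) -> leg D r = 1.
Proof.
move=> pr rD; move: {2}(`|a|%N + `|b|)%N (leqnn (`|a|%N + `|b|)%N) => m.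
elim: m a b => [|m IH] a b lm o.
  have [a0 b0] : a = 0 /\ b = 0 by lia.
  by move: o; rewrite a0 b0 expr0n mulr0 subrr logn0.
have rN : (r %| a ^+ 2 - D * b ^+ 2)%Z.
  have : (0 < logn r `|(a ^+ 2 - D * b ^+ 2)%R|)%N by case: logn o.
  by rewrite logn_gt0 mem_primes dvdzE => /and3P[].
have [rb|rb] := boolP (r %| b)%Z.
  have ra : (r %| a)%Z.
    have : (r %| a ^+ 2)%Z.
      by rewrite -[a ^+ 2](subrK (D * b ^+ 2)) rpredD // dvdz_mull // dvdz_exp.
    by rewrite !dvdzE abszX /= Euclid_dvdX // => /andP[].
  have [a' Da] := dvdzP ra; have [b' Db] := dvdzP rb.
  have E : a ^+ 2 - D * b ^+ 2 = (a' ^+ 2 - D * b' ^+ 2) * r%:Z ^+ 2.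
    by rewrite Da Db; ring.
  have r1 := prime_gt1 pr.
  have [N0|N0] := eqVneq (a' ^+ 2 - D * b' ^+ 2) 0.
    by move: o; rewrite E N0 mul0r logn0.
  apply: (IH a' b').
    have [/andP[/eqP a0 /eqP b0]|ne] := boolP ((a' == 0) && (b' == 0)).
      by rewrite a0 b0.
    have : (`|a'| + `|b'| > 0)%N by move: ne; clear; lia.
    by move: lm; rewrite Da Db !abszM /=; move: r1; clear; nia.
  move: o; rewrite E abszM lognM ?absz_gt0 // ?abszX ?expn_gt0 ?prime_gt0 //.
    by rewrite pfactorK // oddD addbF.
  by rewrite expf_neq0 // -absz_eq0 -lt0n prime_gt0.
apply/eqP/(leg_eq1P _ pr); split=> //.
have [u [v uv]] : exists u v : int, u * b + v * r = 1.
  have /coprimezP : coprimez b r.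
    by rewrite coprimez_sym /coprimez; rewrite -[_ == _]/(coprime r `|b|) prime_coprime.
  by case=> -[u v] /= uv; exists u, v.
exists (a * u); have -> : (a * u) ^+ 2 - D = (a ^+ 2 - D * b ^+ 2) * u ^+ 2
   + D * (u * b - 1) * (u * b + 1) by ring.
have -> : u * b - 1 = - v * r by rewrite -uv; ring.
by apply: rpredD; [apply: dvdz_mulr|rewrite mulNr mulrN mulNr rpredN dvdz_mulr // mulrA dvdz_mull].
Qed.

(** A real Dirichlet character modulo M, the trivial one included. *)
Definition qchar (M : nat) (chi : nat -> int) :=
  [/\ chi 1%N = 1, forall m n, chi (m * n)%N = chi m * chi n,
      forall m n, m = n %[mod M] -> chi m = chi n &
      forall n, if coprime n M then chi n = 1 \/ chi n = -1 else chi n = 0].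

(** M is always a multiple of 8 D, so the cut-off removes even n, where [jac] has no meaning; the
    character need not be primitive. *)
Definition chi (M : nat) (D : int) (n : nat) : int :=
  if coprime n M then jac D n else 0.

Lemma chi_qchar M D : D != 0 -> (0 < M)%N -> (8 * `|D| %| M)%N -> qchar M (chi M D).
Proof.
move=> D0 M0 dM.
have M8 : (8 %| M)%N by apply: dvdn_trans dM; apply: dvdn_mulr.
have MD : (`|D| %| M)%N by apply: dvdn_trans dM; apply: dvdn_mull.
have oddM n : coprime n M -> odd n.
  move=> cn; rewrite -coprimen2; apply: coprime_dvdr cn.
  by apply: dvdn_trans M8.
rewrite /chi; split.
- by rewrite coprime1n jac1.
- move=> m n; rewrite coprimeMl.
  have [cm|] := boolP (coprime m M); last by rewrite mul0r.
  have [cn|] := boolP (coprime n M); last by rewrite mulr0.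
  by rewrite jacM //; [case: (m) (oddM m cm)|case: (n) (oddM n cn)].
- move=> m n mn; have <- : coprime m M = coprime n M.
    by rewrite -coprime_modl mn coprime_modl.
  case: ifP => // cm.
  have cn : coprime n M by rewrite -coprime_modl -mn coprime_modl.
  apply: jac_period; rewrite ?oddM //; try exact: coprime_dvdr MD _.
  - by rewrite -(modn_dvdm m M8) mn modn_dvdm.
  - move=> l _ _; rewrite dvdzE /= => lD.
    have lM : (l %| M)%N by apply: dvdn_trans MD.
    by rewrite -(modn_dvdm m lM) mn modn_dvdm.
- move=> n; case: (boolP (coprime n M)) => // cn; apply: jac_unit; last exact: coprime_dvdr MD _.
  by case: (n) (oddM n cn).
Qed.

(** The coefficients of zeta(s) L(s, f). *)
Definition divsum (f : nat -> int) (n : nat) : int :=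
  \sum_(k <- divisors n) f k.

Lemma divsum_part M f r e m : qchar M f -> prime r -> (0 < m)%N -> ~~ (r %| m)%N ->
  divsum f (r ^ e * m) = (\sum_(i < e.+1) f r ^+ i) * divsum f m.
Proof.
move=> [f1 fM _ _] pr m0 rm.
have rX i : (0 < r ^ i)%N by rewrite expn_gt0 prime_gt0.
have re0 := rX e.
have fX i : f (r ^ i)%N = f r ^+ i.
  by elim: i => [|i IH]; rewrite ?expn0 ?f1 // expnS fM IH exprS.
have P : perm_eq (divisors (r ^ e * m))
    [seq (r ^ i * j)%N | i <- iota 0 e.+1, j <- divisors m].
  apply: uniq_perm; first exact: divisors_uniq.
    apply: allpairs_uniq; rewrite ?iota_uniq ?divisors_uniq //.
    have key u : (u \in [seq (i, j) | i <- iota 0 e.+1, j <- divisors m]) ->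
        logn r (r ^ u.1 * u.2) = u.1.
      case/allpairsP=> -[i j] /= [_ jm ->] /=.
      rewrite -dvdn_divisors // in jm.
      have j0 : (0 < j)%N by apply: dvdn_gt0 jm.
      rewrite lognM // pfactorK // (lognE r j) pr j0.
      by have [rj|_] := boolP (r %| j)%N; [rewrite (dvdn_trans rj jm) in rm | rewrite addn0].
    move=> [i j] [i' j'] /key /= k1 /key /= k2 E.
    have ii' : i = i' by rewrite -k1 E k2.
    by move/eqP: E; rewrite ii' eqn_pmul2l // => /eqP ->.
  move=> d; rewrite -dvdn_divisors ?muln_gt0 ?re0 //; apply/idP/allpairsP.
    move=> dd; have d0 : (0 < d)%N by apply: dvdn_gt0 dd; rewrite muln_gt0 re0.
    exists (logn r d, d`_r^')%N; split; last by rewrite /= -p_part partnC.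
      rewrite mem_iota [_.1]/= add0n ltnS.
      have := dvdn_leq_log r _ dd; rewrite muln_gt0 re0 m0 => /(_ isT).
      rewrite lognM // pfactorK // (lognE r m) pr m0 (negbTE rm) addn0 //.
    rewrite -dvdn_divisors //.
    have : (d`_r^' %| r ^ e * m)%N by apply: dvdn_trans dd; apply: dvdn_part.
    rewrite Gauss_dvdr // coprime_sym coprimeXl //.
    by apply: pnat_coprime (pnat_id pr) _; apply: part_pnat.
  move=> [[i j] []]; rewrite mem_iota -dvdn_divisors // [_.1]/= [_.2]/=.
  rewrite add0n ltnS => /= ie jm ->.
  by rewrite dvdn_mul // dvdn_exp2l.
rewrite /divsum (perm_big _ P) big_allpairs_dep big_distrl.
rewrite -[iota 0 e.+1]/(index_iota 0 e.+1) big_mkord; apply: eq_bigr => i _.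
by rewrite big_distrr /=; apply: eq_bigr => j _; rewrite fM fX.
Qed.

Lemma divsum1 M f : qchar M f -> divsum f 1 = 1.
Proof. by case=> f1 _ _ _; rewrite /divsum big_seq1. Qed.

Lemma geom_pm1 (x : int) e : x = 1 \/ x = -1 ->
  \sum_(i < e.+1) x ^+ i = if x == 1 then e.+1%:Z else (~~ odd e)%:Z.
Proof.
case=> ->; rewrite /=.
  by under eq_bigr do rewrite expr1n; rewrite sumr_const card_ord -[RHS]natz.
elim: e => [|e IH]; first by rewrite big_ord1.
by rewrite big_ord_recr IH /= -signr_odd /=; case: (odd e).
Qed.

Lemma qchar_geom_ge M f r e : qchar M f -> prime r ->
  (odd e -> f r = 1) -> 1 <= \sum_(i < e.+1) f r ^+ i.
Proof.
move=> [_ _ _ /(_ r) fr] pr fe; move: fr; case: ifP => _ fr.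
  by rewrite geom_pm1 //; case: eqP => [//|]; case: (odd e) fe => // /(_ isT).
by rewrite fr big_ord_recl big1 // => i _; rewrite expr0n.
Qed.

Lemma qchar_geom_ge0 M f r e : qchar M f -> 0 <= \sum_(i < e.+1) f r ^+ i.
Proof.
move=> [_ _ _ /(_ r) fr]; move: fr; case: ifP => _ fr.
  by rewrite geom_pm1 //; case: eqP.
by rewrite fr big_ord_recl big1 // => i _; rewrite expr0n.
Qed.

Lemma part_split n : (1 < n)%N -> let r := pdiv n in
  [/\ prime r, n = (r ^ logn r n * n`_r^')%N, ~~ (r %| n`_r^')%N,
      (0 < n`_r^')%N & (n`_r^' < n)%N].
Proof.
move=> n1 r; have pr : prime r by apply: pdiv_prime.
have n0 : (0 < n)%N by apply: ltnW.
have E : n = (r ^ logn r n * n`_r^')%N by rewrite -p_part partnC.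
have rn : (0 < logn r n)%N by rewrite logn_gt0 mem_primes pr n0 pdiv_dvd.
split=> //.
  rewrite -prime_coprime //; apply: pnat_coprime (pnat_id pr) _.
  exact: part_pnat.
rewrite {2}E ltn_Pmull // -(expn0 r) ltn_exp2l // prime_gt1 //.
Qed.

Lemma divsum_ge0 M f n : qchar M f -> (0 < n)%N -> 0 <= divsum f n.
Proof.
move=> qf; elim/ltn_ind: n => n IH n0.
have [n1|n1] := leqP n 1.
  by have -> : n = 1%N; [move: n0 n1; clear; lia | rewrite (divsum1 qf)].
have [pr E rn m0 mn] := part_split n1.
by rewrite E (divsum_part _ qf) // mulr_ge0 ?IH // (qchar_geom_ge0 _ _ qf).
Qed.

Lemma divsum_ge1 M f n : qchar M f -> (0 < n)%N ->
  (forall r, prime r -> odd (logn r n) -> f r = 1) -> 1 <= divsum f n.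
Proof.
move=> qf; elim/ltn_ind: n => n IH n0 h.
have [n1|n1] := leqP n 1.
  by have -> : n = 1%N; [move: n0 n1; clear; lia | rewrite (divsum1 qf)].
have [pr E rn m0 mn] := part_split n1.
rewrite E (divsum_part _ qf) // -[1]mulr1 ler_pM //.
  by apply: (qchar_geom_ge qf pr); apply: h pr.
apply: IH => // l pl ol; apply: h => //.
rewrite E lognM // lognX (logn_prime l (pdiv_prime n1)).
case: eqP ol => [->|_]; last by rewrite muln0.
by rewrite (lognE _ n`_ _) (negbTE rn) !andbF.
Qed.

(** The Euler factor at r is 1 - 1 + ... with an even number of terms. This is how a prime inert for
    a character annihilates a coefficient. *)
Lemma divsum_eq0 M f n r : qchar M f -> (0 < n)%N -> prime r ->
  odd (logn r n) -> f r = -1 -> divsum f n = 0.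
Proof.
move=> qf n0 pr on fr.
have E : n = (r ^ logn r n * n`_r^')%N by rewrite -p_part partnC.
have rn : ~~ (r %| n`_r^')%N.
  rewrite -prime_coprime //; apply: pnat_coprime (pnat_id pr) _.
  exact: part_pnat.
rewrite E (divsum_part _ qf) // geom_pm1; last by right.
by rewrite fr on mul0r.
Qed.

Lemma periodic_sum (V : nmodType) (g : nat -> V) M q r :
  (forall m n, m = n %[mod M] -> g m = g n) ->
  \sum_(0 <= k < q * M + r) g k =
  (\sum_(0 <= k < M) g k) *+ q + \sum_(0 <= k < r) g k.
Proof.
move=> gM; elim: q => [|q IH]; first by rewrite mul0n add0n add0r.
rewrite mulSn -addnA (@big_cat_nat _ _ _ M) ?leq_addr //= mulrS -addrA -IH.
congr (_ + _); rewrite -{1}[M]add0n big_addn addnC addnK.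
by apply: eq_bigr => k _; apply: gM; rewrite modnDr.
Qed.

Section RealCharacter.

Variables (M : nat) (f : nat -> int).
Hypotheses (M1 : (1 < M)%N) (qf : qchar M f).

Let M0 : (0 < M)%N. Proof. exact: ltnW. Qed.
Let f1 : f 1%N = 1. Proof. by case: qf. Qed.
Let fM m n : f (m * n)%N = f m * f n. Proof. by case: qf. Qed.
Let fmod m n : m = n %[mod M] -> f m = f n. Proof. by case: qf => _ _ /(_ m n). Qed.
Let funit n : coprime n M -> f n = 1 \/ f n = -1.
Proof. by case: qf => _ _ _ /(_ n); case: ifP. Qed.
Let f0 n : ~~ coprime n M -> f n = 0.
Proof. by case: qf => _ _ _ /(_ n); case: ifP. Qed.

Lemma qchar_norm n : `|f n| <= 1.
Proof.
have [/funit[]->|/f0->] := boolP (coprime n M); by rewrite ?normrN ?normr1 ?normr0.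
Qed.

Let inv_mod k : coprime k M -> exists u, [/\ (u < M)%N & forall m, (m < M)%N ->
   (k * m == 1 %[mod M]) = (m == u)].
Proof.
move=> ck; exists ((k ^ (totient M).-1) %% M)%N; split; first by rewrite ltn_mod.
move=> m mM; have kk : (k * k ^ (totient M).-1 = 1 %[mod M])%N.
  by rewrite -expnS prednK ?totient_gt0 // Euler_exp_totient.
apply/eqP/eqP => [km|->]; last by rewrite modnMmr.
rewrite -(modn_small mM).
have -> : (m = m * (k * k ^ (totient M).-1) %[mod M])%N by rewrite -modnMmr kk modnMmr muln1.
by rewrite mulnA [(m * k)%N]mulnC -modnMml km modnMml mul1n.
Qed.

Lemma qchar_sum_period c : coprime c M -> f c = -1 -> \sum_(0 <= k < M) f k = 0.
Proof.
move=> cc fc; have h (k : 'I_M) : (c * k %% M < M)%N by rewrite ltn_mod.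
have inj : injective (fun k : 'I_M => Ordinal (h k)).
  move=> i j /(congr1 val) /= E; apply: val_inj => /=.
  have [u [_ uP]] := inv_mod cc.
  wlog ij : i j E / (i <= j)%N.
    by move=> H; case/orP: (leq_total i j) => ?; [|symmetry]; apply: H.
  have : (M %| c * (j - i))%N by rewrite mulnBr -eqn_mod_dvd ?leq_mul2l ?ij ?orbT // E.
  rewrite Gauss_dvdr 1?coprime_sym // => /dvdnP[q Dq].
  by move: (ltn_ord j) (ltn_ord i) Dq ij; clear; case: q => [|q]; rewrite ?mulSn; lia.
have E : \sum_(0 <= k < M) f k = - \sum_(0 <= k < M) f k.
  rewrite !big_mkord {1}(reindex_inj inj) -mulN1r big_distrr /=.
  by apply: eq_bigr => i _; rewrite -fc -fM; apply: fmod; rewrite modn_mod.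
lia.
Qed.

Definition count_inv (k z : nat) : nat :=
  \sum_(1 <= m < z.+1 | k * m == 1 %[mod M]) 1.

Lemma count_inv_bound k z : coprime k M ->
  (M * count_inv k z <= z + M)%N /\ (z <= M * count_inv k z + M)%N.
Proof.
move=> ck; have [u [uM uP]] := inv_mod ck.
pose g m := (k * m == 1 %[mod M] : nat).
have gM m n : m = n %[mod M] -> g m = g n.
  by move=> mn; rewrite /g -modnMmr mn modnMmr.
have sg : (\sum_(0 <= m < M) g m = 1)%N.
  transitivity (\sum_(0 <= m < M | m == u) 1)%N; last by rewrite big_nat1_eq uM.
  rewrite [RHS]big_mkcond !big_nat; apply: eq_bigr => m /andP[_ mM].
  by rewrite /g uP //; case: eqP.
have g0 : g 0%N = 0%N by rewrite /g muln0 mod0n modn_small.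
have -> : count_inv k z = (\sum_(0 <= m < z.+1) g m)%N.
  rewrite [RHS]big_ltn // g0 add0n /count_inv big_mkcond.
  by apply: eq_bigr => m _; rewrite /g; case: eqP.
have r1 : (\sum_(0 <= m < z.+1 %% M) g m <= 1)%N.
  by rewrite -sg [leqRHS](@big_cat_nat _ _ _ (z.+1 %% M)) ?leq_addr //= ltnW ?ltn_mod.
have -> : (\sum_(0 <= m < z.+1) g m =
           z.+1 %/ M + \sum_(0 <= m < z.+1 %% M) g m)%N.
  rewrite [in LHS](divn_eq z.+1 M) (periodic_sum _ _ gM) sg.
  by congr (_ + _)%N; elim: (_ %/ _)%N => [|n IH] //; rewrite mulrS IH.
have re : (z.+1 %% M = 0 -> \sum_(0 <= m < z.+1 %% M) g m = 0)%N.
  by move=> ->; rewrite big_geq.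
move: (divn_eq z.+1 M) (ltn_pmod z.+1 M0) r1 re M1.
move: (z.+1 %/ M)%N (z.+1 %% M)%N (\sum_(0 <= m < _) _)%N => a b e.
clear => zE bM e1 be M1; rewrite mulnDr.
have : (M * e <= b * M)%N by case: b be {zE bM} => [->//|b _]; nia.
by case: e e1 {be} => [|[|]] //; nia.
Qed.

Lemma qchar_psum c n : coprime c M -> f c = -1 ->
  `|\sum_(0 <= k < n) f k| <= M%:Z.
Proof.
move=> cc fc; rewrite (divn_eq n M) (periodic_sum _ _ fmod).
rewrite (qchar_sum_period cc fc) mul0rn add0r.
apply: le_trans (ler_norm_sum _ _ _) _.
apply: (@le_trans _ _ (\sum_(0 <= k < n %% M) 1)).
  by apply: ler_sum => k _; apply: qchar_norm.
by rewrite big_const_nat iter_addr_0 subn0 natz lez_nat ltnW ?ltn_mod.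
Qed.

Lemma qchar_psum2 c u v : coprime c M -> f c = -1 ->
  `|\sum_(u <= k < v) f k| <= 2 * M%:Z.
Proof.
move=> cc fc; have [uv|vu] := leqP u v; last by rewrite big_geq ?normr0 // ltnW.
have E := @big_cat_nat _ _ _ u 0 v xpredT f isT uv.
have -> : \sum_(u <= k < v) f k = \sum_(0 <= k < v) f k - \sum_(0 <= k < u) f k.
  by rewrite [X in X - _]E /= addrAC subrr add0r.
apply: le_trans (ler_normB _ _) _.
by rewrite mulr_natl mulr2n lerD // (qchar_psum _ cc fc).
Qed.

Lemma divsum_nat n N : (0 < n)%N -> (n <= N)%N ->
  divsum f n = \sum_(1 <= k < N.+1 | (k %| n)%N) f k.
Proof.
move=> n0 nN; rewrite /divsum -[RHS]big_filter; apply: perm_big.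
apply: uniq_perm; rewrite ?divisors_uniq ?filter_uniq ?iota_uniq //.
move=> k; rewrite -dvdn_divisors // mem_filter mem_index_iota.
have [kn|//] := boolP (k %| n)%N; rewrite (dvdn_gt0 n0 kn) ltnS.
by rewrite (leq_trans (dvdn_leq n0 kn) nN).
Qed.

(** Dirichlet's hyperbola method on k m = n. The class of 1 is chosen because k m = 1 modulo M
    forces f k = f m, so the terms with k > Y reflect into those with k <= Y < m. Each k <= Y then
    counts every m twice, except that m <= Y counts once. *)
Lemma hyperbola Y : (0 < Y)%N ->
  \sum_(1 <= n < (Y ^ 2).+1 | n == 1 %[mod M]) divsum f n =
  \sum_(1 <= k < Y.+1)
     f k * (2 * (count_inv k (Y ^ 2 %/ k))%:Z - (count_inv k Y)%:Z).
Proof.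
move=> Y0; set N := (Y ^ 2)%N; have YN : (Y <= N)%N by rewrite /N; nia.
pose ok k m := (k * m <= N)%N && (k * m == 1 %[mod M])%N.
have okC k m : ok k m = ok m k by rewrite /ok mulnC.
have E1 : \sum_(1 <= n < N.+1 | n == 1 %[mod M]) divsum f n =
    \sum_(1 <= k < N.+1) \sum_(1 <= m < N.+1) if ok k m then f k else 0.
  transitivity (\sum_(1 <= n < N.+1) \sum_(1 <= k < N.+1) \sum_(1 <= m < N.+1)
      if n == (k * m)%N then if n == 1 %[mod M] then f k else 0 else 0).
    rewrite big_mkcond /= !big_nat; apply: eq_bigr => n /andP[n0 nN].
    case: ifP => _; last first.
      by rewrite big1 // => k _; rewrite big1 // => m _; rewrite if_same.
    rewrite (divsum_nat n0 (nN : (n <= N)%N)) big_mkcond !big_nat.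
    apply: eq_bigr => k /andP[k0 kN].
    rewrite -big_mkcond /=; have [kn|kn] := boolP (k %| n)%N; last first.
      by rewrite big1 // => m /eqP nE; rewrite nE dvdn_mulr in kn.
    rewrite (eq_bigl (fun m => m == n %/ k)%N) => [|m]; last first.
      by rewrite -{1}(divnK kn) mulnC eqn_pmul2l // eq_sym.
    rewrite big_nat1_eq divn_gt0 // dvdn_leq //= ltnS.
    by rewrite (leq_trans (leq_div _ _)).
  rewrite exchange_big /= !big_nat; apply: eq_bigr => k /andP[k0 _].
  rewrite exchange_big /= !big_nat; apply: eq_bigr => m /andP[m0 _].
  by rewrite -big_mkcond big_nat1_eq muln_gt0 k0 m0 /= ltnS /ok; case: leqP.
have cE k z : (0 < k)%N -> (z <= N %/ k)%N ->
    f k * (count_inv k z)%:Z = \sum_(1 <= m < z.+1) if ok k m then f k else 0.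
  move=> k0 zN; rewrite /count_inv -natz natr_sum mulr_sumr big_mkcond !big_nat.
  apply: eq_bigr => m /andP[_ mz]; rewrite mulr1 /ok.
  by rewrite mulnC -leq_divRL // (leq_trans _ zN).
have cE2 k : (0 < k)%N ->
    f k * (count_inv k (N %/ k))%:Z =
    \sum_(1 <= m < N.+1) if ok k m then f k else 0.
  move=> k0; rewrite cE // [RHS](@big_cat_nat _ _ _ (N %/ k).+1) //=; last first.
    by rewrite ltnS leq_div.
  rewrite [X in _ = _ + X]big_nat [X in _ = _ + X]big1 ?addr0 // => m /andP[mk _].
  by rewrite /ok mulnC -leq_divRL // leqNgt mk.
rewrite E1 (@big_cat_nat _ _ _ Y.+1) ?ltnS //=.
have -> : \sum_(Y.+1 <= k < N.+1) \sum_(1 <= m < N.+1) (if ok k m then f k else 0) =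
    \sum_(1 <= m < Y.+1) \sum_(Y.+1 <= k < N.+1) if ok m k then f m else 0.
  rewrite [RHS]exchange_big /= !big_nat; apply: eq_bigr => k /andP[Yk kN].
  rewrite (@big_cat_nat _ _ _ Y.+1) ?ltnS //=.
  rewrite [X in _ + X]big_nat [X in _ + X]big1 ?addr0 => [|m /andP[Ym _]].
    apply: eq_bigr => m _; rewrite okC; case: ifP => // /andP[_ /eqP km].
    have : f (m * k) = 1 by rewrite (fmod km).
    rewrite fM; have [cm|/f0->] := boolP (coprime m M); last by rewrite mul0r.
    have [->|->] := funit cm; first by rewrite mul1r => ->.
    by rewrite mulN1r => <-; rewrite opprK.
  rewrite /ok; case: ifP => // /andP[+ _]; rewrite /N leqNgt => /negP[].
  by move: Yk Ym; clear; nia.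
rewrite -big_split /= !big_nat; apply: eq_bigr => k /andP[k0 kY].
have Yk : (Y <= N %/ k)%N by rewrite leq_divRL // /N; move: kY; rewrite ltnS; clear; nia.
rewrite mulrBr mulrCA mulr_natl mulr2n cE2 // cE // -addrA; congr (_ + _).
by rewrite [in RHS](@big_cat_nat _ _ _ Y.+1) ?ltnS //= addrAC subrr add0r.
Qed.

End RealCharacter.

(** Summation by parts. A one-sided bound on the partial sums is enough since the weights b
    decrease; the boundary term A n * b n is carried through the induction. *)
Lemma abel_lower (R : realDomainType) (a b : nat -> R) g n :
  (forall k, g <= \sum_(0 <= i < k.+1) a i) ->
  (forall k, 0 <= b k) -> (forall k, b k.+1 <= b k) ->
  g * b 0%N <= \sum_(0 <= i < n.+1) a i * b i.
Proof.
move=> gA b0 bS; pose A k := \sum_(0 <= i < k.+1) a i.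
have key : g * (b 0%N - b n) <= \sum_(0 <= i < n.+1) a i * b i - A n * b n.
  elim: n => [|n IH]; first by rewrite /A !big_nat1 !subrr mulr0.
  have -> : A n.+1 = A n + a n.+1 by rewrite /A big_nat_recr.
  rewrite big_nat_recr //=.
  have : 0 <= (A n - g) * (b n - b n.+1) by rewrite mulr_ge0 // subr_ge0 // gA.
  lra.
have : 0 <= (A n - g) * b n by rewrite mulr_ge0 // subr_ge0 gA.
lra.
Qed.

(** * Lower bounds for partial sums of L(1, chi) *)

Definition Lsum (R : realFieldType) (f : nat -> int) (z : nat) : R :=
  \sum_(1 <= k < z.+1) (f k)%:~R / k%:R.

Section LBounds.

Variables (R : realFieldType) (M : nat) (f : nat -> int) (c : nat).
Hypotheses (M1 : (1 < M)%N) (qf : qchar M f) (cc : coprime c M) (fc : f c = -1).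

(** Sums of f over intervals are at least -2M, and the weights 1/k start at 1/(Y+1). *)
Lemma Lsum_tail Y z : (Y <= z)%N ->
  Lsum R f Y - (2 * M)%:R / (Y.+1)%:R <= Lsum R f z.
Proof.
move=> Yz; rewrite /Lsum [leRHS](@big_cat_nat _ _ _ Y.+1) //= lerD2l.
have [->|] := eqVneq Y z.
  by rewrite big_geq // oppr_le0 divr_ge0.
move=> Yz'; have {Yz'}Yz : (Y < z)%N by rewrite ltn_neqAle Yz'.
rewrite -{2}[Y.+1]add0n big_addn subSS -(subnSK Yz) -mulNr.
have -> : \sum_(0 <= i < (z - Y.+1).+1) (f (i + Y.+1))%:~R / (i + Y.+1)%:R =
   \sum_(0 <= i < (z - Y.+1).+1) ((f (i + Y.+1))%:~R : R) * (i + Y.+1)%:R^-1 by [].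
apply: (@abel_lower _ (fun i => (f (i + Y.+1))%:~R) (fun i => (i + Y.+1)%:R^-1)).
- move=> k; have := qchar_psum2 M1 qf Y.+1 (k + Y.+2) cc fc.
  rewrite -{1}[Y.+1]add0n big_addn addnS -addSn addnK ler_norml => /andP[h _].
  rewrite -rmorph_sum /= -(ler_int R) in h *.
  by apply: le_trans h; rewrite rmorphN /= natrM rmorphM.
- by move=> k; rewrite invr_ge0.
- by move=> k; rewrite lef_pV2 ?ler_nat ?leq_add2r // posrE ltr0n addnS.
Qed.

(** The counts in [hyperbola] are Y^2/(M k) up to 2 and Y/M up to 1, so each k costs at most 2 * 2 +
    1 = 5. The subtracted Y/M times the sum of f is at least -Y, which raises the total error to
    6Y. *)
Lemma hyperbola_upper Y : (0 < Y)%N ->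
  (\sum_(1 <= n < (Y ^ 2).+1 | n == 1 %[mod M]) divsum f n)%:~R <=
  2 * Y%:R ^+ 2 / M%:R * Lsum R f Y + 6 * Y%:R.
Proof.
move=> Y0; rewrite hyperbola // rmorph_sum /=.
have M0 : 0 < M%:R :> R by rewrite ltr0n ltnW.
have M1R : 1 <= M%:R :> R by rewrite ler1n ltnW.
have bnd k : (0 < k)%N ->
    (f k * (2 * (count_inv M k (Y ^ 2 %/ k))%:Z - (count_inv M k Y)%:Z))%:~R <=
    2 * Y%:R ^+ 2 / M%:R * ((f k)%:~R / k%:R) - Y%:R / M%:R * (f k)%:~R + 5 :> R.
  move=> k0; have [_ _ _ /(_ k)] := qf.
  case: ifP => [ck fk|_ ->]; last by rewrite !mul0r mulr0 mulr0 subrr add0r.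
  have kR : 0 < k%:R :> R by rewrite ltr0n.
  have [a1 a2] := count_inv_bound M1 (Y ^ 2 %/ k) ck.
  have [b1 b2] := count_inv_bound M1 Y ck.
  set u := count_inv M k (Y ^ 2 %/ k) in a1 a2 *.
  set v := count_inv M k Y in b1 b2 *.
  have {}b1 : v%:R - 1 <= Y%:R / M%:R :> R.
    by rewrite ler_pdivlMr // mulrBl mul1r lerBlDr -natrM -natrD ler_nat mulnC.
  have {}b2 : Y%:R / M%:R <= v%:R + 1 :> R.
    by rewrite ler_pdivrMr // mulrDl mul1r -natrM -natrD ler_nat mulnC.
  have {}a1 : u%:R - 2 <= Y%:R ^+ 2 / M%:R / k%:R :> R.
    rewrite ler_pdivlMr // ler_pdivlMr //.
    have : ((M * u * k)%N%:R : R) <= (Y ^ 2 + M * k)%N%:R.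
      rewrite ler_nat; have := leq_mul a1 (leqnn k); have := leq_divM (Y ^ 2) k.
      clear; nia.
    rewrite natrD natrX !natrM => h; have : 0 <= M%:R * k%:R :> R by rewrite mulr_ge0 // ltW.
    by nra.
  have {}a2 : Y%:R ^+ 2 / M%:R / k%:R <= u%:R + 2 :> R.
    rewrite ler_pdivrMr // ler_pdivrMr //.
    have : ((Y ^ 2)%N%:R : R) <= ((M * u + M + 1) * k)%N%:R.
      rewrite ler_nat; have := ltn_ceil (Y ^ 2) k0.
      by move: a2; clear; nia.
    rewrite natrX natrM !natrD natrM => h.
    have : 0 <= (M%:R - 1) * k%:R :> R by rewrite mulr_ge0 ?subr_ge0 // ltW.
    by nra.
  rewrite rmorphM rmorphB rmorphM /= -!pmulrn.
  have -> : 2 * Y%:R ^+ 2 / M%:R * ((f k)%:~R / k%:R) =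
     2 * (Y%:R ^+ 2 / M%:R / k%:R) * (f k)%:~R :> R by ring.
  move: (Y%:R ^+ 2 / M%:R / k%:R) (Y%:R / M%:R) b1 b2 a1 a2 => x y.
  by case: fk => -> b1 b2 a1 a2; rewrite ?rmorphN1 ?rmorph1 ?mulrN1 ?mulN1r ?mulr1 ?mul1r; lra.
apply: (@le_trans _ _ (\sum_(1 <= k < Y.+1)
   (2 * Y%:R ^+ 2 / M%:R * ((f k)%:~R / k%:R) - Y%:R / M%:R * (f k)%:~R + 5))).
  by rewrite !big_nat; apply: ler_sum => k /andP[k0 _]; apply: bnd.
rewrite !big_split /= -mulr_sumr -/(Lsum R f Y) sumrN -mulr_sumr.
rewrite big_const_nat iter_addr_0 subSS subn0.
have sb : - M%:R <= \sum_(1 <= k < Y.+1) (f k)%:~R :> R.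
  have := qchar_psum M1 qf Y.+1 cc fc; rewrite ler_norml => /andP[h _].
  have f00 : f 0%N = 0.
    have [_ _ _ /(_ 0%N)] := qf; rewrite /coprime gcd0n.
    by case: eqP => // ME; move: M1; rewrite ME.
  rewrite big_ltn // f00 add0r in h.
  by rewrite -rmorph_sum /=; rewrite -(ler_int R) rmorphN /= in h.
have : - Y%:R <= Y%:R / M%:R * \sum_(1 <= k < Y.+1) (f k)%:~R :> R.
  have : Y%:R / M%:R * - M%:R <= Y%:R / M%:R * \sum_(1 <= k < Y.+1) (f k)%:~R :> R.
    by rewrite ler_wpM2l // divr_ge0.
  by rewrite mulrN divfK ?gt_eqF.
rewrite -mulr_natr; lra.
Qed.

End LBounds.

(* The integers n = X^2 - D Y^2 congruent to 1 mod M have divisor sum at least 1.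
   There are enough of them to contradict [hyperbola_upper] if L(1, chi) <= 0. *)
Lemma chi_one_count (D : int) (M B J X0 Y : nat) :
  D != 0 -> (1 < M)%N -> (8 * `|D| %| M)%N -> (0 < B)%N ->
  X0 = (`|D| * M ^ 2 * B ^ 2)%N -> Y = (M * (X0 + J) + X0)%N ->
  (J * B)%:Z <= \sum_(1 <= n < (Y ^ 2).+1 | n == 1 %[mod M]) divsum (chi M D) n.
Proof.
move=> D0 M1 dM B0 X0E YE; have M0 : (0 < M)%N by apply: ltnW.
have qf := chi_qchar D0 M0 dM.
have aD : (0 < `|D|)%N by rewrite absz_gt0.
(* x j is 1 and M y is 0 modulo M, so z is 1 modulo M. For y < B the term D (M y)^2 is at most X0 in
   absolute value while x j > X0. Hence z is positive, and since squares of distinct integers above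
   X0 differ by more than 2 X0, z determines x, and then y. *)
pose x j := (1 + M * (X0 + j))%N.
pose z j y : int := (x j)%:Z ^+ 2 - D * (M * y)%:Z ^+ 2.
have small y : (y < B)%N -> `|D * (M * y)%:Z ^+ 2| <= X0%:Z.
  move=> yB; rewrite normrM normrX /= -abszE expr2 -!PoszM lez_nat X0E.
  by rewrite -mulnA leq_mul // -expnMn leq_sqr leq_mul // ltnW.
have X00 : (0 < X0)%N by rewrite X0E !muln_gt0 aD M0 B0.
have xX j : (X0 < x j)%N by rewrite /x; move: M0; clear; nia.
have zpos j y : (y < B)%N -> 0 < z j y.
  move=> yB; rewrite /z; have := small y yB; have := xX j.
  rewrite -!ltz_nat; move: (D * _) (x j)%:Z X0%:Z (X00 : 0 < X0%:Z :> int) => u v w; clear.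
  by rewrite ler_norml => w0 wv /andP[_ uw]; nia.
have zY j y : (j < J)%N -> (y < B)%N -> z j y <= (Y ^ 2)%:Z.
  move=> jJ yB; rewrite /z; have := small y yB.
  have : (x j <= M * (X0 + J))%N by rewrite /x; move: M0 jJ; clear; nia.
  have -> : (Y ^ 2)%:Z = ((M * (X0 + J))%:Z + X0%:Z) * ((M * (X0 + J))%:Z + X0%:Z).
    by rewrite -PoszD -PoszM -YE.
  rewrite -lez_nat expr2.
  move: (D * _) (x j)%:Z X0%:Z (M * _)%:Z (X00 : 0 < X0%:Z :> int) (isT : 0 <= (x j)%:Z).
  by clear=> u v w t w0 v0 vt; rewrite ler_norml => /andP[uw _];
    have vv : v * v <= t * t by [nia]; have ww : w <= w * w by [nia]; nia.
have zE j y : (y < B)%N -> (`|z j y|%N)%:Z = z j y.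
  by move=> yB; rewrite gez0_abs // ltW // zpos.
pose N := (Y ^ 2)%N.
pose F (u : 'I_J * 'I_B) : 'I_N.+1 := inord `|z u.1 u.2|.
have FE u : val (F u) = `|z u.1 u.2|%N.
  by rewrite /= inordK // ltnS -lez_nat zE // zY.
have Finj : injective F.
  move=> [j y] [j' y'] /(congr1 (fun u => (val u)%:Z)); rewrite !FE /= !zE //.
  rewrite /z => E.
  have h1 := small y (ltn_ord y); have h2 := small y' (ltn_ord y').
  have xx : x j = x j'.
    apply/eqP; apply: contraT => ne; have p1 := xX j; have p2 := xX j'.
    have {}ne : (x j)%:Z != (x j')%:Z by [].
    move: p1 p2; rewrite -!ltz_nat.
    move: ne h1 h2 E; rewrite !ler_norml.
    move: (D * _ ) (D * _) (x j)%:Z (x j')%:Z X0%:Z (X00 : 0 < X0%:Z :> int).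
    by clear=> u v a b w w0 ne /andP[u1 u2] /andP[v1 v2] E wa wb; nia.
  have jj : j = j' by apply: val_inj; move: xx; rewrite /x /=; move: M0; clear; nia.
  have yy : y = y'.
    apply: val_inj; move: E; rewrite xx => /addrI /oppr_inj /(mulfI D0).
    by rewrite !PoszM !exprMn => /mulfI; rewrite expf_neq0 -?lt0n //= => /(_ isT);
      rewrite !expr2 -!PoszM => -[]; clear; nia.
  by rewrite jj yy.
have xM j y : (y < B)%N -> (`|z j y| = 1 %[mod M])%N /\ coprime `|z j y| M.
  move=> yB; have E : (`|z j y| = 1 %[mod M])%N.
    apply/eqP; rewrite -eqz_nat -!modz_nat eqz_mod_dvd zE // /z /x.
    apply/dvdzP; exists (2 * (X0 + j)%:Z + M%:Z * (X0 + j)%:Z ^+ 2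
       - D * M%:Z * y%:Z ^+ 2).
    by rewrite PoszD !PoszM; ring.
  by split=> //; rewrite -coprime_modl E coprime_modl coprime1n.
have Fgood u : (0 < val (F u))%N /\ 1 <= divsum (chi M D) (val (F u)).
  have z0 : (0 < val (F u))%N by rewrite FE absz_gt0 gt_eqF // zpos.
  split=> //; apply: (divsum_ge1 qf z0) => r pr; rewrite FE => or.
  have rz : (r %| `|z u.1 u.2|)%N.
    have : (0 < logn r `|z u.1 u.2|)%N by case: logn or.
    by rewrite logn_gt0 mem_primes => /and3P[].
  have cr : coprime r M by apply: coprime_dvdl rz _; case: (xM u.1 u.2 (ltn_ord _)).
  rewrite /chi cr jac_prime //; apply: norm_odd_logn or => //.
  rewrite dvdzE /= -prime_coprime //; apply: coprime_dvdr cr.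
  by apply: dvdn_trans dM; apply: dvdn_mull.
have -> : (J * B)%:Z = \sum_(u in F @: setT) 1.
  by rewrite sumr_const card_imset // cardsT card_prod !card_ord natz.
pose h n := if n == 1 %[mod M] then divsum (chi M D) n else 0.
have -> : \sum_(1 <= n < N.+1 | n == 1 %[mod M]) divsum (chi M D) n =
    \sum_(n < N.+1) h n.
  have h0 : h 0%N = 0 by rewrite /h mod0n modn_small.
  by rewrite -(big_mkord xpredT h) big_ltn // h0 add0r big_mkcond.
rewrite [leRHS](bigID (mem (F @: setT))) /= -[leLHS]addr0 lerD //.
  apply: ler_sum => n /imsetP[u _ ->]; rewrite /h FE.
  by case: (xM u.1 u.2 (ltn_ord _)) => /eqP -> _; case: (Fgood u); rewrite FE.
apply: sumr_ge0 => n _; rewrite /h; case: ifP => // n1; apply: (divsum_ge0 qf).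
by rewrite lt0n; apply: contraTneq n1 => ->; rewrite mod0n modn_small.
Qed.

(** No asymptotics are involved: at one explicit Y the norms outnumber the error 6Y of
    [hyperbola_upper], which makes [Lsum] at Y positive by a margin exceeding any later loss in the
    tail. *)
Lemma chi_Lsum_pos (R : realFieldType) (D : int) (M : nat) :
  D != 0 -> (forall x : int, x ^+ 2 != D) -> (1 < M)%N -> (8 * `|D| %| M)%N ->
  exists c : R, exists z0 : nat, 0 < c /\
    forall z, (z0 <= z)%N -> c <= Lsum R (chi M D) z.
Proof.
move=> D0 nsq M1 dM; have M0 : (0 < M)%N by apply: ltnW.
have [n0 [n00 cn0 jn0]] := jac_nontrivial D0 nsq M0 dM.
have fn0 : chi M D n0 = -1 by rewrite /chi cn0.
have qf := chi_qchar D0 M0 dM.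
pose B := (32 * M)%N.
(* With J = 2 X0 there are J B = 64 M X0 norms, and Y = (3M + 1) X0 <= 4 M X0, so there are at least
   16Y of them. Then 16Y - 6Y = 10Y gives [Lsum] >= 5M/Y at Y, and the tail loses at most 2M/Y. *)
have B0 : (0 < B)%N by rewrite muln_gt0.
pose X0 := (`|D| * M ^ 2 * B ^ 2)%N.
have X00 : (0 < X0)%N by rewrite /X0 2!muln_gt0 absz_gt0 D0 !expn_gt0 M0 B0.
pose Y := (M * (X0 + 2 * X0) + X0)%N.
have Y0 : (0 < Y)%N by rewrite addn_gt0 X00 orbT.
have lo := @chi_one_count D M B (2 * X0) X0 Y D0 M1 dM B0 erefl erefl.
have up := hyperbola_upper R M1 qf cn0 fn0 Y0.
have {}lo : (16 * Y)%N%:R <= 2 * Y%:R ^+ 2 / M%:R * Lsum R (chi M D) Y + 6 * Y%:R.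
  apply: le_trans up; rewrite -[X in X <= _]/((16 * Y)%N%:Z%:~R) ler_int.
  apply: le_trans lo; rewrite lez_nat /Y /B; move: M0; clear; nia.
have YR : 0 < Y%:R :> R by rewrite ltr0n.
have MR : 0 < M%:R :> R by rewrite ltr0n.
have LY : 5 * (M%:R / Y%:R) <= Lsum R (chi M D) Y.
  have : 10 * Y%:R <= 2 * Y%:R ^+ 2 / M%:R * Lsum R (chi M D) Y.
    by move: lo; rewrite natrM; lra.
  rewrite mulrA ler_pdivrMr // mulrAC ler_pdivlMr // => h.
  rewrite -(ler_pM2r YR); lra.
exists (M%:R / Y%:R), Y; split=> [|z Yz]; first by rewrite divr_gt0.
apply: le_trans (Lsum_tail R M1 qf cn0 fn0 Yz).
have : (2 * M)%:R / (Y.+1)%:R <= 2 * (M%:R / Y%:R) :> R.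
  rewrite natrM -mulrA ler_pM2l // ler_pM2l // lef_pV2 ?posrE ?ltr0n //.
  by rewrite ler_nat.
have : 0 < M%:R / Y%:R :> R by rewrite divr_gt0.
move: LY; move: (_ / _) (_ / _) (Lsum _ _ _) => u v w.
lra.
Qed.

(** * Integers in a residue class split by two characters *)

Section GroupConvolution.

Variables (R : realFieldType) (gT : finGroupType).

Definition conv (s t : gT -> R) (c : gT) : R := \sum_b s b * t (b^-1 * c)%g.

Lemma conv_push (I J : finType) (u : I -> gT) (v : J -> gT) (s : I -> R) (t : J -> R) c :
  conv (fun b => \sum_(i | u i == b) s i) (fun b => \sum_(j | v j == b) t j) c =
  \sum_(p : I * J | (u p.1 * v p.2)%g == c) s p.1 * t p.2.
Proof.
rewrite /conv.
transitivity (\sum_b \sum_(i | u i == b) \sum_(j | v j == (b^-1 * c)%g) s i * t j).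
  apply: eq_bigr => b _; rewrite mulr_suml; apply: eq_bigr => i _.
  by rewrite mulr_sumr.
rewrite (exchange_big_dep xpredT) //=.
rewrite -(pair_big_dep xpredT (fun i j => (u i * v j)%g == c) (fun i j => s i * t j)) /=.
apply: eq_bigr => i _; rewrite (eq_bigl (fun b => b == u i)) => [|b]; last exact: eq_sym.
rewrite big_pred1_eq; apply: eq_bigl => j; apply/eqP/eqP => [->|<-].
  by rewrite mulKVg.
by rewrite mulKg.
Qed.

Variables (x1 x2 : gT -> R).
Hypotheses (x1M : forall b c, x1 (b * c)%g = x1 b * x1 c)
           (x2M : forall b c, x2 (b * c)%g = x2 b * x2 c).
Hypotheses (x1s : forall b, x1 b * x1 b = 1) (x2s : forall b, x2 b * x2 b = 1).
Hypotheses (s1 : \sum_b x1 b = 0) (s2 : \sum_b x2 b = 0)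
           (s12 : \sum_b x1 b * x2 b = 0).

Let xV (x : gT -> R) : (forall b c, x (b * c)%g = x b * x c) ->
  (forall b, x b * x b = 1) -> forall b, x b^-1%g = x b.
Proof.
move=> xM xs b; have x11 : x 1%g = 1.
  by have := xM 1%g 1%g; rewrite mulg1 xs.
by rewrite -[x b^-1%g]mulr1 -(xs b) mulrA -xM mulVg x11 mul1r.
Qed.

Let xnorm (x : gT -> R) : (forall b, x b * x b = 1) -> forall b, `|x b| = 1.
Proof.
move=> xs b; apply/eqP; rewrite -(@eqrXn2 _ 2) // expr1n -normrX expr2 xs.
by rewrite normr1.
Qed.

Variables (Z : gT -> R) (P : R).
Hypothesis ZP : forall b, `|Z b - P| <= 1.

Let E b := Z b - P.
Let W := conv Z (fun b => x1 b * Z b).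
Let Rm := conv E (fun b => x1 b * E b).
Let L1 := \sum_b x1 b * Z b.
Let L2 := \sum_b x2 b * Z b.
Let L12 := \sum_b x1 b * x2 b * Z b.

Let shift (F : gT -> R) c : \sum_b F (b^-1 * c)%g = \sum_b F b.
Proof.
rewrite [RHS](reindex_inj (inj_comp (mulIg c) invg_inj)) /=.
by [].
Qed.

(** Substitute Z = P + E: the term in P^2 is a multiple of the sum of x1, hence 0, and the two mixed
    terms give P L1 and P L1 x1 c. *)
Let WE c : W c = P * L1 * (1 + x1 c) + Rm c.
Proof.
have L1E : L1 = \sum_b x1 b * E b.
  by rewrite /E; under [RHS]eq_bigr do rewrite mulrBr; rewrite sumrB -mulr_suml s1 mul0r subr0.
have -> : Rm c = W c - P * \sum_b x1 (b^-1 * c)%g * E (b^-1 * c)%g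
    - P * (\sum_b x1 b * E b) * x1 c - P * P * \sum_b x1 (b^-1 * c)%g.
  rewrite /Rm /W /conv !mulr_sumr !mulr_suml -!sumrB; apply: eq_bigr => b _.
  rewrite /E x1M xV //; ring.
rewrite (shift (fun b => x1 b * E b)) (shift x1) s1 -L1E; ring.
Qed.

Let Rm_bound c : `|Rm c| <= #|gT|%:R.
Proof.
apply: le_trans (ler_norm_sum _ _ _) _; rewrite -sumr_const.
apply: ler_sum => b _; rewrite !normrM (xnorm x1s) mul1r.
by apply: mulr_ile1; rewrite ?normr_ge0 ?ZP.
Qed.

Let sum_conv (x : gT -> R) : (forall b c, x (b * c)%g = x b * x c) ->
  \sum_c x c * W c = (\sum_b x b * Z b) * \sum_b x b * x1 b * Z b.
Proof.
move=> xM; under eq_bigr do rewrite mulr_sumr.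
rewrite exchange_big /= mulr_suml; apply: eq_bigr => b _.
rewrite (reindex_inj (mulgI b)) /= mulr_sumr; apply: eq_bigr => c _.
by rewrite mulKg xM; ring.
Qed.

(** Summed against x2 (1 + x1), the main term of W vanishes by orthogonality, so [Rm] may be
    replaced by W; the characters x2 and x1 x2 turn the convolution W into products. *)
Let rhoE : \sum_c x2 c * (1 + x1 c) * Rm c = 2 * (L2 * L12).
Proof.
have u2 : \sum_c x2 c * (1 + x1 c) = 0.
  under eq_bigr do rewrite mulrDr mulr1 [x2 _ * _]mulrC.
  by rewrite big_split /= s2 s12 addr0.
have -> : \sum_c x2 c * (1 + x1 c) * Rm c =
    \sum_c (x2 c * W c + x1 c * x2 c * W c) -
    2 * P * L1 * \sum_c x2 c * (1 + x1 c).
  rewrite mulr_sumr -sumrB; apply: eq_bigr => c _; rewrite WE.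
  have -> : x1 c * x2 c * (P * L1 * (1 + x1 c) + Rm c) =
    P * L1 * x2 c * (x1 c + x1 c * x1 c) + x1 c * x2 c * Rm c by ring.
  by rewrite x1s; ring.
rewrite u2 mulr0 subr0 big_split /= sum_conv // sum_conv; last first.
  by move=> b c; rewrite x1M x2M mulrACA.
rewrite mulr_natl mulr2n; congr (_ + _).
  by rewrite -/L2; congr (_ * _); apply: eq_bigr => b _; rewrite [x1 b * _]mulrC.
rewrite mulrC -/L12; congr (_ * _); apply: eq_bigr => b _.
by rewrite [x1 b * x2 b * x1 b]mulrAC x1s mul1r.
Qed.

(* With Z b the mass of the integers in the class b, the left-hand side is the
   sum over the class a of the coefficients of zeta L(x1) L(x2) L(x1 x2). *)
Lemma biquadratic_convolution a : x1 a = 1 -> x2 a = 1 ->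
  `|conv W (fun b => x2 b * W b) a - 4 * P * (L1 * L2 * L12)| <= #|gT|%:R ^+ 3.
Proof.
move=> a1 a2; have u2 : \sum_c x2 c * (1 + x1 c) = 0.
  under eq_bigr do rewrite mulrDr mulr1 [x2 _ * _]mulrC.
  by rewrite big_split /= s2 s12 addr0.
have xa (x : gT -> R) c : (forall b c, x (b * c)%g = x b * x c) ->
    (forall b, x b * x b = 1) -> x a = 1 -> x (c^-1 * a)%g = x c.
  by move=> xM xs xa; rewrite xM xV // xa mulr1.
have [K KE] : exists K, K = P * L1 by exists (P * L1).
(* Expansion by [WE]. As x a = 1, both factors involve the same x c. The term in K^2 vanishes, each
   linear term contributes 2 K L2 L12 by [rhoE], and the last sum is the error. *)
have -> : conv W (fun b => x2 b * W b) a =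
    2 * K ^+ 2 * (\sum_c x2 c * (1 + x1 c)) +
    K * (\sum_c x2 c * (1 + x1 c) * Rm c) +
    K * (\sum_c x2 (c^-1 * a)%g * (1 + x1 (c^-1 * a)%g) * Rm (c^-1 * a)%g) +
    \sum_c x2 c * Rm c * Rm (c^-1 * a)%g.
  rewrite /conv !mulr_sumr -!big_split; apply: eq_bigr => c _ /=.
  rewrite !WE -KE !(xa x1) // !(xa x2) //.
  have -> : (K * (1 + x1 c) + Rm c) * (x2 c * (K * (1 + x1 c) + Rm (c^-1 * a)%g)) =
    K ^+ 2 * x2 c * (1 + x1 c + x1 c + x1 c * x1 c) +
    K * (x2 c * (1 + x1 c) * Rm c) +
    K * (x2 c * (1 + x1 c) * Rm (c^-1 * a)%g) + x2 c * Rm c * Rm (c^-1 * a)%g by ring.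
  by rewrite x1s; ring.
rewrite KE.
rewrite u2 (shift (fun c => x2 c * (1 + x1 c) * Rm c)) rhoE.
have -> : forall v : R, 2 * (P * L1) ^+ 2 * 0 + P * L1 * (2 * (L2 * L12)) +
    P * L1 * (2 * (L2 * L12)) + v - 4 * P * (L1 * L2 * L12) = v.
  by move=> v; ring.
apply: le_trans (ler_norm_sum _ _ _) _.
rewrite exprS -[X in X * _]mulr1 -mulrA mulr_natl -sumr_const.
apply: ler_sum => c _; rewrite !normrM (xnorm x2s) !mul1r expr2.
by rewrite ler_pM // Rm_bound.
Qed.

End GroupConvolution.

(** * Coefficients of the product of four series *)

Section FourfoldSum.

Variables (M N : nat).
Let I := 'I_N.+1.

Lemma pair_divsum (f : nat -> int) m : (0 < m)%N -> (m <= N)%N ->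
  \sum_(p : I * I | (p.1 * p.2 == m)%N) f p.2 = divsum f m.
Proof.
move=> m0 mN; rewrite (divsum_nat f m0 mN).
rewrite -(pair_big_dep xpredT (fun i j : I => (i * j == m)%N) (fun _ j => f j)) /=.
rewrite (exchange_big_dep xpredT) //= [RHS]big_mkcond.
have -> : \sum_(1 <= k < N.+1) (if (k %| m)%N then f k else 0) =
  \sum_(0 <= k < N.+1) (if (k %| m)%N then f k else 0).
  by rewrite [RHS]big_ltn // dvd0n gtn_eqF // add0r.
rewrite big_mkord; apply: eq_bigr => k _; case: ifP => km; last first.
  by rewrite big1 // => i /eqP im; rewrite -im dvdn_mull in km.
have k0 : (0 < k)%N by apply: dvdn_gt0 km.
have jN : (m %/ k < N.+1)%N by rewrite ltnS (leq_trans (leq_div _ _)).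
rewrite (big_pred1 (Ordinal jN)) // => i; rewrite /= -val_eqE /=.
by rewrite -{1}(divnK km) eqn_pmul2r.
Qed.

Let prod4 (q : (I * I) * (I * I)) : nat := (q.1.1 * q.1.2 * (q.2.1 * q.2.2))%N.

(** Grouping the four factors in pairs gives the sum over m m' = n of [divsum f1 m] times f2 m'
    [divsum f1 m']. An odd exponent of r in n is odd in m or in m', and [divsum_eq0] applies. As n
    <= N, bounding the factors by N discards nothing. *)
Lemma fourfold_eq0_aux (f1 f2 : nat -> int) n r : qchar M f1 -> qchar M f2 ->
  (0 < n)%N -> (n <= N)%N -> prime r -> odd (logn r n) -> f1 r = -1 ->
  \sum_(q | prod4 q == n) f1 q.1.2 * (f2 q.2.1 * (f2 q.2.2 * f1 q.2.2)) = 0.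
Proof.
move=> q1 q2 n0 nN pr on fr.
pose h (q : (I * I) * (I * I)) : I * I :=
  (inord (q.1.1 * q.1.2), inord (q.2.1 * q.2.2)).
have vh q : prod4 q == n ->
    (h q).1 = (q.1.1 * q.1.2)%N :> nat /\ (h q).2 = (q.2.1 * q.2.2)%N :> nat.
  rewrite /prod4 => /eqP qn; rewrite /= !inordK //.
    rewrite ltnS; apply: leq_trans nN; rewrite -qn leq_pmull //.
    by move: n0; rewrite -qn !muln_gt0 => /andP[/andP[-> ->]].
  rewrite ltnS; apply: leq_trans nN; rewrite -qn leq_pmulr //.
  by move: n0; rewrite -qn !muln_gt0 => /andP[_ /andP[-> ->]].
rewrite (partition_big h (fun p => (p.1 * p.2 == n)%N)) /=; last first.
  by move=> q qn; have [-> ->] := vh q qn.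
apply: big1 => -[m m'] /= /eqP mn.
have [m0 m'0] : (0 < m)%N /\ (0 < m')%N by apply/andP; rewrite -muln_gt0 mn.
transitivity (\sum_(p : I * I | (p.1 * p.2 == m)%N)
   \sum_(p' : I * I | (p'.1 * p'.2 == m')%N) f1 p.2 * (f2 m' * f1 p'.2)).
  rewrite pair_big_dep /=; apply: congr_big => // q; last first.
    move=> /andP[qn /eqP hq]; have [_] := vh q qn; rewrite hq /= => ->.
    by case: q2 => _ -> _ _; rewrite !mulrA.
  apply/andP/andP => [[qn /eqP hq]|[/eqP e1 /eqP e2]].
    by have [] := vh q qn; rewrite hq /= => -> ->.
  have qn : prod4 q == n by rewrite /prod4 e1 e2 mn.
  split=> //; rewrite -pair_eqE /= -!val_eqE /=.
  by have [/= -> ->] := vh q qn; rewrite e1 e2 !eqxx.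
under eq_bigr do rewrite -mulr_sumr.
rewrite -mulr_suml -mulr_sumr !pair_divsum // -1?ltnS //.
have : odd (logn r m) || odd (logn r m').
  by move: on; rewrite -mn lognM // oddD; case: odd.
case/orP=> o.
  by rewrite (divsum_eq0 q1 m0 pr o fr) mul0r.
by rewrite (divsum_eq0 q1 m'0 pr o fr) !mulr0.
Qed.

Lemma fourfold_eq0 (f1 f2 : nat -> int) n r : qchar M f1 -> qchar M f2 ->
  (0 < n)%N -> (n <= N)%N -> prime r -> odd (logn r n) -> f1 r = -1 \/ f2 r = -1 ->
  \sum_(q | prod4 q == n) f1 q.1.2 * (f2 q.2.1 * (f2 q.2.2 * f1 q.2.2)) = 0.
Proof.
move=> q1 q2 n0 nN pr on [fr|fr]; first exact: fourfold_eq0_aux on fr.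
have := fourfold_eq0_aux q2 q1 n0 nN pr on fr.
(* Exchanging the two middle factors exchanges the roles of f1 and f2. *)
pose s (q : (I * I) * (I * I)) := ((q.1.1, q.2.1), (q.1.2, q.2.2)).
have sK : involutive s by move=> [[? ?] [? ?]].
rewrite (reindex_inj (inv_inj sK)) /= => E; rewrite -[RHS]E.
apply: eq_big => [q|q _]; first by rewrite /prod4 /= mulnACA.
by rewrite [in RHS]mulrCA [f1 q.2.2 * _]mulrC.
Qed.

End FourfoldSum.

(** * Characters on the group of units modulo M *)

Section ResidueClass.

Variables (M : nat) (M1 : (1 < M)%N).

(** Integers not prime to M get the default value 1; the weight [wgt] vanishes on them. *)
Definition rclass (k : nat) : {unit 'Z_M} :=
  insubd (1%g : {unit 'Z_M}) (k%:R : 'Z_M).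

Lemma rclassE k : coprime k M -> FinRing.uval (rclass k) = k%:R :> 'Z_M.
Proof.
move=> ck; rewrite /rclass; apply: (@insubdK _ _ _ (1%g : {unit 'Z_M})).
by rewrite -topredE /= unitZpE // coprime_sym.
Qed.

Lemma rclassM k l : coprime k M -> coprime l M ->
  rclass (k * l) = (rclass k * rclass l)%g.
Proof.
move=> ck cl; apply: val_inj; rewrite /= [LHS]rclassE ?coprimeMl ?ck //.
by rewrite [in RHS]/= !rclassE // natrM.
Qed.

Lemma rclass_eqP k l : coprime k M -> coprime l M ->
  reflect (k = l %[mod M]) (rclass k == rclass l).
Proof.
move=> ck cl; rewrite -(inj_eq val_inj) /= !rclassE //.
apply: (iffP eqP) => [/(congr1 (fun x : 'Z_M => x : nat))|kl].
  by rewrite !val_Zp_nat.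
by apply: val_inj; rewrite /= !val_Zp_nat.
Qed.

Lemma rclass_surj (b : {unit 'Z_M}) :
  coprime (FinRing.uval b : 'Z_M) M /\ rclass (FinRing.uval b : 'Z_M) = b.
Proof.
have cb : coprime (FinRing.uval b : 'Z_M) M.
  by have := valP b; rewrite -[\val b]natr_Zp unitZpE // coprime_sym.
by split=> //; apply: val_inj; rewrite /= rclassE // natr_Zp.
Qed.

Section Char.

Variables (R : realFieldType) (f : nat -> int).
Hypothesis qf : qchar M f.

Definition hatf (b : {unit 'Z_M}) : R := (f (FinRing.uval b : 'Z_M))%:~R.

Lemma hatf_rclass k : coprime k M -> hatf (rclass k) = (f k)%:~R.
Proof.
move=> ck; rewrite /hatf rclassE // val_Zp_nat //.
by case: qf => _ _ /(_ (k %% M)%N k) -> //; rewrite modn_mod.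
Qed.

Lemma hatfM b c : hatf (b * c)%g = hatf b * hatf c.
Proof.
have [cb <-] := rclass_surj b; have [cc <-] := rclass_surj c.
rewrite -rclassM // !hatf_rclass ?coprimeMl ?cb //.
by case: qf => _ -> _ _; rewrite rmorphM.
Qed.

Lemma hatf_sqr b : hatf b * hatf b = 1.
Proof.
have [cb _] := rclass_surj b; case: qf => _ _ _ /(_ (FinRing.uval b : 'Z_M)).
by rewrite cb /hatf => -[] ->; rewrite -rmorphM ?mulrNN mulr1.
Qed.

Lemma hatf_sum c : coprime c M -> f c = -1 -> \sum_b hatf b = 0.
Proof.
move=> cc fc; have : \sum_b hatf b = - \sum_b hatf b.
  rewrite {1}(reindex_inj (mulgI (rclass c))) /= -mulN1r mulr_sumr.
  by apply: eq_bigr => b _; rewrite hatfM hatf_rclass // fc rmorphN1.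
by move=> h; lra.
Qed.

End Char.

End ResidueClass.

Lemma class_sumE (R : nmodType) M (w : nat -> R) N t : (t < M)%N ->
  \sum_(0 <= k < N | (k %% M == t)%N) w k =
  \sum_(0 <= j < N) (if (j * M + t < N)%N then w (j * M + t)%N else 0).
Proof.
move=> tM; have M0 : (0 < M)%N by apply: leq_ltn_trans tM.
rewrite big_mkcond.
transitivity (\sum_(0 <= k < N) \sum_(0 <= j < N)
    if k == (j * M + t)%N then w k else 0).
  rewrite !big_nat; apply: eq_bigr => k /andP[_ kN]; rewrite -big_mkcond /=.
  have [kt|kt] := boolP (k %% M == t)%N; last first.
    rewrite big1 // => j /eqP kE; move: kt.
    by rewrite kE modnMDl modn_small ?eqxx.
  rewrite (eq_bigl (fun j => j == k %/ M)%N) => [|j].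
    by rewrite big_nat1_eq /= (leq_ltn_trans (leq_div _ _) kN).
  apply/eqP/eqP => [->|->]; last by rewrite -(eqP kt) -divn_eq.
  by rewrite divnMDl // divn_small // addn0.
rewrite exchange_big /=; apply: eq_bigr => j _; rewrite -big_mkcond /=.
by rewrite big_nat1_eq.
Qed.

(** The classes interlace: every element of class r but the first comes after its own element of
    class s, which has at least its weight, and the first costs at most 1. Requiring s > 0 avoids
    the index 0, where w is not monotone. *)
Lemma class_sum_le (R : realFieldType) M (w : nat -> R) N r s :
  (forall k, 0 <= w k) -> (forall k, w k <= 1) ->
  (forall k l, (0 < k)%N -> (k <= l)%N -> w l <= w k) ->
  (r < M)%N -> (0 < s < M)%N ->
  \sum_(0 <= k < N | (k %% M == r)%N) w k <=
  \sum_(0 <= k < N | (k %% M == s)%N) w k + 1.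
Proof.
move=> w0 w1 wm rM /andP[s0 sM]; rewrite !class_sumE //.
case: N => [|n]; first by rewrite !big_geq // add0r.
rewrite big_ltn // addrC lerD //; last by case: ifP.
rewrite [leRHS]big_nat_recr //= -[leLHS]addr0 lerD //; last by case: ifP.
rewrite big_add1 /=; apply: ler_sum => j _.
case: ifP => [h|_]; last by case: ifP.
have le : (j * M + s <= j.+1 * M + r)%N by rewrite mulSn; move: sM; clear; lia.
by rewrite (leq_ltn_trans le h) wm // addn_gt0 s0 orbT.
Qed.

(** * Damped sums *)

Section Damping.

Variable R : archiRealFieldType.

Lemma harmonic_unbounded (B : R) : exists n, B <= \sum_(1 <= k < n.+1) k%:R^-1.
Proof.
have key m : m%:R / 2 <= \sum_(1 <= k < (2 ^ m).+1) k%:R^-1 :> R.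
  elim: m => [|m IH]; first by rewrite mul0r sumr_ge0 // => k _; rewrite invr_ge0.
  rewrite (@big_cat_nat _ _ _ (2 ^ m).+1) ?ltnS ?leq_exp2l //=.
  rewrite -[X in X%:R / 2]addn1 natrD mulrDl lerD //.
  apply: (@le_trans _ _ (\sum_((2 ^ m).+1 <= k < (2 ^ m.+1).+1) (2 ^ m.+1)%:R^-1)).
    rewrite big_const_nat iter_addr_0 subSS expnS mul2n -addnn addnK -[leRHS]mulr_natr.
    rewrite addnn -mul2n natrM invfM mul1r -mulrA mulVf ?mulr1 //.
    by rewrite pnatr_eq0 -lt0n expn_gt0.
  rewrite [leLHS]big_nat [leRHS]big_nat; apply: ler_sum => k /andP[k1 k2].
  rewrite lef_pV2 ?posrE ?ltr0n ?expn_gt0 // ?ler_nat //.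
  by apply: leq_trans k1.
have [n Bn] : exists n : nat, B < n%:R.
  by exists (Num.bound `|B|); apply: le_lt_trans (archi_boundP _) => //; apply: ler_norm.
exists (2 ^ (2 * n))%N; apply: le_trans (key _).
by rewrite natrM; lra.
Qed.

Lemma pow_small (x e : R) : 0 <= x < 1 -> 0 < e ->
  exists m0, forall m, (m0 <= m)%N -> x ^+ m <= e.
Proof.
move=> /andP[x0 x1] e0; have y0 : 0 < 1 - x by lra.
have key m : x ^+ m * (1 + m%:R * (1 - x)) <= 1.
  elim: m => [|m IH]; first by rewrite expr0 mul0r addr0 mulr1.
  apply: le_trans IH; rewrite exprSr -mulrA ler_wpM2l ?exprn_ge0 //.
  rewrite -addn1 natrD; have : 0 <= (m%:R : R) by [].
  by move: (m%:R : R) => t t0; have : 0 <= (t + 1) * (1 - x) ^+ 2;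
    [rewrite mulr_ge0 // ?exprn_ge0; lra | nra].
pose m0 := Num.bound (e * (1 - x))^-1.
have m0P : (e * (1 - x))^-1 < m0%:R.
  by apply: archi_boundP; rewrite invr_ge0 mulr_ge0 // ltW.
exists m0 => m m0m; have pos : 0 < 1 + m%:R * (1 - x).
  by rewrite ltr_pwDl // mulr_ge0 // ltW.
rewrite -(ler_pM2r pos); apply: le_trans (key m) _.
have : 1 <= e * (m%:R * (1 - x)).
  rewrite mulrCA mulrC -ler_pdivrMl ?mulr_gt0 // mulr1.
  by apply: le_trans (ltW m0P) _; rewrite ler_nat.
by rewrite mulrDr mulr1; lra.
Qed.

(* The model is eta k = k^(-delta); only these algebraic properties are used,
   so that reals enter only through the existence of eta. *)
Definition damping (eta : nat -> R) :=
  [/\ forall m n, (0 < m)%N -> (0 < n)%N -> eta (m * n)%N = eta m * eta n,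
      forall n, (0 < n)%N -> 0 < eta n,
      forall m n, (0 < m)%N -> (m <= n)%N -> eta n <= eta m &
      eta 2%N < 1].

Lemma damping1 eta : damping eta -> eta 1%N = 1.
Proof.
move=> [eM e0 _ _]; have n0 : eta 1%N != 0 by rewrite gt_eqF ?e0.
by apply: (mulfI n0); rewrite -eM // mulr1.
Qed.

Lemma damping_pow2 eta m : damping eta -> eta (2 ^ m)%N = eta 2%N ^+ m.
Proof.
move=> de; elim: m => [|m IH]; first by rewrite damping1.
by rewrite expnS exprS -IH; case: de => -> //; rewrite expn_gt0.
Qed.

(** Condensation: the block from 2^i to 2^(i+1) contributes at most [eta 2 ^+ i], a term of a
    convergent geometric series. *)
Lemma damping_sum eta m : damping eta ->
  \sum_(1 <= k < 2 ^ m) eta k / k%:R <= (1 - eta 2%N)^-1.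
Proof.
move=> de; have [eM e0 em e2] := de.
have key : \sum_(1 <= k < 2 ^ m) eta k / k%:R <= \sum_(i < m) eta 2%N ^+ i.
  elim: m => [|m IH]; first by rewrite big_geq // big_ord0.
  rewrite (@big_cat_nat _ _ _ (2 ^ m)) ?expn_gt0 ?leq_exp2l //= big_ord_recr /=.
  rewrite lerD // -damping_pow2 //.
  apply: (@le_trans _ _ (\sum_(2 ^ m <= k < 2 ^ m.+1) eta (2 ^ m)%N / (2 ^ m)%:R)).
    rewrite [leLHS]big_nat [leRHS]big_nat; apply: ler_sum => k /andP[k1 k2].
    have p2 : (0 < 2 ^ m)%N by rewrite expn_gt0.
    rewrite ler_pM ?invr_ge0 ?em //; first by rewrite ltW // e0 // (leq_trans p2).
    by rewrite lef_pV2 ?posrE ?ltr0n ?ler_nat // (leq_trans p2).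
  rewrite big_const_nat iter_addr_0 expnS mul2n -addnn addnK -[leLHS]mulr_natr.
  by rewrite divfK // pnatr_eq0 -lt0n expn_gt0.
apply: le_trans key _; have y0 : 0 < 1 - eta 2%N by lra.
rewrite -(ler_pM2l y0) divff ?gt_eqF // -[1 - _]opprB mulNr -subrX1 opprB.
by rewrite lerBlDr lerDl exprn_ge0 // ltW // e0.
Qed.

(** Passes from partial sums, bounded below only from z0 on, to damped sums. Giving the first z0
    terms the common weight theta z0 costs at most z0 (1 - theta z0). *)
Lemma damped_lower (f theta : nat -> R) c z0 N : (0 < z0)%N -> (z0 <= N)%N ->
  (forall k, `|f k| <= 1) ->
  (forall z, (z0 <= z)%N -> c <= \sum_(1 <= k < z.+1) f k / k%:R) ->
  (forall k, 0 <= theta k) -> (forall k, (0 < k)%N -> theta k <= 1) ->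
  (forall m n, (0 < m)%N -> (m <= n)%N -> theta n <= theta m) ->
  c * theta z0 - z0%:R * (1 - theta z0) <= \sum_(1 <= k < N.+1) f k * (theta k / k%:R).
Proof.
move=> z00 zN f1 hc t0 t1 tm.
(* The first z0 terms are lumped into a 0, so that every partial sum of a is one to which the bound
   c applies. *)
pose a i := if i is 0 then \sum_(1 <= k < z0.+1) f k / k%:R
  else f (z0 + i)%N / (z0 + i)%:R.
pose b i := theta (z0 + i)%N.
have aS k : \sum_(0 <= i < k.+1) a i = \sum_(1 <= k < (z0 + k).+1) f k / k%:R.
  elim: k => [|k IH]; first by rewrite big_nat1 addn0.
  by rewrite big_nat_recr //= IH addnS [RHS]big_nat_recr.
have h1 : c * theta z0 <= \sum_(0 <= i < (N - z0).+1) a i * b i.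
  rewrite -{1}[z0]addn0; apply: abel_lower => [k|k|k].
  - by rewrite aS hc // leq_addr.
  - exact: t0.
  - by rewrite /b tm ?addnS // addn_gt0 z00.
have h2 : \sum_(0 <= i < (N - z0).+1) a i * b i =
    \sum_(1 <= k < z0.+1) f k / k%:R * theta z0 +
    \sum_(z0.+1 <= k < N.+1) f k * (theta k / k%:R).
  rewrite big_ltn //= /b addn0 mulr_suml; congr (_ + _).
  rewrite -[in RHS](add1n z0) big_addn subSn // [LHS]big_nat [RHS]big_nat.
  apply: eq_bigr => -[//|k] _; rewrite [(_ + z0)%N]addnC /=; ring.
rewrite (@big_cat_nat _ _ _ z0.+1) //=.
have h3 : - (z0%:R * (1 - theta z0)) <= \sum_(1 <= k < z0.+1) f k * (theta k / k%:R) -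
    \sum_(1 <= k < z0.+1) f k / k%:R * theta z0.
  rewrite -sumrB -mulrN mulr_natl.
  have -> : (- (1 - theta z0)) *+ z0 = \sum_(1 <= k < z0.+1) - (1 - theta z0).
    by rewrite big_const_nat iter_addr_0 subSS subn0.
  rewrite [leLHS]big_nat [leRHS]big_nat; apply: ler_sum => k /andP[k0 kz].
  have -> : f k * (theta k / k%:R) - f k / k%:R * theta z0 =
    f k * (k%:R^-1 * (theta k - theta z0)) by ring.
  have d0 : 0 <= theta k - theta z0 by rewrite subr_ge0 tm.
  have d1 : k%:R^-1 * (theta k - theta z0) <= 1 - theta z0.
    rewrite -[leRHS]mul1r ler_pM // ?invr_ge0 //; last by rewrite lerB // t1.
    by rewrite invf_le1 ?ltr0n // ler1n.
  have d2 : 0 <= k%:R^-1 * (theta k - theta z0) by rewrite mulr_ge0 ?invr_ge0.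
  move: d1 d2 (f1 k); rewrite ler_norml; move: (_ * (_ - _)) (f k) => u v d1 d2 /andP[v1 v2].
  nra.
lra.
Qed.

End Damping.

Section WeightedClassSums.

Variables (R : archiRealFieldType) (M : nat) (N : nat) (eta : nat -> R).
Hypotheses (M1 : (1 < M)%N) (de : damping eta).

Let I := 'I_N.+1.
Let w k : R := eta k ^+ 2 / k%:R.
Definition wgt (k : nat) : R := if coprime k M then w k else 0.
Definition Zsum (b : {unit 'Z_M}) : R := \sum_(i : I | rclass M i == b) wgt i.

Let cop0 k : coprime k M -> (0 < k)%N.
Proof.
by case: k => // /eqP; rewrite gcd0n => ME; move: M1; rewrite ME.
Qed.

Let eta0 k : (0 < k)%N -> 0 < eta k. Proof. by case: de => _ h _ _; apply: h. Qed.
Let eta1 k : (0 < k)%N -> eta k <= 1.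
Proof. by move=> k0; rewrite -(damping1 de); case: de => _ _ h _; apply: h. Qed.

Let ltW_eta k : (0 < k)%N -> 0 <= eta k.
Proof. by move=> k0; apply/ltW/eta0. Qed.
Let em k l : (0 < k)%N -> (k <= l)%N -> eta l <= eta k.
Proof. by case: de => _ _ h _; apply: h. Qed.

Let w0 k : 0 <= w k.
Proof. by rewrite /w mulr_ge0 ?invr_ge0 ?exprn_even_ge0. Qed.

Let w1 k : w k <= 1.
Proof.
case: k => [|k]; first by rewrite /w invr0 mulr0.
apply: mulr_ile1; rewrite ?exprn_even_ge0 ?invr_ge0 //.
  by rewrite exprn_ile1 ?eta1 // ltW ?eta0.
by rewrite invf_le1 ?ltr0n // ler1n.
Qed.

Let wm k l : (0 < k)%N -> (k <= l)%N -> w l <= w k.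
Proof.
move=> k0 kl; have l0 : (0 < l)%N by apply: leq_trans kl.
rewrite /w ler_pM ?exprn_even_ge0 ?invr_ge0 //.
  by rewrite lerXn2r ?nnegrE ?ltW_eta ?em.
by rewrite lef_pV2 ?posrE ?ltr0n // ler_nat.
Qed.

Let ZsumE b : Zsum b =
  \sum_(0 <= k < N.+1 | (k %% M == (FinRing.uval b : 'Z_M))%N) w k.
Proof.
have [cb rb] := rclass_surj M1 b.
have vM : ((FinRing.uval b : 'Z_M) < M)%N by rewrite -[X in (_ < X)%N](Zp_cast M1).
rewrite /Zsum big_mkord big_mkcond [RHS]big_mkcond; apply: eq_bigr => i _.
rewrite /wgt; have [ci|ci] := boolP (coprime i M).
  rewrite -{1}rb; suff -> : (rclass M i == rclass M (FinRing.uval b : 'Z_M)) =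
     (i %% M == (FinRing.uval b : 'Z_M))%N by [].
  by apply/(rclass_eqP M1 ci cb)/eqP; rewrite (modn_small vM).
rewrite if_same; case: eqP => // ib; move: ci.
by rewrite -coprime_modl ib cb.
Qed.

Lemma Zsum_close b c : `|Zsum b - Zsum c| <= 1.
Proof.
have val_pos d : (0 < (FinRing.uval d : 'Z_M) < M)%N.
  have [cd _] := rclass_surj M1 d.
  by rewrite cop0 //= -[X in (_ < X)%N](Zp_cast M1).
have h d e : Zsum d <= Zsum e + 1.
  rewrite !ZsumE; apply: (class_sum_le N.+1 w0 w1 wm) => //.
  by case/andP: (val_pos d).
by rewrite ler_distl lerBlDr !h.
Qed.

Lemma Zsum_hat f : qchar M f ->
  \sum_b hatf R f b * Zsum b =
  \sum_(1 <= k < N.+1) (f k)%:~R * (eta k ^+ 2 / k%:R).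
Proof.
move=> qf; have -> : \sum_b hatf R f b * Zsum b = \sum_(i : I) (f i)%:~R * w i.
  rewrite (partition_big (fun i : I => rclass M i) xpredT) //=.
  apply: eq_bigr => b _; rewrite /Zsum mulr_sumr; apply: eq_bigr => i /eqP ib.
  rewrite /wgt; case: ifP => ci; first by rewrite -ib hatf_rclass.
  by case: qf => _ _ _ /(_ i); rewrite ci => ->; rewrite mulr0 mul0r.
rewrite -(big_mkord xpredT (fun i => (f i)%:~R * w i)) big_ltn //.
by rewrite {1}/w invr0 !mulr0 add0r.
Qed.

(** The integers j M + 1 with j < J lie in the class of 1 and are at most (j + 1) M, so the class
    inherits the divergence of the harmonic series. *)
Lemma Zsum_large J : (J * M < N)%N ->
  eta (J * M).+1 ^+ 2 / M%:R * \sum_(1 <= k < J.+1) k%:R^-1 <= Zsum 1%g.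
Proof.
move=> JN; have M0 : (0 < M)%N by apply: ltnW.
have -> : Zsum 1%g = \sum_(0 <= k < N.+1 | (k %% M == 1)%N) w k.
  by rewrite ZsumE /=; apply: eq_bigl => k; congr (_ == _).
rewrite class_sumE //.
have JN1 : (J <= N.+1)%N by apply: leq_trans (leqW (ltnW JN)); rewrite leq_pmulr.
rewrite [leRHS](@big_cat_nat _ _ _ J) //= -[leLHS]addr0 lerD //; last first.
  by apply: sumr_ge0 => j _; case: ifP.
rewrite mulr_sumr big_add1 /= [leLHS]big_nat [leRHS]big_nat.
apply: ler_sum => j /andP[_ jJ].
have jM : (j * M + 1 <= (J * M).+1)%N by rewrite addn1 ltnS leq_mul2r ltnW ?orbT.
have jMN : (j * M + 1 < N.+1)%N by apply: leq_ltn_trans jM _.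
rewrite jMN /w -mulrA ler_pM ?exprn_even_ge0 ?mulr_ge0 ?invr_ge0 //.
  by rewrite lerXn2r ?nnegrE ?ltW_eta ?em // addn1.
rewrite -invfM -natrM lef_pV2 ?posrE ?ltr0n ?muln_gt0 ?M0 ?addn1 // ler_nat.
by move: M0; clear; nia.
Qed.

Variables f1 f2 : nat -> int.
Hypotheses (qf1 : qchar M f1) (qf2 : qchar M f2).

Let W := conv Zsum (fun b => hatf R f1 b * Zsum b).
Let H := conv W (fun b => hatf R f2 b * W b).

Let Q := ((I * I) * (I * I))%type.
Let prod4 (q : Q) : nat := (q.1.1 * q.1.2 * (q.2.1 * q.2.2))%N.
Let sgn4 (q : Q) : int := f1 q.1.2 * (f2 q.2.1 * (f2 q.2.2 * f1 q.2.2)).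
Let wgt4 (q : Q) : R := wgt q.1.1 * wgt q.1.2 * (wgt q.2.1 * wgt q.2.2).

Let wgt_cop k : wgt k != 0 -> coprime k M.
Proof. by rewrite /wgt; case: ifP => //; rewrite eqxx. Qed.

Let HE a : coprime a M -> H (rclass M a) =
  \sum_(q : Q | prod4 q == a %[mod M]) (sgn4 q)%:~R * wgt4 q.
Proof.
move=> ca.
have eq_conv (s s' t t' : {unit 'Z_M} -> R) c : s =1 s' -> t =1 t' ->
    conv s t c = conv s' t' c.
  by move=> ss tt; apply: eq_bigr => b _; rewrite ss tt.
have WE c : W c = \sum_(p : I * I | (rclass M p.1 * rclass M p.2)%g == c)
    wgt p.1 * ((f1 p.2)%:~R * wgt p.2).
  rewrite -(conv_push (fun i : I => rclass M i) (fun i : I => rclass M i)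
    (fun i : I => wgt i) (fun i : I => (f1 i)%:~R * wgt i)).
  apply: eq_conv => // b; rewrite mulr_sumr; apply: eq_bigr => i /eqP <-.
  have [->|/wgt_cop ci] := eqVneq (wgt i) 0; first by rewrite !mulr0.
  by rewrite hatf_rclass.
have -> : H (rclass M a) = \sum_(q : Q |
    ((rclass M q.1.1 * rclass M q.1.2) * (rclass M q.2.1 * rclass M q.2.2))%g == rclass M a)
    wgt q.1.1 * ((f1 q.1.2)%:~R * wgt q.1.2) *
    ((f2 q.2.1 * f2 q.2.2)%:~R * (wgt q.2.1 * ((f1 q.2.2)%:~R * wgt q.2.2))).
  rewrite -(conv_push (fun p : I * I => (rclass M p.1 * rclass M p.2)%g)
     (fun p : I * I => (rclass M p.1 * rclass M p.2)%g)
     (fun p : I * I => wgt p.1 * ((f1 p.2)%:~R * wgt p.2))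
     (fun p : I * I => (f2 p.1 * f2 p.2)%:~R * (wgt p.1 * ((f1 p.2)%:~R * wgt p.2)))).
  apply: eq_conv => b; first exact: WE.
  rewrite WE mulr_sumr; apply: eq_bigr => p /eqP <-.
  have [->|/wgt_cop c1] := eqVneq (wgt p.1) 0; first by rewrite !mul0r !mulr0.
  have [->|/wgt_cop c2] := eqVneq (wgt p.2) 0; first by rewrite !mulr0.
  by rewrite hatfM // !hatf_rclass // rmorphM.
rewrite big_mkcond [RHS]big_mkcond; apply: eq_bigr => q _.
have -> : (sgn4 q)%:~R * wgt4 q = wgt q.1.1 * ((f1 q.1.2)%:~R * wgt q.1.2) *
    ((f2 q.2.1 * f2 q.2.2)%:~R * (wgt q.2.1 * ((f1 q.2.2)%:~R * wgt q.2.2))).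
  rewrite /sgn4 /wgt4 !rmorphM /=; ring.
have [->|/wgt_cop c11] := eqVneq (wgt q.1.1) 0; first by rewrite !mul0r !if_same.
have [->|/wgt_cop c12] := eqVneq (wgt q.1.2) 0; first by rewrite !(mul0r, mulr0) !if_same.
have [->|/wgt_cop c21] := eqVneq (wgt q.2.1) 0; first by rewrite !(mul0r, mulr0) !if_same.
have [->|/wgt_cop c22] := eqVneq (wgt q.2.2) 0; first by rewrite !(mul0r, mulr0) !if_same.
rewrite -!rclassM ?coprimeMl ?c11 ?c12 ?c21 ?c22 //.
suff -> : (rclass M (q.1.1 * q.1.2 * (q.2.1 * q.2.2)) == rclass M a) =
   (prod4 q == a %[mod M]) by [].
by apply/rclass_eqP/eqP; rewrite ?coprimeMl ?c11 ?c12 ?c21 ?c22.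
Qed.

(** Quadruples with a product n <= N cancel for each n, by [fourfold_eq0]. For the others, one of
    the two factors eta of the product is at most eta N, and the second splits over the four
    coordinates, leaving a fourth power. *)
Lemma Hsum_small a : (0 < N)%N -> coprime a M ->
  (forall n, (0 < n)%N -> (n <= N)%N -> n = a %[mod M] ->
     exists r, [/\ prime r, odd (logn r n) & f1 r = -1 \/ f2 r = -1]) ->
  `|H (rclass M a)| <= eta N * (\sum_(1 <= k < N.+1) eta k / k%:R) ^+ 4.
Proof.
move=> N0 ca bad; rewrite HE //.
pose nu k : R := if coprime k M then eta k / k%:R else 0.
have wgtE k : wgt k = eta k * nu k.
  by rewrite /wgt /nu; case: ifP; rewrite ?mulr0 // /w expr2 mulrA.
have nu0 k : 0 <= nu k.
  rewrite /nu; case: ifP => // ck; rewrite divr_ge0 // ltW // eta0 //.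
  exact: cop0.
pose nu4 (q : Q) := nu q.1.1 * nu q.1.2 * (nu q.2.1 * nu q.2.2).
have wgt4E q : wgt4 q = eta (prod4 q) * nu4 q.
  rewrite /wgt4 !wgtE /nu4 /prod4.
  have [c|] := boolP [&& coprime q.1.1 M, coprime q.1.2 M, coprime q.2.1 M & coprime q.2.2 M].
    case/and4P: c => /cop0 c1 /cop0 c2 /cop0 c3 /cop0 c4.
    case: de => eM _ _ _; rewrite !eM ?muln_gt0 ?c1 ?c2 ?c3 ?c4 //; ring.
  rewrite /nu; do 4?case: (coprime _ _) => //=; rewrite ?(mulr0, mul0r) //.
rewrite (bigID (fun q => prod4 q <= N)%N) /=.
have -> : \sum_(q | (prod4 q == a %[mod M]) && (prod4 q <= N)%N) (sgn4 q)%:~R * wgt4 q = 0.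
  rewrite (partition_big (fun q : Q => inord (prod4 q) : I)
     (fun n => n == a %[mod M])) /=; last first.
    by move=> q /andP[qa qN]; rewrite inordK.
  apply: big1 => n /eqP na.
  have cn : coprime n M by rewrite -coprime_modl na coprime_modl.
  have n0 := cop0 cn; have nN : (n <= N)%N by rewrite -ltnS.
  have [r [pr on fr]] := bad n n0 nN na.
  transitivity (\sum_(q | prod4 q == n) (sgn4 q)%:~R * (eta n ^+ 2 / n%:R)).
    apply: congr_big => // q; last first.
      move=> /andP[/andP[qa qN] /eqP qn].
      have pn : prod4 q = n by rewrite -qn inordK.
      have : coprime (prod4 q) M by rewrite pn.
      rewrite /prod4 !coprimeMl => /andP[/andP[c1 c2] /andP[c3 c4]].
      congr (_ * _); rewrite -pn /wgt4 /wgt c1 c2 c3 c4 /w /prod4.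
      case: de => eM _ _ _; rewrite !eM ?muln_gt0 ?cop0 // !natrM !invfM; ring.
    apply/andP/eqP => [[/andP[qa qN] /eqP <-]|qn]; first by rewrite inordK.
    rewrite qn nN na eqxx; split=> //; apply/eqP/val_inj.
    by rewrite /= inordK.
  by rewrite -mulr_suml -rmorph_sum /= (fourfold_eq0 qf1 qf2 n0 nN pr on fr) mul0r.
rewrite add0r; apply: le_trans (ler_norm_sum _ _ _) _.
have -> : (\sum_(1 <= k < N.+1) eta k / k%:R) ^+ 4 =
    (\sum_(1 <= k < N.+1) eta k / k%:R) * (\sum_(1 <= k < N.+1) eta k / k%:R) *
    ((\sum_(1 <= k < N.+1) eta k / k%:R) * (\sum_(1 <= k < N.+1) eta k / k%:R)) by ring.
have nu_le : \sum_(i : I) nu i <= \sum_(1 <= k < N.+1) eta k / k%:R.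
  rewrite -(big_mkord xpredT nu) big_ltn // {1}/nu.
  have -> : coprime 0 M = false by apply: contraTF isT => /cop0.
  rewrite add0r [leLHS]big_nat [leRHS]big_nat; apply: ler_sum => k /andP[k0 _].
  by rewrite /nu; case: ifP => // _; rewrite divr_ge0 // ltW ?eta0.
have snu0 : 0 <= \sum_(i : I) nu i by apply: sumr_ge0.
apply: (@le_trans _ _ (eta N * ((\sum_(i : I) nu i) * (\sum_(i : I) nu i) *
   ((\sum_(i : I) nu i) * (\sum_(i : I) nu i))))); last first.
  by rewrite ler_wpM2l ?ltW_eta // !ler_pM ?mulr_ge0.
have -> : (\sum_(i : I) nu i) * (\sum_(i : I) nu i) *
    ((\sum_(i : I) nu i) * (\sum_(i : I) nu i)) = \sum_(q : Q) nu4 q.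
  have sq : (\sum_(i : I) nu i) * (\sum_(i : I) nu i) =
      \sum_(p : I * I) nu p.1 * nu p.2.
    by rewrite big_distrlr pair_bigA.
  by rewrite sq big_distrlr pair_bigA.
rewrite mulr_sumr big_mkcond; apply: ler_sum => q _.
have nu40 : 0 <= nu4 q by rewrite /nu4 !mulr_ge0.
case: ifP => [/andP[_ qN]|_]; last by rewrite mulr_ge0 ?ltW_eta.
rewrite -ltnNge in qN; have q0 : (0 < prod4 q)%N by apply: leq_ltn_trans qN.
have s1 : `|(sgn4 q)%:~R| <= 1 :> R.
  rewrite -intr_norm -[1]/(1%:~R) ler_int /sgn4 !normrM.
  by rewrite !mulr_ile1 ?mulr_ge0 ?(qchar_norm qf1) ?(qchar_norm qf2).
rewrite normrM wgt4E -[leRHS]mul1r ler_pM // normrM ger0_norm ?ltW_eta //.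
by rewrite ger0_norm // ler_wpM2r // em // ltnW.
Qed.

End WeightedClassSums.

(** The numerical end of [damped_lower]: t >= 1/2 secures c/2, and the loss z (1 - t) is at most
    c/4. *)
Lemma damped_bound (R : realFieldType) (c z t e : R) : 0 < c -> 0 <= z ->
  1 - 2 * e <= t -> e <= 1 / 4 -> z * (2 * e) <= c / 4 ->
  c / 4 <= c * t - z * (1 - t).
Proof.
move=> c0 z0 te e4 ze.
have h1 : 0 <= c * (t - 1 / 2) by rewrite mulr_ge0 ?(ltW c0) //; lra.
have h2 : 0 <= z * (2 * e - (1 - t)) by rewrite mulr_ge0 //; lra.
lra.
Qed.

Lemma sqr_lower (R : realFieldType) (x e : R) :
  e <= 1 / 4 -> 1 - e <= x -> 1 - 2 * e <= x ^+ 2.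
Proof.
move=> e4 ex; have h : 0 <= (x - (1 - e)) * (x + (1 - e)) by rewrite mulr_ge0; lra.
by have := sqr_ge0 e; lra.
Qed.

(** The bound on P makes 4 P (c/4)^3 at least g + 2, so 2 remains after the error g. *)
Lemma main_term_large (R : realFieldType) (g c P x y z H : R) :
  0 <= g -> 0 < c -> (g + 2) * 16 / c ^+ 3 <= P ->
  c / 4 <= x -> c / 4 <= y -> c / 4 <= z ->
  `|H - 4 * P * (x * y * z)| <= g -> 1 < `|H|.
Proof.
move=> g0 c0 hP hx hy hz; rewrite ler_norml => /andP[h1 _].
have c4 : 0 <= c / 4 by rewrite divr_ge0 // ltW.
have xyz : (c / 4) * (c / 4) * (c / 4) <= x * y * z by apply: ler_pM; [apply: mulr_ge0|..|apply: ler_pM|].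
have P0 : 0 <= (g + 2) * 16 / c ^+ 3.
  by rewrite !mulr_ge0 ?invr_ge0 ?exprn_ge0 ?addr_ge0 // ltW.
have : (g + 2) * 16 / c ^+ 3 * ((c / 4) * (c / 4) * (c / 4)) <= P * (x * y * z).
  by apply: ler_pM => //; apply: mulr_ge0 => //; apply: mulr_ge0.
have -> : (g + 2) * 16 / c ^+ 3 * ((c / 4) * (c / 4) * (c / 4)) = (g + 2) / 4.
  by field; rewrite gt_eqF.
move=> h2; apply: lt_le_trans (ler_norm _); lra.
Qed.

Lemma quarter_le (R : realFieldType) (t e : R) :
  1 - 2 * e <= t -> e <= 1 / 4 -> 1 / 4 <= t.
Proof. lra. Qed.

Lemma eighth_le (R : realFieldType) (c z e : R) :
  0 < z -> e <= c / (8 * z) -> z * (2 * e) <= c / 4.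
Proof. by move=> z0; rewrite ler_pdivlMr ?mulr_gt0 //; lra. Qed.

Section TwoCharacters.

Variable R : archiRealFieldType.
Hypothesis damping_ex : forall (n : nat) (e : R), (0 < n)%N -> 0 < e ->
  exists eta, damping eta /\ 1 - e <= eta n.

(** If no n up to N will do, [Hsum_small] bounds the fourfold sum by 1, while
    [biquadratic_convolution] makes it larger. The order of the choices matters: J makes the
    harmonic sum large, then eta is almost 1 up to T so as to preserve it and the bounds on L, and
    only then N, depending on eta, kills the tail. *)
Lemma two_characters (D1 D2 : int) (M a : nat) :
  D1 != 0 -> D2 != 0 ->
  (forall x : int, x ^+ 2 != D1) -> (forall x : int, x ^+ 2 != D2) ->
  (forall x : int, x ^+ 2 != D1 * D2) ->
  (0 < M)%N -> (8 * `|(D1 * D2)%R| %| M)%N -> coprime a M ->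
  jac D1 a = 1 -> jac D2 a = 1 ->
  exists n, [/\ (0 < n)%N, n = a %[mod M] & forall r, prime r ->
    odd (logn r n) -> leg D1 r = 1 /\ leg D2 r = 1].
Proof.
move=> D10 D20 nsq1 nsq2 nsq12 M0 dM ca j1 j2.
have M8 : (8 %| M)%N by apply: dvdn_trans dM; apply: dvdn_mulr.
have M1 : (1 < M)%N by apply: leq_trans (dvdn_leq M0 M8).
have D120 : D1 * D2 != 0 by rewrite mulf_neq0.
have dM1 : (8 * `|D1| %| M)%N.
  by apply: dvdn_trans dM; rewrite abszM mulnA dvdn_mulr.
have dM2 : (8 * `|D2| %| M)%N.
  by apply: dvdn_trans dM; rewrite abszM mulnCA dvdn_mull.
pose f1 := chi M D1; pose f2 := chi M D2; pose f12 := chi M (D1 * D2).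
have q1 : qchar M f1 := chi_qchar D10 M0 dM1.
have q2 : qchar M f2 := chi_qchar D20 M0 dM2.
have q12 : qchar M f12 := chi_qchar D120 M0 dM.
have oddM k : coprime k M -> odd k.
  move=> ck; rewrite -coprimen2; apply: coprime_dvdr ck.
  by apply: dvdn_trans M8.
have f12E k : f12 k = f1 k * f2 k.
  rewrite /f12 /f1 /f2 /chi; case: ifP => [ck|]; last by rewrite mul0r.
  by rewrite jac_mulD // oddM.
have [n1 [_ cn1 jn1]] := jac_nontrivial D10 nsq1 M0 dM1.
have [n2 [_ cn2 jn2]] := jac_nontrivial D20 nsq2 M0 dM2.
have [n3 [_ cn3 jn3]] := jac_nontrivial D120 nsq12 M0 dM.
have fn1 : f1 n1 = -1 by rewrite /f1 /chi cn1.
have fn2 : f2 n2 = -1 by rewrite /f2 /chi cn2.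
have fn3 : f12 n3 = -1 by rewrite /f12 /chi cn3.
have [c [z0 [c0 z00 L1 L2 L12]]] : exists c : R, exists z0, [/\ 0 < c, (0 < z0)%N,
    forall z, (z0 <= z)%N -> c <= Lsum R f1 z,
    forall z, (z0 <= z)%N -> c <= Lsum R f2 z &
    forall z, (z0 <= z)%N -> c <= Lsum R f12 z].
  have [c1 [z1 [c10 h1]]] := chi_Lsum_pos R D10 nsq1 M1 dM1.
  have [c2 [z2 [c20 h2]]] := chi_Lsum_pos R D20 nsq2 M1 dM2.
  have [c3 [z3 [c30 h3]]] := chi_Lsum_pos R D120 nsq12 M1 dM.
  exists (Num.min c1 (Num.min c2 c3)), (maxn z1 (maxn z2 z3)).+1.
  split=> [||z|z|z]; rewrite ?lt_min ?c10 ?c20 ?c30 // => /ltnW;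
    rewrite !geq_max => /and3P[zz1 zz2 zz3].
  - by rewrite (le_trans _ (h1 z zz1)) // ge_min lexx.
  - by rewrite (le_trans _ (h2 z zz2)) // !ge_min lexx orbT.
  - by rewrite (le_trans _ (h3 z zz3)) // !ge_min lexx !orbT.
have MR : 0 < M%:R :> R by rewrite ltr0n.
have zR : 0 < z0%:R :> R by rewrite ltr0n.
pose g : R := #|{: {unit 'Z_M}}|%:R ^+ 3.
pose B : R := (g + 2) * 16 / c ^+ 3.
have g0 : 0 <= g by rewrite exprn_ge0.
have B0 : 0 <= B by rewrite /B !mulr_ge0 ?invr_ge0 ?exprn_ge0 ?addr_ge0 // ltW.
have [J HJ] := harmonic_unbounded (4 * B * M%:R).
pose T := maxn z0 (J * M).+1.
pose e : R := Num.min (1 / 4) (c / (8 * z0%:R)).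
have e0 : 0 < e by rewrite lt_min !divr_gt0 ?mulr_gt0.
have [|eta [de eT]] := damping_ex (n := T) _ e0; first by rewrite leq_max z00.
have [eM ep em e2] := de.
have ege k : (0 < k)%N -> 0 <= eta k by move=> k0; rewrite ltW // ep.
have ele k : (0 < k)%N -> eta k <= 1 by move=> k0; rewrite -(damping1 de) em.
have theta_large k : (0 < k)%N -> (k <= T)%N -> 1 - 2 * e <= eta k ^+ 2.
  move=> k0 kT; apply: sqr_lower; first by rewrite ge_min lexx.
  by apply: le_trans eT _; apply: em.
have e4 : e <= 1 / 4 by rewrite ge_min lexx.
have ez : z0%:R * (2 * e) <= c / 4.
  have : e <= c / (8 * z0%:R) by rewrite ge_min lexx orbT.
  exact: eighth_le.
pose C : R := (1 - eta 2%N)^-1.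
have C0 : 0 < C by rewrite invr_gt0 subr_gt0.
have [m0 m0P] : exists m0, forall m, (m0 <= m)%N -> eta 2%N ^+ m <= (C ^+ 4)^-1.
  by apply: pow_small; rewrite ?invr_gt0 ?exprn_gt0 // e2 ltW // ep.
(* m0 makes eta N at most C^(-4), where C bounds the sum of eta k / k; adding T ensures N > T. *)
pose m := (m0 + T)%N; pose N := (2 ^ m)%N.
have TN : (T < N)%N by apply: leq_trans (ltn_expl m (isT : 1 < 2)%N); rewrite ltnS leq_addl.
have N0 : (0 < N)%N by rewrite expn_gt0.
have z0N : (z0 <= N)%N by rewrite (leq_trans _ (ltnW TN)) // leq_maxl.
have JN : (J * M < N)%N by rewrite (leq_trans _ (ltnW TN)) // leq_maxr.
pose good n := [&& (0 < n)%N, (n == a %[mod M])%N &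
  all (fun r => odd (logn r n) ==> (leg D1 r == 1) && (leg D2 r == 1)) (primes n)].
have [/hasP[n _ /and3P[n0 /eqP na /allP ok]]|/hasPn nogood] := boolP (has good (iota 0 N.+1)).
  exists n; split=> // r pr on; have rn : r \in primes n.
    by rewrite -logn_gt0; case: logn on.
  by have := ok r rn; rewrite on => /andP[/eqP -> /eqP ->].
exfalso.
have bad n : (0 < n)%N -> (n <= N)%N -> n = a %[mod M] ->
     exists r, [/\ prime r, odd (logn r n) & f1 r = -1 \/ f2 r = -1].
  move=> n0 nN na; have := nogood n; rewrite mem_iota /= ltnS nN => /(_ isT).
  rewrite /good n0 na eqxx /= => /allPn[r]; rewrite mem_primes => /and3P[pr _ rn].
  rewrite negb_imply => /andP[on ne]; exists r; split=> //.
  have cr : coprime r M.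
    apply: coprime_dvdl rn _; by rewrite -coprime_modl na coprime_modl.
  have legs D : (8 * `|D| %| M)%N -> leg D r = 1 \/ chi M D r = -1.
    move=> dD; rewrite /chi cr jac_prime //; apply: leg_unitE => //.
    rewrite dvdzE /= -prime_coprime //; apply: coprime_dvdr cr.
    by apply: dvdn_trans dD; apply: dvdn_mull.
  case: (legs D1 dM1) => [l1|]; last by left.
  case: (legs D2 dM2) => [l2|]; last by right.
  by move: ne; rewrite l1 l2.
have Hle := Hsum_small M1 de q1 q2 N0 ca bad.
have up : eta N * (\sum_(1 <= k < N.+1) eta k / k%:R) ^+ 4 <= 1.
  have sC : \sum_(1 <= k < N.+1) eta k / k%:R <= C.
    apply: le_trans (damping_sum m.+1 de).
    rewrite [leRHS](@big_cat_nat _ _ _ N.+1) //=; last by rewrite ltn_exp2l.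
    rewrite lerDl big_nat sumr_ge0 // => k /andP[k0 _].
    by rewrite divr_ge0 // ltW // ep // (leq_trans _ k0).
  have s0 : 0 <= \sum_(1 <= k < N.+1) eta k / k%:R.
    by rewrite big_nat sumr_ge0 // => k /andP[k0 _]; rewrite divr_ge0 // ltW // ep.
  apply: (@le_trans _ _ ((C ^+ 4)^-1 * C ^+ 4)).
    rewrite ler_pM ?exprn_ge0 //; first by rewrite ltW // ep.
      by rewrite /N damping_pow2 // m0P // leq_addr.
    by rewrite lerXn2r ?nnegrE // ltW.
  by rewrite mulVf // gt_eqF // exprn_gt0.
have low f : qchar M f -> (forall z, (z0 <= z)%N -> c <= Lsum R f z) ->
    c / 4 <= \sum_b hatf R f b * @Zsum R M N eta b.
  move=> qf hf; rewrite Zsum_hat //.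
  have := @damped_lower R (fun k => (f k)%:~R) (fun k => eta k ^+ 2) c z0 N z00 z0N.
  move=> /(_ _ hf) h; apply: le_trans (h _ _ _ _).
  - by apply: (damped_bound c0 (ltW zR) _ e4 ez); rewrite theta_large ?leq_maxl.
  - move=> k; rewrite -intr_norm -[1]/(1%:~R) ler_int; exact: qchar_norm qf k.
  - by move=> k; rewrite exprn_even_ge0.
  - by move=> k k0; rewrite exprn_ile1 ?ege ?ele.
  - move=> k l k0 kl; rewrite lerXn2r ?nnegrE ?em ?ege //.
    exact: leq_trans kl.
have P_large : B <= @Zsum R M N eta 1%g.
  apply: le_trans (Zsum_large M1 de JN).
  have t := theta_large (J * M).+1 isT (leq_maxr _ _).
  apply: (@le_trans _ _ (1 / 4 / M%:R * (4 * B * M%:R))).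
    by rewrite le_eqVlt; apply/orP; left; apply/eqP; field; rewrite gt_eqF.
  have t4 : 1 / 4 <= eta (J * M).+1 ^+ 2 by exact: quarter_le t e4.
  apply: ler_pM => //; first by rewrite !divr_ge0.
    by apply: mulr_ge0 => //; apply: mulr_ge0.
  by rewrite ler_pM2r ?invr_gt0.
have sum_hat f k : qchar M f -> coprime k M -> f k = -1 ->
    \sum_(b : {unit 'Z_M}) hatf R f b = 0.
  by move=> qf ck fk; apply: (hatf_sum M1 R qf ck fk).
have h12 (b : {unit 'Z_M}) : hatf R f1 b * hatf R f2 b = hatf R f12 b.
  by rewrite /hatf f12E rmorphM.
have s12 : \sum_(b : {unit 'Z_M}) hatf R f1 b * hatf R f2 b = 0.
  by rewrite (eq_bigr _ (fun b _ => h12 b)); apply: sum_hat fn3.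
have := @biquadratic_convolution R _ (hatf R f1) (hatf R f2)
  (hatfM M1 R q1) (hatfM M1 R q2) (hatf_sqr M1 R q1) (hatf_sqr M1 R q2)
  (sum_hat _ _ q1 cn1 fn1) (sum_hat _ _ q2 cn2 fn2) s12
  (@Zsum R M N eta) (@Zsum R M N eta 1%g) (fun b => Zsum_close N M1 de b 1%g) (rclass M a).
rewrite !hatf_rclass // /f1 /f2 /chi ca j1 j2 -/(chi M D1) -/(chi M D2) => /(_ erefl erefl).
have l1 := low _ q1 L1; have l2 := low _ q2 L2; have l12 := low _ q12 L12.
have -> : \sum_b hatf R f1 b * hatf R f2 b * @Zsum R M N eta b =
    \sum_b hatf R f12 b * @Zsum R M N eta b.
  by apply: eq_bigr => b _; rewrite h12.
have {Hle up} := le_trans Hle up.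
move=> Hle Heq; have := main_term_large g0 c0 P_large l1 l2 l12 Heq.
by rewrite ltNge Hle.
Qed.

End TwoCharacters.

Lemma damping_exists (R : realType) n (e : R) : (0 < n)%N -> 0 < e ->
  exists eta, damping eta /\ 1 - e <= eta n.
Proof.
move=> n0 e0; have ln0 k : (0 < k)%N -> 0 <= ln (k%:R : R).
  by move=> k0; rewrite ln_ge0 // ler1n.
(* Because expR x >= 1 + x, it suffices that delta ln n <= e; the summand 1 keeps the denominator
   positive at n = 1. *)
pose delta := e / (1 + ln n%:R).
have d0 : 0 < delta by rewrite divr_gt0 // ltr_pwDl // ln0.
exists (fun k => expR (- delta * ln k%:R)); split.
  split=> [k l k0 l0|k k0|k l k0 kl|].
  - by rewrite natrM lnM ?posrE ?ltr0n // mulrDr expRD.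
  - exact: expR_gt0.
  - rewrite ler_expR !mulNr lerN2 ler_wpM2l ?(ltW d0) //.
    by rewrite ler_ln ?posrE ?ltr0n ?ler_nat // (leq_trans k0).
  - rewrite -[ltRHS]expR0 ltr_expR mulNr oppr_lt0 mulr_gt0 //.
    by rewrite ln_gt0 // ltr1n.
apply: le_trans (expR_ge1Dx _); rewrite lerD2l mulNr lerN2.
rewrite /delta mulrAC ler_pdivrMr ?ltr_pwDl ?ln0 // mulrDr mulr1 lerDr.
exact: ltW.
Qed.

Theorem two_character_integer (D1 D2 : int) (M a : nat) :
  D1 != 0 -> D2 != 0 ->
  (forall x : int, x ^+ 2 != D1) -> (forall x : int, x ^+ 2 != D2) ->
  (forall x : int, x ^+ 2 != D1 * D2) ->
  (0 < M)%N -> (8 * `|(D1 * D2)%R| %| M)%N -> coprime a M ->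
  jac D1 a = 1 -> jac D2 a = 1 ->
  exists n, [/\ (0 < n)%N, n = a %[mod M] & forall r, prime r ->
    odd (logn r n) -> leg D1 r = 1 /\ leg D2 r = 1].
Proof. exact: two_characters (@damping_exists Rdefinitions.R) _ _ _ _. Qed.

(** * Legendre's theorem on ternary forms *)

(* Thue's lemma in disguise: by the pigeonhole principle, a box with more than D
   points contains two points with the same residue. *)
Definition residue_map (F : int -> int -> int -> int) (D : nat) :=
  exists f : int -> int -> int -> nat, (forall x y z, (f x y z < D)%N) /\
  forall x y z x' y' z', f x y z = f x' y' z' ->
    (D %| F (x - x') (y - y') (z - z'))%Z.

Lemma residue_mapM F D1 D2 : coprime D1 D2 -> residue_map F D1 -> residue_map F D2 ->
  residue_map F (D1 * D2).
Proof.
move=> cD [f1 [h1 p1]] [f2 [h2 p2]].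
exists (fun x y z => f1 x y z * D2 + f2 x y z)%N; split=> [x y z|x y z x' y' z' E].
  by move: (h1 x y z) (h2 x y z); clear; nia.
have D2p : (0 < D2)%N by apply: leq_trans (h2 0 0 0).
have E1 : f1 x y z = f1 x' y' z'.
  have := congr1 (fun k => k %/ D2)%N E.
  by rewrite !divnMDl // !divn_small // !addn0.
have E2 : f2 x y z = f2 x' y' z'.
  have := congr1 (fun k => k %% D2)%N E.
  by rewrite !modnMDl !modn_small.
rewrite PoszM Gauss_dvdz; first by rewrite p1 // p2.
by rewrite /coprimez; exact: cD.
Qed.

Lemma residue_map_local F n : (0 < n)%N ->
  (forall l, prime l -> (l %| n)%N -> residue_map F (l ^ logn l n)) ->
  residue_map F n.
Proof.
elim/ltn_ind: n => n IH n0 h; have [n1|n1] := leqP n 1.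
  have -> : n = 1%N by move: n0 n1; clear; lia.
  exists (fun _ _ _ => 0%N); split=> // *; exact: dvd1z.
have [pr E rn m0 mn] := part_split n1.
rewrite E; apply: residue_mapM.
- by rewrite coprimeXl // prime_coprime.
- by apply: h => //; apply: pdiv_dvd.
apply: IH => // l pl ln.
have ll : logn l n = logn l n`_(pdiv n)^'.
  rewrite {1}E lognM ?expn_gt0 ?pdiv_gt0 // lognX (logn_prime l pr).
  by case: eqP => [lE|_]; [move: ln rn; rewrite -lE => -> | rewrite muln0].
by rewrite -ll; apply: h => //; apply: dvdn_trans ln (dvdn_part _ _).
Qed.

Definition pair_zero (N : nat) (l : nat) (a b : int) :=
  exists x y : int, [/\ ~~ (l %| x)%Z, ~~ (l %| y)%Z & (N %| a * x ^+ 2 + b * y ^+ 2)%Z].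

(** For squarefree coefficients without a common factor, a bad prime l divides one or two of them.
    In the second case the congruence modulo l^2 amounts to a zero modulo l of the form with
    coefficients a/l and b/l. *)
Definition local_pair (l : nat) (a b c : int) :=
  (~~ (l %| a)%Z -> ~~ (l %| b)%Z -> (l %| c)%Z -> pair_zero l l a b) /\
  ((l %| a)%Z -> (l %| b)%Z -> ~~ (l %| c)%Z -> pair_zero (l ^ 2) l a b).

Definition locally_isotropic (l : nat) (a b c : int) :=
  [/\ local_pair l a b c, local_pair l b c a & local_pair l c a b].

Lemma pair_zeroC N l a b : pair_zero N l a b -> pair_zero N l b a.
Proof. by case=> x [y [hx hy h]]; exists y, x; rewrite addrC. Qed.

Lemma pair_zeroN N l a b : pair_zero N l a b -> pair_zero N l (- a) (- b).
Proof.
by case=> x [y [hx hy h]]; exists x, y; rewrite !mulNr -opprD rpredN.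
Qed.

Lemma local_pairC l a b c : local_pair l a b c -> local_pair l b a c.
Proof. by move=> [h1 h2]; split=> *; apply: pair_zeroC; auto. Qed.

Lemma local_pairN l a b c : local_pair l a b c -> local_pair l (- a) (- b) (- c).
Proof. by move=> [h1 h2]; split; rewrite !rpredN => *; apply: pair_zeroN; auto. Qed.

Lemma coprime_inverse (N : nat) (y : int) : coprime N `|y| ->
  exists u : int, (N %| u * y - 1)%Z.
Proof.
move=> cN; have /coprimezP[[u v] /= uv] : coprimez y N.
  by rewrite coprimez_sym.
by exists u; apply/dvdzP; exists (- v); rewrite -uv; ring.
Qed.

Lemma pair_zero_root (e l : nat) a b : prime l -> pair_zero (l ^ e) l a b ->
  exists s : int, ((l ^ e)%N %| a * s ^+ 2 + b)%Z.
Proof.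
move=> pl [x [y [_ ly h]]].
have [|u uy] := @coprime_inverse (l ^ e) y.
  by rewrite coprimeXl // prime_coprime.
exists (x * u).
have -> : a * (x * u) ^+ 2 + b = (a * x ^+ 2 + b * y ^+ 2) * u ^+ 2 -
   b * (u * y + 1) * (u * y - 1) by ring.
by apply: rpredB; [apply: dvdz_mulr | apply: dvdz_mull].
Qed.

Definition tform (a b c x y z : int) := a * x ^+ 2 + b * y ^+ 2 + c * z ^+ 2.

(** The form is divisible by l on the lattice x = s y modulo l, of index l. *)
Lemma residue_map_prime1 l a b c : prime l ->
  (l %| c)%Z -> (exists s : int, (l %| a * s ^+ 2 + b)%Z) ->
  residue_map (tform a b c) l.
Proof.
move=> pl lc [s ls]; have l0 : l%:Z != 0 by rewrite eqz_nat -lt0n prime_gt0.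
exists (fun x y z => `|((x - s * y)%R %% l)%Z|%N); split=> [x y z|x y z x' y' z' E].
  by rewrite -ltz_nat gez0_abs ?modz_ge0 // ltz_pmod // ltz_nat prime_gt0.
have : (l %| (x - s * y) - (x' - s * y'))%Z.
  rewrite -eqz_mod_dvd; apply/eqP.
  by rewrite -[LHS]gez0_abs ?modz_ge0 // E gez0_abs ?modz_ge0.
case/dvdzP=> k Ek; rewrite /tform.
have -> : x - x' = s * (y - y') + k * l by rewrite -Ek; ring.
have -> : a * (s * (y - y') + k * l) ^+ 2 + b * (y - y') ^+ 2 + c * (z - z') ^+ 2 =
  (a * s ^+ 2 + b) * (y - y') ^+ 2 + a * (2 * s * (y - y') * k + k ^+ 2 * l) * l +
   c * (z - z') ^+ 2 by ring.
by apply: rpredD; [apply: rpredD; [exact: dvdz_mulr|exact: dvdz_mull]|exact: dvdz_mulr].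
Qed.

(** The lattice is x = s y, z = 0 modulo l, of index l^2. Although x = s y holds only modulo l, the
    cross term gains its second factor l from a. *)
Lemma residue_map_prime2 l a b c : prime l -> (l %| a)%Z ->
  (exists s : int, ((l ^ 2)%N %| a * s ^+ 2 + b)%Z) ->
  residue_map (tform a b c) (l ^ 2).
Proof.
move=> pl /dvdzP[a' Da] [s ls].
have l0 : l%:Z != 0 by rewrite eqz_nat -lt0n prime_gt0.
have lp : (0 < l)%N by apply: prime_gt0.
exists (fun x y z => `|((x - s * y)%R %% l)%Z| * l + `|(z %% l)%Z|)%N.
have lt x : (`|(x %% l)%Z| < l)%N.
  by rewrite -ltz_nat gez0_abs ?modz_ge0 // ltz_pmod.
split=> [x y z|x y z x' y' z' E].
  by rewrite expnS expn1; move: (lt (x - s * y)) (lt z); clear; nia.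
have E1 := congr1 (fun k => k %/ l)%N E; have E2 := congr1 (fun k => k %% l)%N E.
rewrite !divnMDl // !divn_small // !addn0 in E1.
rewrite !modnMDl !modn_small // in E2.
have : (l %| (x - s * y) - (x' - s * y'))%Z.
  rewrite -eqz_mod_dvd; apply/eqP.
  by rewrite -[LHS]gez0_abs ?modz_ge0 // E1 gez0_abs ?modz_ge0.
have : (l %| z - z')%Z.
  rewrite -eqz_mod_dvd; apply/eqP.
  by rewrite -[LHS]gez0_abs ?modz_ge0 // E2 gez0_abs ?modz_ge0.
case/dvdzP=> m ->; case/dvdzP=> k Ek; rewrite /tform.
have -> : x - x' = s * (y - y') + k * l by rewrite -Ek; ring.
have -> : a * (s * (y - y') + k * l) ^+ 2 + b * (y - y') ^+ 2 + c * (m * l) ^+ 2 =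
  (a * s ^+ 2 + b) * (y - y') ^+ 2 +
  (a' * (2 * s * (y - y') * k + k ^+ 2 * l) + c * m ^+ 2) * l%:Z ^+ 2.
  by rewrite Da; ring.
have l2E : l%:Z ^+ 2 = (l ^ 2)%N by rewrite expnS expn1 PoszM.
by rewrite l2E; apply: rpredD; [exact: dvdz_mulr|exact: dvdz_mull].
Qed.

Lemma int_divisible_range (N v : int) : 0 < N -> (N %| v)%Z ->
  - N < v -> v < 2 * N -> v = 0 \/ v = N.
Proof.
move=> N0 /dvdzP[k ->] h1 h2.
have : k = 0 \/ k = 1 by nia.
by case=> ->; rewrite ?mul0r ?mul1r; [left | right].
Qed.

Lemma ceil_sqrt n : (0 < n)%N -> exists X, [/\ (0 < X)%N, (n <= X ^ 2)%N &
  forall x, (x < X)%N -> (x ^ 2 < n)%N].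
Proof.
move=> n0; have ex : exists X, (n <= X ^ 2)%N.
  by exists n; rewrite expnS expn1 leq_pmulr.
exists (ex_minn ex); case: ex_minnP => X nX Xmin; split=> //.
  by case: X nX Xmin => //; rewrite exp0n // leqNgt n0.
by move=> x xX; rewrite ltnNge; apply/negP => /Xmin; rewrite leqNgt xX.
Qed.

(* If the form takes the value [A * B * C], the identity                      *)
(* [A (xz + By)^2 + B (yz - Ax)^2 = (z^2 + AB) (A x^2 + B y^2)] gives a zero. *)
Lemma ternary_of_residue_map (A B C : nat) : (0 < A)%N -> (0 < B)%N -> (0 < C)%N ->
  residue_map (tform A B (- C%:Z)) (A * B * C) ->
  (forall X Y Z, X ^ 2 = B * C -> Y ^ 2 = A * C -> Z ^ 2 = A * B ->
     [/\ A = 1, B = 1 & C = 1])%N ->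
  exists x y z : int, ~~ [&& x == 0, y == 0 & z == 0] /\
    A%:Z * x ^+ 2 + B%:Z * y ^+ 2 = C%:Z * z ^+ 2.
Proof.
move=> A0 B0 C0 [f [fD fP]] sq.
(* With the sides sqrt(BC), sqrt(AC), sqrt(AB) rounded up, each term of the form at a difference of
   two points stays below ABC in size, so its value lies strictly between -ABC and 2ABC. The box has
   more than ABC points unless all three products are squares. *)
have [X [X0 X2 Xlt]] := @ceil_sqrt (B * C) ltac:(by rewrite muln_gt0 B0).
have [Y [Y0 Y2 Ylt]] := @ceil_sqrt (A * C) ltac:(by rewrite muln_gt0 A0).
have [Z [Z0 Z2 Zlt]] := @ceil_sqrt (A * B) ltac:(by rewrite muln_gt0 A0).
have [/and3P[/eqP EX /eqP EY /eqP EZ]|ne] :=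
    boolP [&& X ^ 2 == B * C, Y ^ 2 == A * C & Z ^ 2 == A * B]%N.
  have [-> -> ->] := sq X Y Z EX EY EZ; by exists 1, 0, 1.
have XYZ : (A * B * C < X * Y * Z)%N.
  rewrite -ltn_sqr; have -> : ((A * B * C) ^ 2 = (B * C) * (A * C) * (A * B))%N by ring.
  have -> : ((X * Y * Z) ^ 2 = X ^ 2 * Y ^ 2 * Z ^ 2)%N by rewrite !expnMn.
  have p1 : (0 < B * C)%N by rewrite muln_gt0 B0.
  have p2 : (0 < A * C)%N by rewrite muln_gt0 A0.
  have p3 : (0 < A * B)%N by rewrite muln_gt0 A0.
  move: ne X2 Y2 Z2 p1 p2 p3; move: (X ^ 2)%N (Y ^ 2)%N (Z ^ 2)%N (B * C)%N (A * C)%N (A * B)%N.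
  clear=> x y z u v w ne ux vy wz u0 v0 w0.
  have le1 : (u * v * w <= x * y * z)%N by rewrite !leq_mul.
  rewrite ltn_neqAle le1 andbT; apply: contra ne => /eqP E.
  have xu : x = u by have := leq_mul vy wz; nia.
  have yv : y = v by have := leq_mul ux wz; nia.
  have zw : z = w by have := leq_mul ux vy; nia.
  by rewrite xu yv zw !eqxx.
pose F (p : 'I_X * 'I_Y * 'I_Z) : 'I_(A * B * C) :=
  Ordinal (fD (p.1.1 : nat)%:Z (p.1.2 : nat)%:Z (p.2 : nat)%:Z).
have : ~~ injectiveb F.
  apply/negP => /injectiveP /leq_card; rewrite !card_prod !card_ord.
  by rewrite leqNgt XYZ.
case/injectivePn=> -[[i j] k] [[[i' j'] k']] /= ne' /(congr1 val) /= /fP dv.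
set x := (i : nat)%:Z - (i' : nat)%:Z in dv.
set y := (j : nat)%:Z - (j' : nat)%:Z in dv.
set z := (k : nat)%:Z - (k' : nat)%:Z in dv.
have sqlt n (u v : 'I_n) m : (forall x, (x < n)%N -> (x ^ 2 < m)%N) ->
    ((u : nat)%:Z - (v : nat)%:Z) ^+ 2 < m%:Z.
  move=> h; have := h `|(u : nat)%:Z - (v : nat)%:Z|%N.
  have -> : (`|(u : nat)%:Z - (v : nat)%:Z| < n)%N.
    by move: (ltn_ord u) (ltn_ord v); clear; lia.
  move=> /(_ isT); rewrite -ltz_nat => /(le_lt_trans _); apply.
  by rewrite -abszX lez_abs.
have x2 : x ^+ 2 < (B * C)%:Z by apply: sqlt Xlt.
have y2 : y ^+ 2 < (A * C)%:Z by apply: sqlt Ylt.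
have z2 : z ^+ 2 < (A * B)%:Z by apply: sqlt Zlt.
have nz : ~~ [&& x == 0, y == 0 & z == 0].
  apply: contra ne'; rewrite !subr_eq0 !eqz_nat => /and3P[e1 e2 e3].
  by rewrite -!pair_eqE /= -!pair_eqE /= -!val_eqE /= e1 e2 e3.
have [] : tform A B (- C%:Z) x y z = 0 \/ tform A B (- C%:Z) x y z = (A * B * C)%:Z.
  have x0 := sqr_ge0 x; have y0 := sqr_ge0 y; have z0 := sqr_ge0 z.
  apply: int_divisible_range dv _ _.
  - by rewrite ltz_nat !muln_gt0 A0 B0.
  - rewrite /tform; move: A0 B0 C0 x0 y0 z0 z2; rewrite -!ltz_nat !PoszM.
    by move: (x ^+ 2) (y ^+ 2) (z ^+ 2) A%:Z B%:Z C%:Z; clear; nia.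
  - rewrite /tform; move: A0 B0 C0 x0 y0 z0 x2 y2; rewrite -!ltz_nat !PoszM.
    by move: (x ^+ 2) (y ^+ 2) (z ^+ 2) A%:Z B%:Z C%:Z; clear; nia.
- rewrite /tform mulNr => /eqP; rewrite subr_eq0 => /eqP E.
  by exists x, y, z.
rewrite /tform !PoszM => E.
exists (x * z + B%:Z * y), (y * z - A%:Z * x), (z ^+ 2 + A%:Z * B%:Z); split.
  have : 0 < z ^+ 2 + A%:Z * B%:Z.
    by rewrite ltr_wpDl ?sqr_ge0 // mulr_gt0 // ltz_nat.
  by move=> h; rewrite !negb_and (gt_eqF h) !orbT.
have -> : A%:Z * (x * z + B%:Z * y) ^+ 2 + B%:Z * (y * z - A%:Z * x) ^+ 2 =
  (z ^+ 2 + A%:Z * B%:Z) * (A%:Z * x ^+ 2 + B%:Z * y ^+ 2) by ring.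
have -> : A%:Z * x ^+ 2 + B%:Z * y ^+ 2 = C%:Z * (z ^+ 2 + A%:Z * B%:Z).
  by move: E; rewrite mulNr => /eqP; rewrite subr_eq => /eqP ->; ring.
ring.
Qed.

Lemma residue_map_rot a b c D :
  residue_map (tform b c a) D -> residue_map (tform a b c) D.
Proof.
move=> [f [fD fP]]; exists (fun x y z => f y z x); split=> // x y z x' y' z' /fP.
by rewrite /tform [X in (D %| X)%Z](_ : _ = a * (x - x') ^+ 2 + b * (y - y') ^+ 2 +
  c * (z - z') ^+ 2) //; ring.
Qed.

Lemma residue_map_pair l a b c : prime l -> local_pair l a b c ->
  (~~ (l %| a)%Z -> ~~ (l %| b)%Z -> (l %| c)%Z -> residue_map (tform a b c) l) /\
  ((l %| a)%Z -> (l %| b)%Z -> ~~ (l %| c)%Z -> residue_map (tform a b c) (l ^ 2)).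
Proof.
move=> pl [h1 h2]; split=> ha hb hc.
  apply: residue_map_prime1 => //; have := @pair_zero_root 1 l a b pl.
  by rewrite expn1; apply; apply: h1.
by apply: residue_map_prime2 => //; apply: (pair_zero_root pl); apply: h2.
Qed.

(** At 2 the point (1, 1) always works: two odd numbers have an even sum, and two numbers equal to 2
    modulo 4 have a sum divisible by 4. *)
Lemma local_pair2 (a b c : int) : ~~ (4 %| a)%Z -> ~~ (4 %| b)%Z -> local_pair 2 a b c.
Proof.
by move=> ha hb; split=> h1 h2 _; exists 1, 1; split=> //; rewrite !mulr1; lia.
Qed.

Lemma squarefree_logn n l : (0 < n)%N -> prime l -> squarefree n ->
  logn l n = (l %| n)%N.
Proof.
move=> n0 pl sf; have := sf l pl; have := logn_gt0 l n.
rewrite mem_primes pl n0 /= => <-.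
by case: (logn l n) => [|[|]].
Qed.

Lemma squarefree_ndvd n l : (0 < n)%N -> prime l -> squarefree n -> ~~ (l ^ 2 %| n)%N.
Proof.
by move=> n0 pl sf; apply/negP; rewrite pfactor_dvdn // leqNgt ltnS sf.
Qed.

Lemma legendre_coprime (A B C : nat) : (0 < A)%N -> (0 < B)%N -> (0 < C)%N ->
  squarefree A -> squarefree B -> squarefree C ->
  (forall l, prime l -> ~~ [&& l %| A, l %| B & l %| C]%N) ->
  (forall l, prime l -> (2 < l)%N -> locally_isotropic l A B (- C%:Z)) ->
  exists x y z : int, ~~ [&& x == 0, y == 0 & z == 0] /\
    A%:Z * x ^+ 2 + B%:Z * y ^+ 2 = C%:Z * z ^+ 2.
Proof.
move=> A0 B0 C0 sA sB sC gcd1 loc; apply: ternary_of_residue_map => //; last first.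
  (* A prime dividing U misses V or W, so it has exponent 1 in U V or in U W, which is then not a
     square. *)
  have aux (U V W X Y : nat) : (0 < U)%N -> (0 < V)%N -> (0 < W)%N ->
      squarefree U -> squarefree V -> squarefree W ->
      (forall l, prime l -> ~~ [&& l %| U, l %| V & l %| W]%N) ->
      (X ^ 2 = U * V)%N -> (Y ^ 2 = U * W)%N -> U = 1%N.
    move=> U0 V0 W0 sU sV sW g1 EX EY; apply/eqP; rewrite eqn_leq U0 andbT.
    rewrite leqNgt; apply/negP => U1; have pl := pdiv_prime U1.
    have lU := pdiv_dvd U; have := g1 _ pl; rewrite lU /= negb_and.
    have l1 : logn (pdiv U) U = 1%N by rewrite squarefree_logn // lU.
    case/orP=> h.
      have := congr1 (logn (pdiv U)) EX.
      rewrite lognX lognM // l1 (squarefree_logn V0 pl sV) (negbTE h).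
      by move: (logn _ X); clear; lia.
    have := congr1 (logn (pdiv U)) EY.
    rewrite lognX lognM // l1 (squarefree_logn W0 pl sW) (negbTE h).
    by move: (logn _ Y); clear; lia.
  move=> X Y Z EX EY EZ; split.
  - by apply: (aux A B C Z Y).
  - apply: (aux B A C Z X) => //; first by move=> l pl; rewrite andbCA; apply: gcd1.
    by rewrite mulnC.
  - apply: (aux C A B Y X) => //; try by rewrite mulnC.
    by move=> l pl; rewrite andbC -andbA; apply: gcd1.
have ABC0 : (0 < A * B * C)%N by rewrite !muln_gt0 A0 B0.
apply: residue_map_local => // l pl lABC.
have {}loc : locally_isotropic l A B (- C%:Z).
  have [l2|l2] := ltnP 2 l; first exact: loc.
  have -> : l = 2%N by have := prime_gt1 pl; move: l2; clear; lia.
  have h4 n : (0 < n)%N -> squarefree n -> ~~ (4 %| n%:Z)%Z.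
    by move=> n0 sn; apply: (@squarefree_ndvd n 2).
  by split; apply: local_pair2; rewrite ?rpredN h4.
have [l1 l2 l3] := loc.
have [r1 r1'] := residue_map_pair pl l1.
have [r2 r2'] := residue_map_pair pl l2.
have [r3 r3'] := residue_map_pair pl l3.
rewrite !lognM ?muln_gt0 ?A0 ?B0 // !squarefree_logn //.
have := gcd1 l pl; move: lABC; rewrite !Euclid_dvdM //.
move: r1 r1' r2 r2' r3 r3'.
rewrite ?rpredN !(dvdzE _ (Posz _)) /=.
move=> r1 r1' r2 r2' r3 r3'.
move: r1 r1' r2 r2' r3 r3'.
case: (l %| A)%N; case: (l %| B)%N; case: (l %| C)%N => //= r1 r1' r2 r2' r3 r3' _ _.
- by apply: r1'.
- by do 2!apply: residue_map_rot; apply: r3'.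
- by rewrite expn1; apply: residue_map_rot; apply: r2.
- by apply: residue_map_rot; apply: r2'.
- by rewrite expn1; do 2!apply: residue_map_rot; apply: r3.
- by rewrite expn1; apply: r1.
Qed.

Lemma local_pair_scale l (g a b c : int) : prime l -> ~~ (l %| g)%Z ->
  local_pair l (g * a) (g * b) (g * c) -> local_pair l a b c.
Proof.
move=> pl lg; have Eu x : (l %| g * x)%Z = (l %| x)%Z.
  by rewrite Gauss_dvdzr //; rewrite -[coprimez _ _]/(coprime l `|g|) prime_coprime.
have pz e : pair_zero (l ^ e) l (g * a) (g * b) -> pair_zero (l ^ e) l a b.
  move=> [x [y [hx hy h]]]; exists x, y; split=> //.
  move: h; rewrite -!mulrA -mulrDr Gauss_dvdzr //.
  by rewrite -[coprimez _ _]/(coprime (l ^ e) `|g|) coprimeXl // prime_coprime.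
move=> [h1 h2]; split=> ha hb hc.
  by have := pz 1%N; rewrite expn1; apply; apply: h1; rewrite Eu.
by apply: pz; apply: h2; rewrite Eu.
Qed.

(** The common factor g is divided out. At a prime of g the quotients are units by squarefreeness
    and the local conditions become void; at the others g is a unit. *)
Theorem legendre_ternary (A B C : nat) : (0 < A)%N -> (0 < B)%N -> (0 < C)%N ->
  squarefree A -> squarefree B -> squarefree C ->
  (forall l, prime l -> (2 < l)%N -> locally_isotropic l A B (- C%:Z)) ->
  exists x y z : int, ~~ [&& x == 0, y == 0 & z == 0] /\
    A%:Z * x ^+ 2 + B%:Z * y ^+ 2 = C%:Z * z ^+ 2.
Proof.
move=> A0 B0 C0 sA sB sC loc.
pose g := gcdn (gcdn A B) C.
have g0 : (0 < g)%N by rewrite !gcdn_gt0 A0.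
have [a Da] : exists a, A = (g * a)%N.
  have /dvdnP[a ->] : (g %| A)%N by rewrite (dvdn_trans (dvdn_gcdl _ _)) ?dvdn_gcdl.
  by exists a; rewrite mulnC.
have [b Db] : exists b, B = (g * b)%N.
  have /dvdnP[b ->] : (g %| B)%N by rewrite (dvdn_trans (dvdn_gcdl _ _)) ?dvdn_gcdr.
  by exists b; rewrite mulnC.
have [c Dc] : exists c, C = (g * c)%N.
  have /dvdnP[c ->] : (g %| C)%N by rewrite dvdn_gcdr.
  by exists c; rewrite mulnC.
have sfr n m : (0 < n)%N -> n = (g * m)%N -> squarefree n ->
    [/\ (0 < m)%N, squarefree m & forall l, prime l -> (l %| g)%N -> ~~ (l %| m)%N].
  move=> n0 E sn; have m0 : (0 < m)%N by move: n0; rewrite E muln_gt0 => /andP[].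
  have le l : prime l -> (logn l g + logn l m <= 1)%N.
    by move=> pl; rewrite -lognM // -E; apply: sn.
  split=> // l pl; first exact: leq_trans (leq_addl _ _) (le l pl).
  move=> lg; apply/negP => lm; have := le l pl.
  have : (0 < logn l g)%N by rewrite logn_gt0 mem_primes pl g0.
  have : (0 < logn l m)%N by rewrite logn_gt0 mem_primes pl m0.
  by clear; lia.
have [a0 sa ga] := sfr A a A0 Da sA.
have [b0 sb gb] := sfr B b B0 Db sB.
have [c0 sc gc] := sfr C c C0 Dc sC.
have [||x [y [z [nz E]]]] := @legendre_coprime a b c a0 b0 c0 sa sb sc.
- move=> l pl; apply/negP => /and3P[la lb lc].
  have : (g * l %| g)%N by rewrite {2}/g !dvdn_gcd Da Db Dc !dvdn_pmul2l // la lb.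
  by rewrite -{2}[g]muln1 dvdn_pmul2l // dvdn1 => /eqP l1; rewrite l1 in pl.
- move=> l pl l2; have [lg|lg] := boolP (l %| g)%N.
    have na := ga l pl lg; have nb := gb l pl lg; have nc := gc l pl lg.
    by split; split; rewrite ?rpredN !dvdzE /= ?(negbTE na) ?(negbTE nb) ?(negbTE nc).
  have [h1 h2 h3] := loc l pl l2.
  by split; apply: (@local_pair_scale _ g) => //; rewrite ?mulrN -!PoszM -?Da -?Db -?Dc.
exists x, y, z; split=> //.
by rewrite Da Db Dc !PoszM -!mulrA -mulrDr E.
Qed.

(** One argument serves all cases: if l divided one coordinate of the required pair, then, k being
    prime to l, some coefficient would be divisible by l or l^2 against the hypotheses. *)
Lemma locally_isotropic_sol (l : nat) (a b c X Y k : int) : prime l ->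
  ~~ ((l ^ 2)%N %| a)%Z -> ~~ ((l ^ 2)%N %| b)%Z -> ~~ ((l ^ 2)%N %| c)%Z ->
  ~~ (l %| k)%Z -> (l %| a * X ^+ 2 + b * Y ^+ 2 + c * k ^+ 2)%Z ->
  ((l %| c)%Z -> ((l ^ 2)%N %| a * X ^+ 2 + b * Y ^+ 2 + c * k ^+ 2)%Z) ->
  locally_isotropic l a b c.
Proof.
move=> pl a2 b2 c2 lk S1 S2.
have l2E : (l ^ 2)%N%:Z = l%:Z * l%:Z by rewrite expnS expn1 PoszM.
have EM x y : (l %| x * y)%Z = (l %| x)%Z || (l %| y)%Z.
  by rewrite !dvdzE abszM Euclid_dvdM.
have sq x : (l %| x ^+ 2)%Z = (l %| x)%Z by rewrite expr2 EM orbb.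
have sq2 x : (l %| x)%Z -> ((l ^ 2)%N %| x ^+ 2)%Z.
  by move=> lx; rewrite l2E expr2 dvdz_mul.
have U2 x y : ~~ (l %| y)%Z -> ((l ^ 2)%N %| x * y ^+ 2)%Z -> ((l ^ 2)%N %| x)%Z.
  move=> ly; rewrite Gauss_dvdzl // -[coprimez _ _]/(coprime (l ^ 2) `|y ^+ 2|).
  by rewrite abszX coprimeXl // coprimeXr // prime_coprime.
split; split=> h1 h2 h3.
- have lXY : (l %| a * X ^+ 2 + b * Y ^+ 2)%Z.
    by rewrite -[_ + _](addrK (c * k ^+ 2)) rpredB // dvdz_mulr.
  have nX : ~~ (l %| X)%Z.
    apply/negP => lX; have lY : (l %| Y)%Z.
      have : (l %| b * Y ^+ 2)%Z.
        by rewrite -[b * _](addKr (a * X ^+ 2)) rpredD // rpredN dvdz_mull // sq.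
      by rewrite EM sq (negbTE h2).
    case/negP: c2; apply: (U2 _ k) => //.
    rewrite -[c * _](addKr (a * X ^+ 2 + b * Y ^+ 2)) rpredD ?S2 //.
    by rewrite rpredN rpredD // dvdz_mull // sq2.
  exists X, Y; split=> //; apply/negP => lY; case/negP: nX.
  have : (l %| a * X ^+ 2)%Z.
    by rewrite -[a * _](addrK (b * Y ^+ 2)) rpredB // dvdz_mull // sq.
  by rewrite EM sq (negbTE h1).
- case/negP: h3; have : (l %| c * k ^+ 2)%Z.
    rewrite -[c * _](addKr (a * X ^+ 2 + b * Y ^+ 2)) rpredD // rpredN.
    by rewrite rpredD // dvdz_mulr.
  by rewrite EM sq (negbTE lk) orbF.
- have lYk : (l %| b * Y ^+ 2 + c * k ^+ 2)%Z.
    have -> : b * Y ^+ 2 + c * k ^+ 2 =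
      a * X ^+ 2 + b * Y ^+ 2 + c * k ^+ 2 - a * X ^+ 2 by ring.
    by rewrite rpredB // dvdz_mulr.
  exists Y, k; split=> //; apply/negP => lY.
  have : (l %| c * k ^+ 2)%Z.
    by rewrite -[c * _](addKr (b * Y ^+ 2)) rpredD // rpredN dvdz_mull // sq.
  by rewrite EM sq (negbTE lk) (negbTE h2).
- have lX : (l %| X)%Z.
    have : (l %| a * X ^+ 2)%Z.
      have -> : a * X ^+ 2 =
        a * X ^+ 2 + b * Y ^+ 2 + c * k ^+ 2 - b * Y ^+ 2 - c * k ^+ 2 by ring.
      by rewrite !rpredB // dvdz_mulr.
    by rewrite EM sq (negbTE h3).
  have lYk : ((l ^ 2)%N %| b * Y ^+ 2 + c * k ^+ 2)%Z.
    have -> : b * Y ^+ 2 + c * k ^+ 2 =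
      a * X ^+ 2 + b * Y ^+ 2 + c * k ^+ 2 - a * X ^+ 2 by ring.
    by rewrite rpredB ?S2 // dvdz_mull // sq2.
  exists Y, k; split=> //; apply/negP => lY; case/negP: c2; apply: (U2 _ k) => //.
  by rewrite -[c * _](addKr (b * Y ^+ 2)) rpredD // rpredN dvdz_mull // sq2.
- have lXk : (l %| c * k ^+ 2 + a * X ^+ 2)%Z.
    rewrite [X in (l %| X)%Z](_ : _ = a * X ^+ 2 + b * Y ^+ 2 + c * k ^+ 2 - b * Y ^+ 2).
      by rewrite rpredB // dvdz_mulr.
    by ring.
  exists k, X; split=> //; apply/negP => lX.
  have : (l %| c * k ^+ 2)%Z.
    by rewrite -[c * _](addrK (a * X ^+ 2)) rpredB // dvdz_mull // sq.
  by rewrite EM sq (negbTE lk) (negbTE h1).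
- have lY : (l %| Y)%Z.
    have : (l %| b * Y ^+ 2)%Z.
      rewrite [X in (l %| X)%Z](_ : _ = a * X ^+ 2 + b * Y ^+ 2 + c * k ^+ 2 -
        a * X ^+ 2 - c * k ^+ 2); last by ring.
      by rewrite !rpredB // dvdz_mulr.
    by rewrite EM sq (negbTE h3).
  have lXk : ((l ^ 2)%N %| c * k ^+ 2 + a * X ^+ 2)%Z.
    rewrite [X in (_ %| X)%Z](_ : _ = a * X ^+ 2 + b * Y ^+ 2 + c * k ^+ 2 - b * Y ^+ 2).
      by rewrite rpredB ?S2 // dvdz_mull // sq2.
    by ring.
  exists k, X; split=> //; apply/negP => lX; case/negP: c2; apply: (U2 _ k) => //.
  by rewrite -[c * _](addrK (a * X ^+ 2)) rpredB // dvdz_mull // sq2.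
Qed.

(** * Local and global points *)

(** Pigeonhole: a x^2 and c - b y^2 take (l + 1)/2 values each, so they meet in the field with l
    elements. *)
Lemma conic_universal (l : nat) (a b c : int) : prime l -> (2 < l)%N ->
  ~~ (l %| a)%Z -> ~~ (l %| b)%Z ->
  exists x y : int, (l %| a * x ^+ 2 + b * y ^+ 2 - c)%Z.
Proof.
move=> pl l2; have dE := dvdz_pcharf (pchar_Fp pl).
rewrite !dE; set a' : 'F_l := a%:~R; set b' : 'F_l := b%:~R => a0 b0.
pose h := (l./2).+1.
pose f (u : 'I_h + 'I_h) : 'F_l := match u with
  | inl i => a' * i%:R ^+ 2 | inr j => c%:~R - b' * j%:R ^+ 2 end.
have lE : l = (l./2).*2.+1 by rewrite -(odd_prime_half pl l2) card_Fp.
have sqn (i j : nat) : (i < h)%N -> (j < h)%N -> (i%:R : 'F_l) ^+ 2 = j%:R ^+ 2 -> i = j.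
  wlog ij : i j / (i <= j)%N.
    by move=> H hi hj E; case/orP: (leq_total i j) => ?; [|symmetry]; apply: H.
  move=> il jl /eqP; rewrite eq_sym -subr_eq0 subr_sqr mulf_eq0 -natrB // -natrD.
  rewrite -!(dvdn_pcharf (pchar_Fp pl)) => E.
  move: il jl ij E; rewrite /h !ltnS => il jl ij /orP[] lij.
    have [e|e] := posnP (j - i)%N; first by apply/eqP; rewrite eqn_leq ij -subn_eq0 e.
    by have := dvdn_leq e lij; move: lE jl; clear; lia.
  have [e|e] := posnP (j + i)%N; first by move: e; clear; lia.
  by have := dvdn_leq e lij; move: lE jl il; clear; lia.
have sqI (i j : 'I_h) : (i%:R : 'F_l) ^+ 2 = j%:R ^+ 2 -> i = j.
  by move=> E; apply: ord_inj; apply: sqn E.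
have /injectivePn [u [v uv E]] : ~~ injectiveb f.
  apply/negP => /injectiveP /leq_card.
  by rewrite card_sum card_ord card_Fp // /h; move: lE; clear; lia.
have sol (i j : 'I_h) : a' * i%:R ^+ 2 = c%:~R - b' * j%:R ^+ 2 ->
    exists x y : int, (l %| a * x ^+ 2 + b * y ^+ 2 - c)%Z.
  move=> e; exists i%:Z, j%:Z.
  by rewrite dE rmorphB rmorphD !rmorphM /= -!pmulrn -/a' -/b' -!expr2 e subrK subrr.
case: u v uv E => [i|i] [j|j] uv /= E.
- by move/(mulfI a0)/sqI: E uv => ->; rewrite eqxx.
- exact: sol E.
- exact: sol (esym E).
by move/addrI/oppr_inj/(mulfI b0)/sqI: E uv => ->; rewrite eqxx.
Qed.

Lemma PoszX (n k : nat) : (n ^ k)%N%:Z = n%:Z ^+ k.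
Proof. by rewrite -!natz natrX. Qed.

Definition conductor (l : nat) : nat := (if l == 2 then 8 else l)%N.

(* T1 and T2 have the same l-part, 1 or l, and prime-to-l parts congruent modulo
   the conductor of quadratic characters at l. *)
Definition local_match (l : nat) (T1 T2 : int) : bool :=
  if (l %| T1)%Z then ~~ ((l ^ 2)%N %| T1)%Z && ((l * conductor l)%N %| T1 - T2)%Z
  else (conductor l %| T1 - T2)%Z.

Definition locally_solvable (p q d : int) (l : nat) :=
  exists x y z w : int, local_match l (p * x ^+ 2 + q * y ^+ 2) (p * q * z ^+ 2 + d * w ^+ 2).

Lemma conductor_odd l : (2 < l)%N -> conductor l = l.
Proof. by rewrite /conductor; case: eqP => // ->. Qed.

Lemma locally_solvableC p q d l : locally_solvable p q d l -> locally_solvable q p d l.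
Proof.
case=> x [y [z [w h]]]; exists y, x, z, w.
by rewrite [X in local_match _ X]addrC [q * p]mulrC.
Qed.

Lemma locally_solvable_unit (p q d : int) l : prime l -> (2 < l)%N ->
  ~~ (l %| p)%Z -> ~~ (l %| q)%Z -> locally_solvable p q d l.
Proof.
move=> pl l2 lp lq; have [x [y h]] := conic_universal (p * q) pl l2 lp lq.
exists x, y, 1, 0; rewrite /local_match conductor_odd //.
have E : p * x ^+ 2 + q * y ^+ 2 - (p * q * 1 ^+ 2 + d * 0 ^+ 2) =
         p * x ^+ 2 + q * y ^+ 2 - p * q by ring.
rewrite E h ifN //; apply: contra lp => h'; move: h.
rewrite rpredBl //; move: lq; rewrite !dvdzE abszM Euclid_dvdM //= => /negbTE ->.
by rewrite orbF.
Qed.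

(** The common value is p if p divides d, and p q if q is a square modulo p. Otherwise q and d are
    both nonsquares, so q d is a square and the value q d^2 serves. *)
Lemma locally_solvable_ramified (p : nat) (q d : int) : prime p -> (2 < p)%N ->
  ~~ (p %| q)%Z -> ~~ ((p ^ 2)%N %| d)%Z -> leg d p <> 1 -> locally_solvable p q d p.
Proof.
move=> pp p2 pq p2d ld.
have p0 : p%:Z != 0 by move: p2; clear; lia.
have [pd|pd] := boolP (p %| d)%Z.
  have [d' dE] := dvdzP pd.
  have pd' : ~~ (p %| d')%Z.
    by apply: contra p2d; rewrite dE PoszX expr2 => h; rewrite dvdz_mul.
  have [z [w h]] := conic_universal 1 pp p2 pq pd'.
  exists 1, 0, z, w; rewrite /local_match conductor_odd //.
  have -> : p%:Z * 1 ^+ 2 + q * 0 ^+ 2 = p by ring.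
  have -> : ~~ ((p ^ 2)%N %| p%:Z)%Z.
    by rewrite dvdzE gtnNdvd ?ltn_Pmull ?prime_gt1 // prime_gt0.
  rewrite dvdzz !(PoszX, PoszM) ?expr2.
  have -> : p%:Z - (p%:Z * q * z ^+ 2 + d * w ^+ 2) =
     p%:Z * - (q * z ^+ 2 + d' * w ^+ 2 - 1) by rewrite dE; ring.
  by rewrite dvdz_mul2l // rpredN h.
have [lq|lq] := leg_unitE pp pq.
  have /(leg_eq1P _ pp)[_ [s hs]] : leg q p == 1 by rewrite lq.
  exists s, 0, 1, 0; rewrite /local_match conductor_odd //.
  have -> : p%:Z * s ^+ 2 + q * 0 ^+ 2 = p%:Z * s ^+ 2 by ring.
  have -> : p%:Z * s ^+ 2 - (p%:Z * q * 1 ^+ 2 + d * 0 ^+ 2) = p%:Z * (s ^+ 2 - q) by ring.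
  rewrite dvdz_mulr // !(PoszX, PoszM) ?expr2 !dvdz_mul2l // hs andbT.
  apply: contra pq => h; have := rpredB h hs.
  by rewrite (_ : s ^+ 2 - (s ^+ 2 - q) = q) //; ring.
have /(leg_eq1P _ pp)[pqd [s hs]] : leg (q * d) p == 1.
  by rewrite legM // lq; case: (leg_unitE pp pd) => // ->.
exists 0, d, 0, s; rewrite /local_match conductor_odd //.
have -> : p%:Z * 0 ^+ 2 + q * d ^+ 2 = q * d * d by ring.
rewrite ifN.
  have -> : q * d * d - (p%:Z * q * 0 ^+ 2 + d * s ^+ 2) = - (s ^+ 2 - q * d) * d by ring.
  by rewrite dvdz_mulr // rpredN.
by move: pqd pd; rewrite !dvdzE !abszM !Euclid_dvdM //= => /norP[/negbTE -> /negbTE ->].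
Qed.

(* Whether x, y, z, w satisfy [local_match] at 2 depends only on residues mod 16. *)
Definition match2_check (P Q D : nat) :=
  let R := (P * Q %% 16)%N in
  has (fun x => has (fun y =>
    let m := (P * x ^ 2 + Q * y ^ 2)%N in let r := (m %% 16)%N in
    if odd m then has (fun z => has (fun w => r %% 8 == (R * z ^ 2 + D * w ^ 2) %% 8)%N
      (iota 0 4)) (iota 0 4)
    else if (r %% 4 == 2)%N then has (fun z => has (fun w =>
      r == (R * z ^ 2 + D * w ^ 2) %% 16)%N (iota 0 4)) (iota 0 4)
    else false)
    (iota 0 4)) (iota 0 4).

(** The integers 0 to 3 give all squares modulo 16. For D = 1 modulo 8 the prime 2 splits in K and
    the check can fail. *)
Lemma match2_check_all :
  all (fun P => all (fun Q => all (fun D =>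
    ((P == 2) || odd P) ==> odd Q ==> ~~ (4 %| D)%N ==> (D %% 8 != 1)%N ==>
    match2_check P Q D) (iota 0 16)) (iota 0 16)) (iota 0 16).
Proof. by vm_compute. Qed.

Lemma locally_solvable2 (p q : nat) (d : int) : p = 2%N \/ odd p -> odd q ->
  ~~ (4 %| d)%Z -> (d %% 8)%Z != 1 -> locally_solvable p q d 2%N.
Proof.
move=> hp hq h4 h8.
pose D := `|(d %% 16)%Z|%N.
have dE : d = 16 * (d %/ 16)%Z + D%:Z by rewrite /D; lia.
have D16 : (D < 16)%N by rewrite /D; lia.
move: D dE D16 => D dE D16.
have : match2_check (p %% 16) (q %% 16) D.
  move/allP: match2_check_all => /(_ (p %% 16)%N).
  rewrite mem_iota ltn_mod => /(_ isT) /allP /(_ (q %% 16)%N).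
  rewrite mem_iota ltn_mod => /(_ isT) /allP /(_ D).
  rewrite mem_iota D16 => /(_ isT).
  have -> : ((p %% 16)%N == 2) || odd (p %% 16) by case: hp; clear; lia.
  have -> : odd (q %% 16) by move: hq; clear; lia.
  have -> : ~~ (4 %| D)%N by move: h4 dE; move: (d %/ 16)%Z; clear; lia.
  have -> // : (D %% 8 != 1)%N.
  by move: h8 dE; move: (d %/ 16)%Z; clear; lia.
case/hasP=> x _ /hasP[y _]; set m := (_ + _)%N; set R := (_ %% 16)%N.
pose n z w := (R * z ^ 2 + D * w ^ 2)%N.
suff sol z w : (odd m && (m %% 8 == n z w %% 8)%N) ||
    ((m %% 4 == 2)%N && (m %% 16 == n z w %% 16)%N) -> locally_solvable p q d 2%N.
  have m8 : (m %% 16 %% 8 = m %% 8)%N by rewrite modn_dvdm.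
  have m4 : (m %% 16 %% 4 = m %% 4)%N by rewrite modn_dvdm.
  lazy zeta; rewrite m8 m4; case: ifP => [o|_].
    by case/hasP=> z _ /hasP[w _] /eqP e; apply: (sol z w); rewrite o -/(n z w) e eqxx.
  case: ifP => // e4 /hasP[z _ /hasP[w _]] /eqP e.
  by apply: (sol z w); rewrite e4 -/(n z w) e eqxx orbT.
have [k kE] : exists k, k = n z w by exists (n z w).
rewrite -kE => H; exists x%:Z, y%:Z, z%:Z, w%:Z.
set T1 := _ + _; set T2 := _ + _.
have [u E1] : exists u, T1 = 16 * u + m%:Z.
  exists ((p %/ 16)%N%:Z * x%:Z ^+ 2 + (q %/ 16)%N%:Z * y%:Z ^+ 2).
  rewrite /T1 /m !(PoszD, PoszM) {1}(divn_eq p 16) {1}(divn_eq q 16) !PoszD !PoszM.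
  by ring.
have [v E2] : exists v, T2 = 16 * v + k%:Z.
  have RE := divn_eq (p %% 16 * (q %% 16)) 16.
  move: RE; rewrite -/R; move: (_ %/ 16)%N => e RE.
  exists (((p %/ 16)%N%:Z * q%:Z + (p %% 16)%N%:Z * (q %/ 16)%N%:Z + e%:Z) * z%:Z ^+ 2
          + (d %/ 16)%Z * w%:Z ^+ 2).
  rewrite /T2 kE /n !(PoszD, PoszM).
  have -> : R%:Z = (p %% 16)%N%:Z * (q %% 16)%N%:Z - e%:Z * 16.
    by rewrite -PoszM RE PoszD PoszM addrC addKr.
  rewrite {1}dE {1}(divn_eq p 16) {1 2}(divn_eq q 16) !PoszD !PoszM.
  by ring.
rewrite /local_match E1 E2 /conductor /=.
have -> : (2 ^ 2 = 4)%N by [].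
have -> : (2 * 8 = 16)%N by [].
move: H; move: (m) (k); clear => {}m {}k H.
by case: ifP => A; [apply/andP; split|]; lia.
Qed.

Lemma dvd_conductor l : (l %| conductor l)%N.
Proof. by rewrite /conductor; case: eqP => // ->. Qed.

Lemma coprime_conductor l n : prime l -> coprime (conductor l) n = ~~ (l %| n)%N.
Proof.
move=> pl; rewrite /conductor; case: eqP => [->|_]; last exact: prime_coprime.
by rewrite -[8%N]/(2 ^ 3)%N coprime_pexpl // prime_coprime.
Qed.

Lemma local_match_mod l T1 T2 T1' T2' : ((l * conductor l)%N %| T1 - T1')%Z ->
  ((l * conductor l)%N %| T2 - T2')%Z -> local_match l T1 T2 -> local_match l T1' T2'.
Proof.
move=> h1 h2.
have dvd_mod (e : nat) T T' : (e %| l * conductor l)%N ->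
    ((l * conductor l)%N %| T - T')%Z -> (e %| T)%Z = (e %| T')%Z.
  move=> he h; have he' : (e %| T - T')%Z by apply: dvdz_trans h; rewrite dvdzE.
  by rewrite -{1}[T](subrK T') rpredDl.
have h12 : ((l * conductor l)%N %| T1 - T2 - (T1' - T2'))%Z.
  have := rpredB h1 h2; rewrite (_ : T1 - T1' - (T2 - T2') = T1 - T2 - (T1' - T2')) //.
  by ring.
rewrite /local_match (dvd_mod l _ _ _ h1) ?dvdn_mulr //.
have -> : ((l ^ 2)%N %| T1)%Z = ((l ^ 2)%N %| T1')%Z.
  by apply: dvd_mod h1; rewrite expnS expn1 dvdn_mul ?dvd_conductor.
rewrite (dvd_mod _ _ _ (dvdnn _) h12) (dvd_mod (conductor l) _ _ _ h12) //.
exact: dvdn_mull.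
Qed.

Lemma zchinese_dvd (M N : nat) (a b : int) : coprime M N ->
  exists c, (M %| c - a)%Z /\ (N %| c - b)%Z.
Proof.
move=> h; exists (zchinese M N a b).
have h' : coprimez M N by [].
by split; rewrite -eqz_mod_dvd; apply/eqP; rewrite ?(zchinese_modl h') ?(zchinese_modr h').
Qed.

Lemma form_congr (M : int) (a b x y x' y' : int) : (M %| x - x')%Z -> (M %| y - y')%Z ->
  (M %| a * x ^+ 2 + b * y ^+ 2 - (a * x' ^+ 2 + b * y' ^+ 2))%Z.
Proof.
move=> hx hy.
have -> : a * x ^+ 2 + b * y ^+ 2 - (a * x' ^+ 2 + b * y' ^+ 2) =
   a * (x + x') * (x - x') + b * (y + y') * (y - y') by ring.
by rewrite rpredD // dvdz_mull.
Qed.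

Lemma semilocal_solution (p q d : int) (s : seq nat) : uniq s -> all prime s ->
  (forall l, l \in s -> locally_solvable p q d l) ->
  exists x y z w, forall l, l \in s ->
    local_match l (p * x ^+ 2 + q * y ^+ 2) (p * q * z ^+ 2 + d * w ^+ 2).
Proof.
elim: s => [|l s IH] /=; first by move=> *; exists 0, 0, 0, 0.
case/andP=> ls us /andP[pl ps] sol.
have [|x [y [z [w h]]]] := IH us ps.
  by move=> r rs; apply: sol; rewrite inE rs orbT.
have [|x' [y' [z' [w' h']]]] := sol l; first by rewrite inE eqxx.
pose M := (\prod_(r <- s) (r * conductor r))%N; pose N := (l * conductor l)%N.
have cMN : coprime M N.
  rewrite /M big_seq; apply: (big_ind (fun k => coprime k N)) => [|a b|r rs].
  - exact: coprime1n.
  - by rewrite coprimeMl => -> ->.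
  have pr := allP ps _ rs; have rl : r != l by apply: contraNneq ls => <-.
  have c1 a b : prime a -> prime b -> a != b -> coprime a (conductor b).
    move=> pa pb ab; rewrite coprime_sym coprime_conductor //.
    by rewrite dvdn_prime2 // eq_sym.
  rewrite /N coprimeMl !coprimeMr prime_coprime // dvdn_prime2 // rl c1 //=.
  rewrite [coprime _ l]coprime_sym c1 1?eq_sym // coprime_conductor //.
  by rewrite -prime_coprime // c1.
have [X [X1 X2]] := zchinese_dvd x x' cMN; have [Y [Y1 Y2]] := zchinese_dvd y y' cMN.
have [Z [Z1 Z2]] := zchinese_dvd z z' cMN; have [W [W1 W2]] := zchinese_dvd w w' cMN.
have dvd_sym (D a b : int) : (D %| a - b)%Z -> (D %| b - a)%Z by rewrite -rpredN opprB.
exists X, Y, Z, W => r; rewrite inE => /orP[/eqP ->|rs].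
  by apply: local_match_mod h'; apply: form_congr; apply: dvd_sym.
have rM : ((r * conductor r)%N %| M%:Z)%Z.
  by rewrite dvdzE /= /M (big_rem r rs) dvdn_mulr.
by apply: local_match_mod (h r rs); apply: form_congr; apply: dvd_sym;
   apply: dvdz_trans rM _.
Qed.

Lemma semilocal_solution_gt0 (p q d : int) (s : seq nat) : 0 < p -> 0 < q ->
  uniq s -> all prime s -> (forall l, l \in s -> locally_solvable p q d l) ->
  exists x y z w, [/\ 0 < p * x ^+ 2 + q * y ^+ 2, 0 < p * q * z ^+ 2 + d * w ^+ 2 &
    forall l, l \in s ->
      local_match l (p * x ^+ 2 + q * y ^+ 2) (p * q * z ^+ 2 + d * w ^+ 2)].
Proof.
move=> p0 q0 us ps sol; have [x [y [z [w h]]]] := semilocal_solution us ps sol.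
pose M := (\prod_(r <- s) (r * conductor r))%N.
have M0 : 0 < M%:Z.
  rewrite ltz_nat /M big_seq; apply: (big_ind (fun k => 0 < k)%N) => // [a b|r rs].
    by rewrite muln_gt0 => -> ->.
  have pr := prime_gt0 (allP ps _ rs).
  by rewrite muln_gt0 pr /conductor; case: eqP.
(* Shifts by multiples of M preserve the local matches; they make X nonzero and p q Z^2 larger than
   |d| w^2. *)
pose X := x + M%:Z * (`|x| + 1); pose Z := z + M%:Z * (`|z| + `|d| * w ^+ 2 + 1).
have X0 : 0 < X by rewrite /X; move: M0; move: (M%:Z) => K; clear; nia.
have dw : 0 <= `|d| * w ^+ 2 by rewrite mulr_ge0 ?sqr_ge0.
have Z0 : `|d| * w ^+ 2 < Z.
  by rewrite /Z; move: M0 dw; move: (M%:Z) (_ * _) => K; clear; nia.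
exists X, y, Z, w; split.
- apply: ltr_wpDr; first by apply: mulr_ge0; [exact: ltW | exact: sqr_ge0].
  by apply: mulr_gt0 => //; apply: exprn_gt0.
- have : Z <= p * q * Z ^+ 2.
    have : 0 < p * q by rewrite mulr_gt0.
    have : 0 < Z by apply: le_lt_trans Z0.
    by move: (p * q) (Z); clear; nia.
  have : - (`|d| * w ^+ 2) <= d * w ^+ 2.
    by rewrite -mulNr ler_wpM2r ?sqr_ge0 // lerNl ler_normr lexx orbT.
  by move: Z0; move: (_ * _) (_ * _) (_ * _); clear; lia.
move=> l ls; apply: local_match_mod (h l ls); apply: form_congr;
  rewrite ?subrr ?dvdz0 // -opprB rpredN addrAC subrr add0r dvdz_mulr // dvdzE /=.
all: by rewrite /M (big_rem l ls) dvdn_mulr.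
Qed.

Lemma local_match_logn l (t1 t2 : nat) : prime l -> (0 < t1)%N -> (0 < t2)%N ->
  local_match l t1 t2 -> (logn l t1 <= 1)%N /\ logn l t1 = logn l t2.
Proof.
move=> pl t10 t20; rewrite /local_match.
have l1 (t : nat) : (0 < t)%N -> (l %| t%:Z)%Z = (1 <= logn l t)%N.
  by move=> t0; rewrite dvdzE /= -[l in LHS]expn1 pfactor_dvdn.
have l2 (t : nat) : (0 < t)%N -> ((l ^ 2)%N %| t%:Z)%Z = (2 <= logn l t)%N.
  by move=> t0; rewrite dvdzE /= pfactor_dvdn.
have eqd (e D : nat) : (e %| D)%N -> (D %| t1%:Z - t2%:Z)%Z -> (e %| t1%:Z)%Z = (e %| t2%:Z)%Z.
  move=> eD h; have he : (e %| t1%:Z - t2%:Z)%Z by apply: dvdz_trans h; rewrite dvdzE.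
  by rewrite -{1}[t1%:Z](subrK t2%:Z) rpredDl.
case: ifP => [lt /andP[lt2 h]|lt h].
  have := eqd l _ (dvdn_mulr _ (dvdnn l)) h.
  have d2 : (l ^ 2 %| l * conductor l)%N by rewrite expnS expn1 dvdn_mul ?dvd_conductor.
  have := eqd _ _ d2 h.
  by move: lt lt2; rewrite !l1 // !l2 //; clear; lia.
have := eqd l _ (dvd_conductor l) h.
by move: lt; rewrite !l1 //; clear; lia.
Qed.

(** A local match forces equal exponents, at most 1, so t1 and t2 share their S-part t; cancelling t
    leaves S-units congruent modulo each conductor. *)
Lemma common_part (S : seq nat) (t1 t2 : nat) : all prime S -> (0 < t1)%N -> (0 < t2)%N ->
  (forall l, l \in S -> local_match l t1 t2) ->
  exists t m1 m2 : nat, [/\ t1 = (t * m1)%N /\ t2 = (t * m2)%N, squarefree t,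
    forall l, prime l -> l \notin S -> ~~ (l %| t)%N &
    forall l, l \in S -> [/\ ~~ (l %| m1)%N, ~~ (l %| m2)%N & (conductor l %| m1%:Z - m2%:Z)%Z]].
Proof.
move=> pS t10 t20 h; pose pi : nat_pred := [pred l | l \in S].
have hl l (lS : l \in S) := local_match_logn (allP pS l lS) t10 t20 (h l lS).
have partE : (t1`_pi)%N = (t2`_pi)%N.
  by apply: eq_partn_from_log => // l lS; case: (hl l lS).
exists (t1`_pi)%N, (t1`_pi^')%N, (t2`_pi^')%N.
have ndvd (t : nat) l : l \in S -> ~~ (l %| (t`_pi^')%N)%N.
  move=> lS; apply/negP=> ld; have := pnatP _ (part_gt0 pi^' t).
  by move/(_ pi^') => /elimT /(_ (part_pnat _ _) l (allP pS l lS) ld) /negP; apply.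
have ndvd' l : prime l -> l \notin S -> ~~ (l %| (t1`_pi)%N)%N.
  move=> pl lS; apply: contra lS => ld; have := pnatP _ (part_gt0 pi t1).
  by move/(_ pi) => /elimT /(_ (part_pnat _ _) l pl ld).
have logt l : l \in S -> logn l (t1`_pi)%N = logn l t1.
  move=> lS; rewrite -[in RHS](partnC pi t10) lognM ?part_gt0 //.
  by rewrite (lognE l (_`_pi^')%N) (negbTE (ndvd t1 l lS)) !andbF addn0.
have E1 := partnC pi t10; have E2 := partnC pi t20.
split=> //; first by rewrite E1 partE E2.
- move=> l pl; have [lS|lS] := boolP (l \in S); first by rewrite logt //; case: (hl l lS).
  by rewrite lognE (negbTE (ndvd' l pl lS)) !andbF.
move=> l lS; split; try exact: ndvd.
have pl := allP pS l lS.
have : local_match l ((t1`_pi)%N * (t1`_pi^')%N)%N ((t1`_pi)%N * (t2`_pi^')%N)%N.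
  by rewrite E1 partE E2; apply: h.
rewrite /local_match; move: (ndvd t1 l lS).
have : ~~ (l ^ 2 %| (t1`_pi)%N)%N.
  by rewrite pfactor_dvdn ?part_gt0 // logt // -ltnNge ltnS; case: (hl l lS).
move: (part_gt0 pi t1); move: ((t1`_pi)%N) ((t1`_pi^')%N) ((t2`_pi^')%N) => t m1 m2 t0 lt lm1.
rewrite !PoszM -mulrBr; case: ifP => [ld /andP[_]|/negbT ld].
  have lt1 : (l %| t)%N by move: ld; rewrite dvdzE /= Euclid_dvdM // (negbTE lm1) orbF.
  have [u uE] := dvdnP lt1.
  have -> : t%:Z * (m1%:Z - m2%:Z) = l%:Z * (u%:Z * (m1%:Z - m2%:Z)).
    by rewrite uE PoszM; ring.
  rewrite dvdz_mul2l; last by have := prime_gt0 pl; clear; lia.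
  rewrite Gauss_dvdzr //; suff: coprime (conductor l) u by [].
  rewrite coprime_conductor //.
  by apply: contra lt => lu; rewrite uE expnS expn1 dvdn_mul.
rewrite Gauss_dvdzr //; suff: coprime (conductor l) t by [].
rewrite coprime_conductor //.
by apply: contra ld => lt'; rewrite dvdzE /= dvdn_mulr.
Qed.

Lemma locally_isotropic_unit (l : nat) (a b c : int) : ~~ (l %| a)%Z -> ~~ (l %| b)%Z ->
  ((l %| c)%Z -> pair_zero l l a b) -> locally_isotropic l a b c.
Proof.
move=> la lb h; split; split=> h1 h2 h3; try exact: h; exfalso;
  by move: la lb; rewrite ?h1 ?h2 ?h3.
Qed.

Lemma locally_isotropicN_rot l (a b c : int) :
  locally_isotropic l a b (- c) -> locally_isotropic l c (- b) (- a).
Proof.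
case=> /local_pairN h1 /local_pairN h2 /local_pairN h3; rewrite opprK in h1 h2 h3.
by split; apply: local_pairC.
Qed.

Lemma pair_zero_leg (l : nat) (a b : int) : prime l -> ~~ (l %| b)%Z -> leg (- (a * b)) l = 1 ->
  pair_zero l l a b.
Proof.
move=> pl lb /eqP /(leg_eq1P _ pl)[lab [x hx]]; exists x, a; split.
- apply: contra lab => lx; have lx2 : (l %| x ^+ 2)%Z by rewrite expr2 dvdz_mulr.
  by have := rpredB lx2 hx; rewrite opprB addrC subrK.
- by apply: contra lab => la; rewrite rpredN dvdz_mulr.
have -> : a * x ^+ 2 + b * a ^+ 2 = a * (x ^+ 2 - - (a * b)) by ring.
by rewrite dvdz_mull.
Qed.

Lemma nonsquare_mul_sqr (d k : int) : k != 0 -> (forall x : int, x ^+ 2 != d) ->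
  forall x y : int, y != 0 -> (k * x) ^+ 2 != d * y ^+ 2.
Proof.
move=> k0 nd x y y0; apply/eqP => E.
have : (`|y| ^ 2 %| `|(k * x)%R| ^ 2)%N.
  by rewrite -!abszX E abszM dvdn_mull.
rewrite dvdn_pexp2r // -dvdzE => /dvdzP[u uE]; move/eqP: E; rewrite uE exprMn.
by rewrite (inj_eq (mulIf (expf_neq0 2 y0))) (negbTE (nd u)).
Qed.

(** As A and t are positive, the form is indefinite for either sign of d; for d < 0 its term changes
    sides before Legendre's theorem is applied. *)
Lemma represent_ternary (A t : nat) (d : int) : (0 < A)%N -> d != 0 -> (0 < t)%N ->
  squarefree A -> squarefree `|d| -> squarefree t ->
  (forall l, prime l -> (2 < l)%N -> locally_isotropic l A d (- t%:Z)) ->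
  exists x y z : int, ~~ [&& x == 0, y == 0 & z == 0] /\
    A%:Z * x ^+ 2 + d * y ^+ 2 = t%:Z * z ^+ 2.
Proof.
move=> A0 d0 t0 sA sd st h; have d0' : (0 < `|d|)%N by rewrite absz_gt0.
have [dp|dn] := ltP 0 d.
  have dE : d = `|d|%N by rewrite gez0_abs // ltW.
  by have := legendre_ternary A0 d0' t0 sA sd st; rewrite -dE; apply.
have dE : - d = `|d|%N by rewrite lez0_abs.
have [|x [y [z [n0 E]]]] := legendre_ternary t0 d0' A0 st sd sA.
  by move=> l pl l2; rewrite -dE; apply: locally_isotropicN_rot; apply: h.
exists z, y, x; split; first by apply: contra n0 => /and3P[-> -> ->].
by rewrite -E -dE; ring.
Qed.

(** * A rational point on the quadric *)

Section RationalPoint.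

Variables (p q : nat) (d : int).
Hypotheses (pp : prime p) (pq : prime q) (npq : p != q).
Hypotheses (d0 : d != 0) (sd : squarefree `|d|) (nd : forall x : int, x ^+ 2 != d).
Hypothesis npqd : forall x : int, x ^+ 2 != - (p * q)%N%:Z * d.

Let D1 : int := - (p * q)%N%:Z.
Let D2 : int := - (p * q)%N%:Z * d.
Let S := primes (2 * (p * q * `|d|))%N.

Let pq0 : (0 < p * q)%N. Proof. by rewrite muln_gt0 !prime_gt0. Qed.

Let memS l : prime l -> (l \in S) = [|| l == 2%N, (l %| p * q)%N | (l %| d)%Z].
Proof.
move=> pl; rewrite /S mem_primes pl !muln_gt0 (prime_gt0 pp) (prime_gt0 pq) absz_gt0 d0 /=.
by rewrite !(Euclid_dvdM _ _ pl) dvdn_prime2 // dvdzE.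
Qed.

Let primeS : all prime S.
Proof. by apply/allP => l; rewrite mem_primes => /andP[]. Qed.

Let squarefree_pq : squarefree (p * q).
Proof.
move=> l pl; rewrite lognM ?prime_gt0 // !logn_prime //.
by case: eqP => [->|_]; case: eqP => // e; move: npq; rewrite e eqxx.
Qed.

(** p t m1 = (p X)^2 - D1 Y^2 and p q t m2 = (p q Z)^2 - D2 W^2 are norms, so by [norm_odd_logn] the
    primes dividing m1, respectively m2, to an odd power split for D1, respectively D2. Both Jacobi
    symbols are therefore 1. *)
Lemma square_class_representative (t m1 m2 : nat) (X Y Z W : int) :
  (0 < t)%N -> squarefree t ->
  (forall l, prime l -> l \notin S -> ~~ (l %| t)%N) ->
  (forall l, l \in S ->
    [/\ ~~ (l %| m1)%N, ~~ (l %| m2)%N & (conductor l %| m1%:Z - m2%:Z)%Z]) ->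
  p%:Z * X ^+ 2 + q%:Z * Y ^+ 2 = (t * m1)%N%:Z ->
  (p * q)%N%:Z * Z ^+ 2 + d * W ^+ 2 = (t * m2)%N%:Z ->
  exists n, [/\ (0 < n)%N, forall l, l \in S -> (l %| m1%:Z - n%:Z)%Z &
    forall r, prime r -> odd (logn r n) -> leg D1 r = 1 /\ leg D2 r = 1].
Proof.
move=> t0 st tS mS E1 E2.
have D10 : D1 != 0 by rewrite oppr_eq0; move: pq0; clear; lia.
have D20 : D2 != 0 by rewrite mulf_neq0.
have S2 : 2%N \in S by rewrite memS.
have SD1 l : prime l -> (l %| D1)%Z -> l \in S.
  by move=> pl; rewrite /D1 memS // dvdzE abszN => ->; rewrite orbT.
have SD2 l : prime l -> (l %| D2)%Z -> l \in S.
  move=> pl; rewrite /D2 memS // !dvdzE abszM abszN Euclid_dvdM //=.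
  by case/orP => ->; rewrite ?orbT.
have oddm m : ~~ (2 %| m)%N -> odd m by rewrite dvdn2 negbK.
have [o1 o2] : odd m1 /\ odd m2 by have [h1 h2 _] := mS _ S2; split; apply: oddm.
have m10 : (0 < m1)%N by apply: odd_gt0.
have m20 : (0 < m2)%N by apply: odd_gt0.
have cop (m : nat) (D : int) : (0 < m)%N -> D != 0 ->
    (forall l, l \in S -> ~~ (l %| m)%N) -> (forall l, prime l -> (l %| D)%Z -> l \in S) ->
    coprime m `|D|.
  move=> m0 DN0 hm hD; rewrite coprime_has_primes ?absz_gt0 //.
  apply/hasPn => l; rewrite mem_primes => /and3P[pl _ lD] /=.
  by rewrite mem_primes pl m0 /=; apply: hm; apply: hD; rewrite // dvdzE.
have m1S l : l \in S -> ~~ (l %| m1)%N by case/mS.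
have m2S l : l \in S -> ~~ (l %| m2)%N by case/mS.
have logt r m : prime r -> (forall l, l \in S -> ~~ (l %| m)%N) ->
    (0 < m)%N -> odd (logn r m) -> r \notin S /\ logn r (t * m) = logn r m.
  move=> pr hm m0 om; have rS : r \notin S.
    by apply/negP => /hm rm; move: om; rewrite lognE (negbTE rm) !andbF.
  by split=> //; rewrite lognM // (lognE r t) (negbTE (tS r pr rS)) !andbF.
have logS r a : prime r -> r \notin S -> (0 < a)%N -> {subset primes a <= S} ->
    forall b, (0 < b)%N -> logn r (a * b) = logn r b.
  move=> pr rS a0 aS b b0; rewrite lognM // lognE pr a0 /=.
  by case: ifP => // ra; case/negP: rS; apply: aS; rewrite mem_primes pr a0.
have J1 : jac D1 m1 = 1.
  apply: (jac_one o1) => [|]; last exact: cop.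
  move=> r pr om; have [rS lt] := logt r m1 pr m1S m10 om.
  apply: (norm_odd_logn (a := p%:Z * X) (b := Y) pr); first by apply: contra rS; apply: SD1.
  have -> : (p%:Z * X) ^+ 2 - D1 * Y ^+ 2 = p%:Z * (t * m1)%N%:Z.
    by rewrite -E1 /D1 PoszM; ring.
  have pS : {subset primes p <= S}.
    by move=> l; rewrite primes_prime // inE => /eqP ->; rewrite memS // dvdn_mulr ?orbT.
  have tm0 : (0 < t * m1)%N by rewrite muln_gt0 t0.
  by rewrite abszM /= (logS r p pr rS (prime_gt0 pp) pS _ tm0) lt.
have J2 : jac D2 m2 = 1.
  apply: (jac_one o2) => [|]; last exact: cop.
  move=> r pr om; have [rS lt] := logt r m2 pr m2S m20 om.
  apply: (norm_odd_logn (a := (p * q)%N%:Z * Z) (b := W) pr).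
    by apply: contra rS; apply: SD2.
  have -> : ((p * q)%N%:Z * Z) ^+ 2 - D2 * W ^+ 2 = (p * q)%N%:Z * (t * m2)%N%:Z.
    by rewrite -E2 /D2; ring.
  have pqS : {subset primes (p * q)%N <= S}.
    by move=> l; rewrite mem_primes => /and3P[pl _ h]; rewrite memS // h orbT.
  have tm0 : (0 < t * m2)%N by rewrite muln_gt0 t0.
  by rewrite abszM /= (logS r _ pr rS pq0 pqS _ tm0) lt.
have modE l (D : nat) : l \in S -> (D %| conductor l)%N -> m1 = m2 %[mod D].
  move=> lS hD; have [_ _ h] := mS l lS; apply/eqP.
  have : (D %| m1%:Z - m2%:Z)%Z by apply: dvdz_trans h; rewrite dvdzE.
  by rewrite -eqz_mod_dvd !modz_nat.
(* The conductors were put into [local_match] for this: m1 and m2 agree modulo a period of the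
   symbol of D2. *)
have J3 : jac D2 m1 = 1.
  rewrite -J2; apply: jac_period => //; try exact: cop.
    exact: modE S2 _.
  by move=> l pl l2 lD; apply: (modE l); [exact: SD2|exact: dvd_conductor].
have nD1 (x : int) : x ^+ 2 != D1.
  apply: contraTneq (sqr_ge0 x) => ->; rewrite /D1 oppr_ge0 -ltNge.
  by move: pq0; clear; lia.
have nD12 (x : int) : x ^+ 2 != D1 * D2.
  have := nonsquare_mul_sqr (oner_neq0 int) nd x D10; rewrite mul1r.
  by rewrite [d * _](_ : _ = D1 * D2) // /D1 /D2; ring.
pose M := (8 * `|(D1 * D2)%R|)%N.
have M0 : (0 < M)%N by rewrite muln_gt0 absz_gt0 mulf_neq0.
have cM : coprime m1 M.
  rewrite /M coprimeMr; apply/andP; split.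
    by rewrite -[8%N]/(2 ^ 3)%N coprimeXr // coprimen2.
  by rewrite abszM coprimeMr !cop.
have [n [n0 nm hn]] := two_character_integer D10 D20 nD1 npqd nD12 M0 (dvdnn M) cM J1 J3.
exists n; split=> // l lS.
have lM : (l %| M)%N.
  have pl := allP primeS l lS; move: lS; rewrite memS //.
  rewrite /M /D2 /D1 !abszM !abszN /= => /or3P[/eqP ->|h|h].
  - exact: dvdn_mulr.
  - by rewrite dvdn_mull // dvdn_mulr.
  - by rewrite dvdn_mull // dvdn_mull // dvdn_mull.
have : (M %| m1%:Z - n%:Z)%Z by rewrite -eqz_mod_dvd !modz_nat eqz_nat nm.
by apply: dvdz_trans; rewrite dvdzE.
Qed.

(** Both binary forms represent one number c up to squares. Legendre's conditions hold at S by the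
    local points, at the other primes of c by the two characters, and are void elsewhere. *)
Theorem rational_point : (forall l, l \in S -> locally_solvable p q d l) ->
  exists x y z w : int, p%:Z * x ^+ 2 + q%:Z * y ^+ 2 != 0 /\
    p%:Z * x ^+ 2 + q%:Z * y ^+ 2 = (p * q)%N%:Z * z ^+ 2 + d * w ^+ 2.
Proof.
have p0 := prime_gt0 pp; have q0 := prime_gt0 pq.
have pz : 0 < p%:Z by []; have qz : 0 < q%:Z by [].
move=> /(semilocal_solution_gt0 pz qz (primes_uniq _) primeS).
case=> X [Y [Z [W [T10 T20 mT]]]].
have [t1 E1] : exists t1 : nat, p%:Z * X ^+ 2 + q%:Z * Y ^+ 2 = t1.
  by exists `|(p%:Z * X ^+ 2 + q%:Z * Y ^+ 2)%R|%N; rewrite gtz0_abs.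
have [t2 E2] : exists t2 : nat, p%:Z * q%:Z * Z ^+ 2 + d * W ^+ 2 = t2.
  by exists `|(p%:Z * q%:Z * Z ^+ 2 + d * W ^+ 2)%R|%N; rewrite gtz0_abs.
rewrite E1 E2 !ltz_nat in T10 T20 mT.
have [t [m1 [m2 [[t1E t2E] st tS mS]]]] := common_part primeS T10 T20 mT.
rewrite t1E in E1 T10; rewrite t2E -PoszM in E2.
have t0 : (0 < t)%N by move: T10; rewrite muln_gt0 => /andP[].
have [n [n0 mn hn]] := square_class_representative t0 st tS mS E1 E2.
have [f [k [nE k0 sf]]] := squarefree_decomp n0.
have f0 : (0 < f)%N by move: n0; rewrite nE muln_gt0 => /andP[].
have nS l : l \in S -> ~~ (l %| n)%N.
  move=> lS; have [lm _ _] := mS l lS; apply: contra lm => ln.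
  have : (l %| m1%:Z - n%:Z + n%:Z)%Z by rewrite rpredD ?mn // dvdzE.
  by rewrite subrK dvdzE.
have fS l : l \in S -> ~~ (l %| f)%N.
  by move=> /nS; apply: contra => h; rewrite nE dvdn_mulr.
have kS l : l \in S -> ~~ (l %| k)%N.
  by move=> /nS; apply: contra => h; rewrite nE dvdn_mull // dvdn_mulr.
(* The squarefree representative of t n modulo squares. *)
pose c := (t * f)%N.
have c0 : (0 < c)%N by rewrite muln_gt0 t0.
have sc : squarefree c.
  move=> l pl; rewrite lognM //; have [lS|lS] := boolP (l \in S).
    by rewrite (lognE l f) (negbTE (fS l lS)) !andbF addn0; apply: st.
  by rewrite (lognE l t) (negbTE (tS l pl lS)) !andbF; apply: sf.
have cS l : prime l -> l \notin S -> (l %| c)%N -> leg D1 l = 1 /\ leg D2 l = 1.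
  move=> pl lS; rewrite Euclid_dvdM // (negbTE (tS l pl lS)) /= => lf.
  apply: hn => //; rewrite nE lognM ?expn_gt0 ?k0 // lognX oddD oddM addbF.
  by rewrite (squarefree_logn f0 pl sf) lf.
(* The representation of t m1 at l in S yields one of t f, since
   t m1 is congruent to t f k^2. *)
have isotropic (A B x y : int) (m l : nat) : prime l -> l \in S ->
    ~~ ((l ^ 2)%N %| A)%Z -> ~~ ((l ^ 2)%N %| B)%Z ->
    A * x ^+ 2 + B * y ^+ 2 = (t * m)%N%:Z -> (l %| m%:Z - n%:Z)%Z ->
    locally_isotropic l A B (- c%:Z).
  move=> pl lS lA lB E lmn.
  have vE : A * x ^+ 2 + B * y ^+ 2 + - c%:Z * k%:Z ^+ 2 = t%:Z * (m%:Z - n%:Z).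
    by rewrite E nE /c !PoszM; ring.
  apply: (@locally_isotropic_sol l A B _ x y k) => //.
  - by rewrite rpredN dvdzE squarefree_ndvd.
  - by rewrite dvdzE kS.
  - by rewrite vE dvdz_mull.
  rewrite vE rpredN !dvdzE /= Euclid_dvdM // (negbTE (fS l lS)) orbF abszM.
  by move=> lt; rewrite expnS expn1 dvdn_mul.
have m2n l : l \in S -> (l %| m2%:Z - n%:Z)%Z.
  move=> lS; have [_ _ h] := mS l lS.
  have h' : (l %| m1%:Z - m2%:Z)%Z.
    by apply: dvdz_trans h; rewrite dvdzE /= dvd_conductor.
  have := rpredB (mn l lS) h'.
  by rewrite (_ : _ - _ = m2%:Z - n%:Z) //; ring.
have sqp r : prime r -> squarefree r.
  by move=> pr l pl; rewrite logn_prime //; case: eqP.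
have notS l : prime l -> l \notin S -> [/\ ~~ (l %| p)%N, ~~ (l %| q)%N & ~~ (l %| d)%Z].
  move=> pl; rewrite memS // Euclid_dvdM // !negb_or.
  by case/and3P=> _ /andP[-> ->] ->.
have dq0 : q%:Z != 0 by rewrite gt_eqF.
have [|x1 [y1 [z1 [n1 R1]]]] := represent_ternary p0 dq0 c0 (sqp p pp) (sqp q pq) sc.
  move=> l pl l2; have [lS|lS] := boolP (l \in S).
    by apply: (isotropic _ _ X Y m1) => //; rewrite ?mn // dvdzE squarefree_ndvd //; apply: sqp.
  have [lp lq ld] := notS l pl lS.
  apply: locally_isotropic_unit; rewrite ?dvdzE // ?abszN /= => lc.
  by apply: pair_zero_leg; rewrite ?dvdzE // -PoszM; case: (cS l pl lS lc).
have [|x2 [y2 [z2 [n2 R2]]]] := represent_ternary pq0 d0 c0 squarefree_pq sd sc.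
  move=> l pl l2; have [lS|lS] := boolP (l \in S).
    apply: (isotropic _ _ Z W m2); rewrite ?m2n // dvdzE squarefree_ndvd // ?absz_gt0 //.
  have [lp lq ld] := notS l pl lS.
  apply: locally_isotropic_unit => //.
    by rewrite dvdzE /= Euclid_dvdM // negb_or lp.
  rewrite dvdzE abszN /= => lc.
  by apply: pair_zero_leg; rewrite // -mulNr; case: (cS l pl lS lc).
have z1N : z1 != 0.
  apply: contraNneq n1 => z0; move: R1; rewrite z0 expr0n mulr0 eqxx andbT => /eqP.
  have ge0 (a u : int) : 0 < a -> 0 <= a * u ^+ 2.
    by move=> a0; apply: mulr_ge0; [exact: ltW | exact: sqr_ge0].
  rewrite paddr_eq0 ?ge0 // mulf_eq0 (gt_eqF pz) sqrf_eq0 => /andP[/= ->].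
  by rewrite mulf_eq0 (gt_eqF qz) sqrf_eq0.
(* The second form is anisotropic because -p q d is not a square; for z1 above, positivity of the
   first form was enough. Hence the two representations of c can be scaled to the common nonzero
   value c (z1 z2)^2. *)
have z2N : z2 != 0.
  apply: contraNneq n2 => z0; move: R2; rewrite z0 expr0n mulr0 eqxx andbT => R2.
  have k0' : (p * q)%N%:Z != 0 by rewrite gt_eqF.
  have [y20|y20] := eqVneq y2 0.
    move/eqP: R2; rewrite y20 expr0n mulr0 addr0 mulf_eq0 (negbTE k0') expf_eq0 /=.
    by move=> ->.
  have := nonsquare_mul_sqr k0' npqd x2 y20; case/eqP.
  have -> : ((p * q)%N%:Z * x2) ^+ 2 = (p * q)%N%:Z * ((p * q)%N%:Z * x2 ^+ 2) by ring.
  by rewrite -(addrK (d * y2 ^+ 2) (_ * x2 ^+ 2)) R2; ring.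
exists (x1 * z2), (y1 * z2), (x2 * z1), (y2 * z1).
have F1 : p%:Z * (x1 * z2) ^+ 2 + q%:Z * (y1 * z2) ^+ 2 = c%:Z * z1 ^+ 2 * z2 ^+ 2.
  by rewrite -R1; ring.
rewrite F1; split; first by rewrite !mulf_neq0 ?expf_neq0 // gt_eqF.
transitivity (c%:Z * z2 ^+ 2 * z1 ^+ 2); first by ring.
by rewrite -R2; ring.
Qed.

End RationalPoint.

(** * Splitting quaternion algebras *)

Section NormSplitting.

Variables (F : fieldType) (a X Y : F).

Local Notation b := (X ^+ 2 - a * Y ^+ 2).

Definition mx2 (c00 c01 c10 c11 : F) : 'M[F]_2 :=
  \matrix_(i, j) if (i : nat) == 0%N then if (j : nat) == 0%N then c00 else c01
                 else if (j : nat) == 0%N then c10 else c11.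

Lemma mx2P (M N : 'M[F]_2) : M 0 0 = N 0 0 -> M 0 1 = N 0 1 -> M 1 0 = N 1 0 ->
  M 1 1 = N 1 1 -> M = N.
Proof.
move=> h00 h01 h10 h11; apply/matrixP => i j.
have ord2 (k : 'I_2) : k = 0 \/ k = 1.
  by case: k => [[|[|//]] h]; [left|right]; apply: val_inj.
by case: (ord2 i) (ord2 j) => -> [] ->.
Qed.

(* e1 and e2 are sent to [[0, a], [1, 0]] and [[X, -aY], [Y, -X]]. *)
Definition quat_mx (x : quaternion a b) : 'M[F]_2 :=
  let: Quat x0 x1 x2 x3 := x in
  mx2 (x0 + X * x2 + a * Y * x3) (a * x1 - a * Y * x2 - a * X * x3)
      (x1 + Y * x2 + X * x3) (x0 - X * x2 - a * Y * x3).

Lemma quat_mx_linear : linear quat_mx.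
Proof.
by move=> c [x0 x1 x2 x3] [y0 y1 y2 y3]; apply: mx2P; rewrite !mxE /=; ring.
Qed.

Lemma quat_mx_monoid : monoid_morphism quat_mx.
Proof.
split; first by apply: mx2P; rewrite !mxE /=; ring.
by move=> [x0 x1 x2 x3] [y0 y1 y2 y3]; apply: mx2P;
   rewrite !mxE !big_ord_recl big_ord0 !mxE /=; ring.
Qed.

HB.instance Definition _ := GRing.isLinear.Build F (quaternion a b) 'M[F]_2 _ quat_mx
  quat_mx_linear.
HB.instance Definition _ := GRing.isMonoidMorphism.Build (quaternion a b) 'M[F]_2 quat_mx
  quat_mx_monoid.

(** A and B recover X x2 + a Y x3 and Y x2 + X x3, a linear system in x2, x3 of determinant b. *)
Definition mx_quat (M : 'M[F]_2) : quaternion a b :=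
  let A := (M 0 0 - M 1 1) / 2 in let B := (M 1 0 - M 0 1 / a) / 2 in
  Quat ((M 0 0 + M 1 1) / 2) ((M 1 0 + M 0 1 / a) / 2)
       ((X * A - a * Y * B) / b) ((X * B - Y * A) / b).

Lemma norm_splits : 2 != 0 :> F -> a != 0 -> b != 0 -> quaternion_splits a b.
Proof.
move=> n2 na nb; exists quat_mx; exists mx_quat.
  move=> [x0 x1 x2 x3]; rewrite /mx_quat !mxE /=.
  by congr Quat; field; rewrite ?nb ?na ?n2.
move=> M; apply: mx2P; rewrite !mxE /=; field; rewrite ?nb ?na ?n2 //.
Qed.

End NormSplitting.

Lemma square_norm_form (F : fieldType) (r q : F) : 2 != 0 :> F -> r != 0 ->
  exists X Y, X ^+ 2 - r ^+ 2 * Y ^+ 2 = q.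
Proof.
move=> n2 nr; exists ((q + 1) / 2), ((q - 1) / (2 * r)).
by field; rewrite nr n2.
Qed.

(* The norm form of F(sqrt p) is multiplicative, and the hypothesis reads
   N(s w + x sqrt p) = q N(y + z sqrt p). *)
Lemma norm_form_of_point (F : fieldType) (p q s x y z w : F) : 2 != 0 :> F ->
  p != 0 -> p * x ^+ 2 + q * y ^+ 2 != 0 ->
  p * x ^+ 2 + q * y ^+ 2 = p * q * z ^+ 2 + s ^+ 2 * w ^+ 2 ->
  exists X Y, X ^+ 2 - p * Y ^+ 2 = q.
Proof.
move=> n2 np nv E.
have [N0|N0] := eqVneq (y ^+ 2 - p * z ^+ 2) 0; last first.
  exists ((s * w * y - p * x * z) / (y ^+ 2 - p * z ^+ 2)).
  exists ((x * y - s * w * z) / (y ^+ 2 - p * z ^+ 2)).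
  have E1 : (s * w * y - p * x * z) ^+ 2 - p * (x * y - s * w * z) ^+ 2 =
      (y ^+ 2 - p * z ^+ 2) * (s ^+ 2 * w ^+ 2 - p * x ^+ 2) by ring.
  have E2 : s ^+ 2 * w ^+ 2 - p * x ^+ 2 = q * (y ^+ 2 - p * z ^+ 2).
    by rewrite -[s ^+ 2 * _](addKr (p * q * z ^+ 2)) -E; ring.
  move: N0 E1; rewrite {}E2; move: (y ^+ 2 - p * z ^+ 2) => N N0 E1.
  transitivity (((s * w * y - p * x * z) ^+ 2 - p * (x * y - s * w * z) ^+ 2) / N ^+ 2).
    by field.
  by rewrite E1; field.
(* If the norm of y + z sqrt p vanishes, p turns out to be a square in F; the norm form is then
   hyperbolic and represents everything. *)
have psq r : p = r ^+ 2 -> exists X Y, X ^+ 2 - p * Y ^+ 2 = q.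
  move=> pr; rewrite pr; apply: square_norm_form => //.
  by apply: contraNneq np => r0; rewrite pr r0 expr0n.
have yz : y ^+ 2 = p * z ^+ 2 by apply/eqP; rewrite -subr_eq0 N0.
have [z0|z0] := eqVneq z 0; last first.
  by apply: (psq (y / z)); rewrite exprMn yz exprVn mulfK ?expf_neq0.
move: yz E nv; rewrite z0 expr0n mulr0 => -> ; rewrite !mulr0 addr0 add0r => E.
rewrite mulf_eq0 (negbTE np) expf_eq0 /= => x0.
apply: (psq (s * w / x)).
by rewrite exprMn exprMn -E exprVn mulfK ?expf_neq0.
Qed.

(** * The discriminant of a quadratic field *)

Lemma rat_nonsquare (d : int) : (forall x : int, x ^+ 2 != d) ->
  forall x : rat, x ^+ 2 != d%:~R.
Proof.
move=> nd x; apply/eqP => E.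
have y0 : denq x != 0 by apply: denq_neq0.
have E' : numq x ^+ 2 = d * denq x ^+ 2.
  apply: (intr_inj (R := rat)); rewrite rmorphXn /= rmorphM /= rmorphXn /= -E -exprMn.
  by rewrite -{2}[x]divq_num_den divfK // intr_eq0.
by have := nonsquare_mul_sqr (oner_neq0 int) nd (numq x) y0; rewrite mul1r E' eqxx.
Qed.

(** An off-diagonal entry of M^2 is b times the trace; if the trace were nonzero, b = 0 would make d
    the square of a diagonal entry. The size is a variable since it will be the dimension of K. *)
Lemma trace_sqr_scalar n (M : 'M[rat]_n) (d : int) : n = 2%N ->
  (forall x : int, x ^+ 2 != d) -> M *m M = (d%:~R)%:M -> \tr M = 0.
Proof.
move=> n2; subst n => /rat_nonsquare nd /matrixP E.
have E00 := E 0 0; have E01 := E 0 1; have E10 := E 1 0; have E11 := E 1 1.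
rewrite !mxE !big_ord_recl !big_ord0 /= in E00 E01 E10 E11.
rewrite /mxtrace !big_ord_recl big_ord0 /= addr0.
have l01 : lift ord0 ord0 = 1 :> 'I_2 by apply: val_inj.
rewrite !l01 ?mulr1n ?mulr0n ?addr0 in E00 E01 E10 E11 *.
move: E00 E01 E10 E11; move: (M 0 0) (M 0 1) (M 1 0) (M 1 1) => a b c e E00 E01 E10 E11.
have [//|t0] := eqVneq (a + e) 0.
have b0 : b = 0 by apply: (mulfI t0); rewrite mulr0 -[RHS]E01; ring.
by case/eqP: (nd a); rewrite -[RHS]E00 b0; ring.
Qed.

Lemma det_mx2 (R : comNzRingType) (A : 'M[R]_2) :
  \det A = A 0 0 * A 1 1 - A 0 1 * A 1 0.
Proof.
rewrite (expand_det_row A 0) !big_ord_recl big_ord0 /cofactor !det_mx11 !mxE /=.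
have l01 : lift ord0 ord0 = 1 :> 'I_2 by apply: val_inj.
have l10 : lift (1 : 'I_2) (0 : 'I_1) = 0 :> 'I_2 by apply: val_inj.
by rewrite !l01 l10 expr0 mul1r addr0 expr1 mulN1r mulrN.
Qed.

Section QuadraticField.

Variables (d : int) (K : fieldExtType rat) (s : K).
Hypotheses (nd : forall x : int, x ^+ 2 != d) (sE : s ^+ 2 = d%:~R).
Hypothesis genK : <<1; s>>%VS = {:K}%VS.

Lemma intr_alg (n : int) : n%:~R = (n%:~R : rat)%:A :> K.
Proof. by rewrite -in_algE rmorph_int. Qed.

Lemma quadratic_dim : \dim {:K} = 2%N.
Proof.
have s1 : s \notin 1%VS.
  apply/negP => /vlineP[c sc]; case/eqP: (rat_nonsquare nd c).
  apply: (fmorph_inj (in_alg K)).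
  by rewrite rmorphXn rmorph_int /= -sc sE.
have root_s : root ('X^2 - (d%:~R)%:P) s by rewrite /root !hornerE sE subrr.
have over : 'X^2 - (d%:~R)%:P \is a polyOver (1%AS : {subfield K}).
  by rewrite rpredB ?rpredX ?polyOverX // polyOverC rpred_int.
have := dvdp_leq _ (minPoly_dvdp over root_s).
rewrite size_XnsubC // size_minPoly => /(_ _).
have deg1 := adjoin_deg_eq1 1 s.
rewrite -genK dim_Fadjoin dimv1 muln1.
have : adjoin_degree 1 s != 1%N by rewrite deg1.
have : (0 < adjoin_degree 1 s)%N by [].
rewrite -size_poly_eq0 size_XnsubC // => h1 h2 h3.
by have := h3 isT; move: h1 h2; case: (adjoin_degree 1 s) => [|[|[|]]].
Qed.

Lemma amulr_linear c (x y : K) : amulr (c *: x + y) = c *: amulr x + amulr y :> 'End(K).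
Proof. by apply/lfunP => u; do !rewrite lfunE /=; rewrite mulrDr -scalerAr. Qed.

Lemma mxof_amulr_alg (c : rat) :
  passmx.mxof (vbasis {:K}) (vbasis {:K}) (amulr (c%:A : K)) = c%:M.
Proof.
have -> : amulr (c%:A : K) = c *: \1%VF.
  by apply/lfunP => u; do !rewrite lfunE /=; rewrite -scalerAr mulr1.
rewrite (GRing.scalable_linear (passmx.mxof_linear _ _)) passmx.mxof1 /= ?scalemx1 //.
exact: basis_free (vbasisP _).
Qed.

Lemma field_trace_linear : linear (@field_trace K : K -> rat^o).
Proof.
move=> c x y; rewrite /field_trace amulr_linear passmx.mxof_linear.
by rewrite mxtraceD mxtraceZ. Qed.

Lemma field_trace_int (n : int) : field_trace (n%:~R : K) = 2 * n%:~R.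
Proof.
by rewrite /field_trace intr_alg mxof_amulr_alg mxtrace_scalar quadratic_dim mulr_natl.
Qed.

Lemma field_trace_root : field_trace s = 0.
Proof.
apply: (trace_sqr_scalar quadratic_dim nd).
rewrite -passmx.mxof_comp ?vbasisP //.
have -> : (amulr s \o amulr s)%VF = amulr (s * s) by rewrite rmorphM.
by rewrite -expr2 sE intr_alg mxof_amulr_alg.
Qed.

Lemma integral_root : ring_of_integers s.
Proof.
exists ('X^2 - d%:P); first by rewrite monicXnsubC.
rewrite rmorphB /= map_polyXn map_polyC /root !hornerE /= sE subrr //.
Qed.

(** Change of basis: (1, s) has discriminant 4d and integral coordinates in an integral basis.
    Equality up to a square determines the symbols, and no explicit integral basis has to be
    found. *)
Lemma discriminant_square_class (DK : int) : is_discriminant K DK ->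
  exists k : int, 4 * d = DK * k ^+ 2.
Proof.
case=> w [wb wint] DE.
have sw : size w = 2%N by case/andP: wb => /eqP sp /eqP <-; rewrite sp quadratic_dim.
have [c cE] : exists c : 'I_(size w) -> int, 1 = \sum_(i < size w) w`_i *~ c i.
  by apply/wint; apply: integral1.
have [e eE] := (wint s).1 integral_root.
pose r (j : 'I_2) : K := if j == 0 then 1 else s.
pose C : 'M[int]_(2, size w) := \matrix_(j, i) if j == 0 then c i else e i.
have rE j : r j = \sum_(i < size w) w`_i *~ C j i.
  rewrite /r; have [->|j0] := eqVneq j 0; [rewrite cE|rewrite eE];
    by apply: eq_bigr => i _; rewrite mxE ?(negbTE j0).
pose G := \matrix_(i < size w, j < size w) field_trace (w`_i * w`_j).
pose T := GRing.isLinear.Build rat K rat^o _ _ field_trace_linear.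
pose L : {linear K -> rat^o} := HB.pack (@field_trace K : K -> rat^o) T.
have tr_sum (f : 'I_(size w) -> K) (g : 'I_(size w) -> int) :
    field_trace (\sum_i f i *~ g i) = \sum_i (g i)%:~R * field_trace (f i).
  rewrite -[field_trace _]/(L _) linear_sum; apply: eq_bigr => i _.
  by rewrite raddfMz -mulrzl.
have gram : \matrix_(i < 2, j < 2) field_trace (r i * r j) =
    map_mx intr C *m G *m (map_mx intr C)^T.
  apply/matrixP => i j; rewrite !mxE (rE j) mulr_sumr.
  under eq_bigr => m _ do rewrite mulrzAr.
  rewrite tr_sum; apply: eq_bigr => m _; rewrite !mxE mulrC; congr (_ * _).
  rewrite rE mulr_suml; under eq_bigr => k _ do rewrite mulrzAl.
  by rewrite tr_sum; apply: eq_bigr => k _; rewrite !mxE.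
have detG : \det G = DK%:~R by rewrite DE.
have : \det (\matrix_(i < 2, j < 2) field_trace (r i * r j)) = 4 * d%:~R.
  rewrite det_mx2 !mxE /r /= mulr1 mul1r -expr2 sE field_trace_root.
  have -> : field_trace (1 : K) = 2 := etrans (field_trace_int 1) (mulr1 2).
  by rewrite field_trace_int; ring.
rewrite gram; move: C {rE gram} (G) detG; rewrite sw => C H detG.
rewrite !det_mulmx det_tr detG det_map_mx => E.
exists (\det C); apply: (intr_inj (R := rat)).
by rewrite !rmorphM /= -[4%:~R * _]/(4 * d%:~R) -E; ring.
Qed.

End QuadraticField.

Lemma legendre_eq1 (n : int) (l : nat) : prime l -> leg n l = 1 -> legendre n l = 1.
Proof.
move=> pl /eqP /(leg_eq1P _ pl) [ln [x hx]]; rewrite /legendre (negbTE ln).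
have l0 : l%:Z != 0 by have := prime_gt0 pl; clear; lia.
have hy : (`|(x %% l)%Z| < l)%N.
  by have := ltz_pmod x (prime_gt0 pl : 0 < l%:Z); have := modz_ge0 x l0; clear; lia.
case: ifP => // /existsP[]; exists (Ordinal hy) => /=.
by rewrite gez0_abs ?modz_ge0 // modzXm eqz_mod_dvd.
Qed.

(** If d has symbol 1, so has 4d; hence l does not divide k, and the symbol of k^2 is 1. *)
Lemma leg_discriminant (d DK k : int) (l : nat) : prime l -> (2 < l)%N ->
  4 * d = DK * k ^+ 2 -> legendre DK l <> 1 -> leg d l <> 1.
Proof.
move=> pl l2 E hl ld; apply: hl; apply: legendre_eq1 => //.
have l4 : ~~ (l %| 2)%Z.
  by rewrite dvdzE /=; apply/negP => /dvdn_leq; move: l2; clear; lia.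
have := congr1 (leg^~ l) E; rewrite /= -[4 * d]/(2 * 2 * d) expr2 !legM // ld.
have [-> | ->] := leg_unitE pl l4.
all: have [lk | lk] := boolP (l %| k)%Z;
  [have -> : leg k l = 0 by apply/eqP; rewrite leg_eq0 // lk|]; rewrite ?mulr0 //.
all: by have [-> | ->] := leg_unitE pl lk; rewrite ?mulrNN !mulr1 => ->.
Qed.

Lemma square_free_squarefree (d : int) : d != 0 -> square_free d -> squarefree `|d|.
Proof.
move=> d0 sd r pr; rewrite leqNgt -pfactor_dvdn ?absz_gt0 //; apply/negP => h.
have /sd : (r%:Z ^+ 2 %| d)%Z by rewrite dvdzE abszX.
by rewrite /GRing.unit /= => /orP[] /eqP[] r1; move: pr; rewrite ?r1.
Qed.

Lemma square_free_nonsquare (d : int) : d != 1 -> square_free d -> forall x : int, x ^+ 2 != d.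
Proof.
move=> d1 sd x; apply/eqP => E; have /sd : (x ^+ 2 %| d)%Z by rewrite E dvdzz.
rewrite /GRing.unit /= => /orP[] /eqP x1; move: d1; rewrite -E x1 ?sqrrN expr1n eqxx //.
Qed.

Lemma locally_solvable_everywhere (p q : nat) (d : int) (l : nat) :
  d != 0 -> square_free d -> (d %% 8)%Z != 1 -> prime p -> prime q -> (2 < q)%N -> p != q ->
  ((2 < p)%N -> leg d p <> 1) -> leg d q <> 1 -> prime l -> locally_solvable p q d l.
Proof.
move=> d0 sd d8 pp pq q2 npq lp lq pl; have sf := square_free_squarefree d0 sd.
have nd2 r : prime r -> ~~ ((r ^ 2)%N %| d)%Z.
  by move=> pr; rewrite dvdzE /= squarefree_ndvd // absz_gt0.
have oddp r : prime r -> (2 < r)%N -> odd r.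
  by move=> pr; apply: contraTT => e; have := even_prime pr; rewrite (negbTE e) => -[->|].
have [l2 | l2] := leqP l 2.
  have -> : l = 2%N by have := prime_gt1 pl; move: l2; clear; lia.
  apply: locally_solvable2; last exact: d8.
  - by case: (even_prime pp) => h; [left|right].
  - exact: oddp.
  - exact: (nd2 2%N).
have [lE | nlp] := eqVneq l p.
  rewrite lE in l2 *; apply: locally_solvable_ramified; rewrite ?nd2 // ?lp //.
    by rewrite dvdzE /= dvdn_prime2.
  exact: lp.
have [lE | nlq] := eqVneq l q.
  rewrite lE; apply: locally_solvableC; apply: locally_solvable_ramified; rewrite ?nd2 //.
  by rewrite dvdzE /= dvdn_prime2 // eq_sym.
by apply: locally_solvable_unit; rewrite ?dvdzE /= ?dvdn_prime2.
Qed.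

Lemma quaternion_splits_Qsqrt (d : int) (K : fieldExtType rat) (p q : nat) :
  d != 0 -> d != 1 -> square_free d -> (d %% 8)%Z != 1 -> is_Qsqrt d K ->
  prime p -> prime q -> (2 < q)%N -> p != q ->
  ((2 < p)%N -> leg d p <> 1) -> leg d q <> 1 ->
  quaternion_splits (p%:R : K) (q%:R : K).
Proof.
move=> d0 d1 sd d8 [s sE _] pp pq q2 npq lp lq.
have char0 n : (0 < n)%N -> n%:R != 0 :> K.
  by move=> n0; rewrite -(rmorph_nat (in_alg K)) fmorph_eq0 pnatr_eq0 -lt0n.
have p0 := char0 p (prime_gt0 pp); have q0 := char0 q (prime_gt0 pq).
have n2 := char0 2 isT.
have intr0 (n : int) : (n%:~R == 0 :> K) = (n == 0).
  by rewrite -(rmorph_int (in_alg K)) fmorph_eq0 intr_eq0.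
suff [X [Y XY]] : exists X Y : K, X ^+ 2 - p%:R * Y ^+ 2 = q%:R.
  by rewrite -XY; apply: norm_splits => //; rewrite XY.
have s0 : s != 0 by apply: contraNneq d0 => s0; rewrite -intr0 -sE s0 expr0n.
(* If -p q d = c^2, then -p q = (c/s)^2 in K, so q = -p Y^2 with Y = c/(s p). This case is excluded
   from [rational_point], whose second character would be trivial. *)
have [[c cE] | nsq] := pselect (exists c : int, c ^+ 2 = - (p * q)%N%:Z * d).
  exists 0, (c%:~R / (s * p%:R)); rewrite expr0n /= sub0r.
  have cK : (c%:~R : K) ^+ 2 = - (p%:R * q%:R) * s ^+ 2.
    by rewrite -rmorphXn cE /= rmorphM rmorphN /= sE -natrM.
  transitivity (- (c%:~R ^+ 2 / (s ^+ 2 * p%:R))); first by field; rewrite p0 s0.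
  by rewrite cK; field; rewrite p0 s0.
have [||x [y [z [w [nv E]]]]] := rational_point pp pq npq d0
  (square_free_squarefree d0 sd) (square_free_nonsquare d1 sd) _ _.
- by move=> x; apply/eqP => e; apply: nsq; exists x.
- by move=> l; rewrite mem_primes => /and3P[pl _ _]; exact: locally_solvable_everywhere d0 sd d8 pp pq q2 npq lp lq pl.
apply: (@norm_form_of_point K _ _ s x%:~R y%:~R z%:~R w%:~R) => //.
  move: nv; rewrite -intr0 !(rmorphD, rmorphXn, rmorphM) //=.
have := congr1 (intr : int -> K) E.
by rewrite !(rmorphD, rmorphXn, rmorphM) /= sE.
Qed.

Theorem theorem3p1 (d : int) (hd0 : d != 0) (hd1 : d != 1)
    (hdsf : square_free d) (hd8 : (d != 1 %[mod 8])%Z)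
    (p q : nat) (hp : prime p) (hq : prime q) (hq3 : (3 <= q)%N) (hpq : p != q)
    (K : fieldExtType rat) (hK : is_Qsqrt d K)
    (DK : int) (hDK : is_discriminant K DK) :
  ((3 <= p)%N -> legendre DK p <> 1 -> legendre DK q <> 1 ->
     quaternion_splits (p%:R : K) (q%:R : K))
  /\
  (p = 2%N -> legendre DK q <> 1 ->
     quaternion_splits (2%:R : K) (q%:R : K)).
Proof.
have nsq := square_free_nonsquare hd1 hdsf.
have [s sE genK] := hK.
have [k kE] := discriminant_square_class nsq sE genK hDK.
have leg_ne r : prime r -> (2 < r)%N -> legendre DK r <> 1 -> leg d r <> 1.
  by move=> pr r2; apply: leg_discriminant kE.
split=> [p3 lp lq | p2 lq].
  by apply: (quaternion_splits_Qsqrt hd0 hd1 hdsf hd8 hK) => // [_|]; apply: leg_ne.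
subst p; apply: (quaternion_splits_Qsqrt hd0 hd1 hdsf hd8 hK hp) => //.
exact: leg_ne.
Qed.
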